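(* For every wave function $\psi(x,z)$ in Wilson's adelic Grassmannian $\mathrm{Gr}^{\mathrm{ad}}$, fixed under the involution $ac$ of $\mathrm{Gr}^{\mathrm{ad}}$, the integral operator $\mathcal{E}_\psi\mathcal{E}_\psi^*$ on $L^2(t,\infty)$ reflects a (non-constant) differential operator $R(z,\partial_z)\in\mathcal{F}_z(\psi)$ of order at most $2\min(d_1,d_2)$, where $d_1$ and $d_2$ are the degree and codegree of $\psi(x,z)$.
   Context: Operators: with real truncation parameters $s,t$, $$(\mathcal{E}_\psi f)(z)=\int_s^\infty\psi(y,z)f(y)\,dy\ (z\ge t),\qquad(\mathcal{E}_\psi^*f)(x)=\int_t^\infty\overline{\psi(x,w)}f(w)\,dw\ (x\ge s),$$ so that $$(\mathcal{E}_\psi\mathcal{E}_\psi^*f)(z)=\int_t^\infty K_\psi(z,w)f(w)\,dw,\qquad K_\psi(z,w)=\int_s^\infty\psi(y,z)\overline{\psi(y,w)}\,dy,$$ viewed as an operator on $L^2(t,\infty)$. KP wave functions (at zero higher times) are normalized as $\psi(x,z)=\big(1+\sum_{j\ge1}a_j(x)z^{-j}\big)e^{-xz}$. Wave functions in $\mathrm{Gr}^{\mathrm{ad}}$ are precisely the KP wave functions $\psi(x,z)$ such that $$\psi(x,z)=\frac{1}{p(x)q(z)}P(x,\partial_x)\cdot e^{-xz},\qquad e^{-xz}=\frac{1}{\widetilde p(x)\widetilde q(z)}\widetilde P(x,\partial_x)\cdot\psi(x,z)$$ for some differential operators $P(x,\partial_x)$, $\widetilde P(x,\partial_x)$ with polynomial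 coefficients and polynomials $p(x),\widetilde p(x),q(z),\widetilde q(z)$. The orders of $P$ and $\widetilde P$ are called the degree $d_1$ and codegree $d_2$ of $\psi$, respectively. Involutions: the adjoint involution is $a(\psi)=\psi^*$, defined as follows. Write $\psi=W\cdot e^{-xz}$ with $W=1+\sum_{j\ge1}w_j(x)\partial_x^{-j}$, where $\partial_x^{-j}\cdot e^{-xz}=(-z)^{-j}e^{-xz}$. Then $\psi^*(x,z)=(W^* )^{-1}\cdot e^{-xz}$, where $W^*$ is the formal adjoint. Equivalently, $\psi^*(x,z)=\frac{1}{\widetilde q(-z)}\widetilde P^*(x,\partial_x)\cdot\frac{e^{-xz}}{\widetilde p(x)}$, with $\widetilde P^*$ the formal adjoint of $\widetilde P$. The Schwartz involution is $c(\psi)(x,z)=\overline{\psi(\overline x,\overline z)}$. Fixed under $ac$ means $a(c(\psi))=\psi$. Right generalized Fourier algebra: $\mathcal{F}_z(\psi)$ is the algebra of differential operators $R(z,\partial_z)$ for which there exists a differential operator $L(x,\partial_x)$ with $L(x,\partial_x)\cdot\psi(x,z)=R(z,\partial_z)\cdot\psi(x,z)$. Reflection: for $R(z,\partial_z)=\sum_j a_j(z)\partial_z^j$, put $R(-z,-\partial_z)=\sum_j(-1)^ja_j(-z)\partial_z^j$. An integral operator $T$ acting on $L^2(\Gamma)$, for a contour $\Gamma\subset\mathbb{C}$, is said to reflect $R(z,\partial_z)$ if $T\circ R(-z,-\partial_z)=R(z,\partial_z)\circ T$ on a dense subspace of $L^2(\Gamma)$. Non-constant means not a scalar multiple of the 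identity.
   Formalization: Assumes min(d1,d2) > 0, excluding only ψ = e^{-xz} with degree or codegree 0, where no non-constant operator of order 0 is reflected; also makes explicit that ψ has no poles on the truncated ranges and that E_ψ and its adjoint are defined on L². *)

(* Defs.v *)
(* MathComp / MathComp-Analysis. *)
From HB Require Import structures.
From mathcomp Require Import all_boot all_order all_algebra.
From mathcomp Require Import ring complex.

Set Implicit Arguments.
Unset Strict Implicit.
Unset Printing Implicit Defensive.

Import Order.TTheory GRing.Theory Num.Theory.

Local Open Scope ring_scope.
Local Open Scope complex_scope.

Notation "f %:F" := (@FracField.tofrac _ f) : ring_scope.

(** * The differential field C(x) *)

Definition ratfun (R : rcfType) := {fraction {poly R[i]}}.

Section RationalFunctions.
Variable R : rcfType.
Implicit Types (f : ratfun R) (n d : {poly R[i]}).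

Definition rderiv f : ratfun R :=
  let n := \n_(repr f) in let d := \d_(repr f) in
  (n^`() * d - n * d^`())%:F / (d ^+ 2)%:F.

(* conjugation of the coefficients: the conjugate of f at the conjugate of x *)
Definition rconj f : ratfun R :=
  (map_poly (@conjc R) \n_(repr f))%:F / (map_poly (@conjc R) \d_(repr f))%:F.

Lemma ratfun_numden f : f = (\n_(repr f))%:F / (\d_(repr f))%:F.
Proof.
have d0 : (\d_(repr f))%:F != 0 :> ratfun R.
  by rewrite tofrac_eq0; exact: denom_ratioP.
apply: (mulIf d0); rewrite divfK //.
rewrite -[X in X * _ = _]reprK; set r := repr f; clearbody r.
unlock FracField.tofrac; rewrite -[LHS]FracField.pi_mul.
apply/eqmodP; rewrite /= FracField.equivfE /FracField.mulf.
by rewrite !numden_Ratio ?mulf_neq0 ?oner_neq0 ?denom_ratioP // !mulr1 mulrC.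
Qed.

Lemma ratfun_eq n d n' d' : d != 0 -> d' != 0 ->
  (n%:F / d%:F == n'%:F / d'%:F :> ratfun R) = (n * d' == n' * d).
Proof.
move=> d0 d'0; rewrite eqr_div ?tofrac_eq0 // -!tofracM.
by rewrite tofrac_eq.
Qed.

(* the two operations do not depend on the fraction that represents f *)
Lemma rderivE n d : d != 0 ->
  rderiv (n%:F / d%:F) = (n^`() * d - n * d^`())%:F / (d ^+ 2)%:F.
Proof.
move=> d0; rewrite /rderiv; set f := n%:F / d%:F.
have d'0 : \d_(repr f) != 0 by exact: denom_ratioP.
have /eqP := ratfun_numden f; rewrite {1}/f ratfun_eq //.
move: (\n_(repr f)) (\d_(repr f)) d'0 => n' d' d'0 /eqP e.
apply/eqP; rewrite ratfun_eq ?expf_neq0 //; apply/eqP.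
have e' : n^`() * d' + n * d'^`() = n'^`() * d + n' * d^`() by rewrite -!derivM e.
have E : n^`() * d' = n'^`() * d + n' * d^`() - n * d'^`() by rewrite -e' addrK.
apply/eqP; rewrite -subr_eq0; apply/eqP.
transitivity (d * d' * (n'^`() * d + n' * d^`() - n * d'^`() - n^`() * d')
   + d'^`() * d * (n * d' - n' * d) + d^`() * d' * (n * d' - n' * d)).
  by rewrite !expr2; ring.
by rewrite E e !subrr !mulr0 !addr0.
Qed.

Lemma rconjE n d : d != 0 ->
  rconj (n%:F / d%:F) = (map_poly (@conjc R) n)%:F / (map_poly (@conjc R) d)%:F.
Proof.
move=> d0; rewrite /rconj; set f := n%:F / d%:F.
have d'0 : \d_(repr f) != 0 by exact: denom_ratioP.
have /eqP := ratfun_numden f; rewrite {1}/f ratfun_eq //.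
move: (\n_(repr f)) (\d_(repr f)) d'0 => n' d' d'0 /eqP e.
apply/eqP; rewrite ratfun_eq ?map_poly_eq0 //.
by rewrite -!rmorphM e.
Qed.

End RationalFunctions.

(** * Formal wave functions *)

(* [u] stands for (\sum_m (u m)(x) z^m) e^{-xz}: the exponential is implicit.
   Every [u] below has [u m = 0] for m large. *)
Definition formal (R : rcfType) := int -> ratfun R.

(* \sum_k c_k(x) d_x^k, or \sum_k c_k(z) d_z^k: a polynomial in the derivation,
   whose coefficients are written to the left *)
Definition diffop (R : rcfType) := {poly {poly R[i]}}.

Section FormalWaves.
Variable R : rcfType.
Implicit Types (u psi phi : formal R) (P L Q : diffop R) (p q : {poly R[i]}).

Definition diffop_order P : nat := (size P).-1.

Definition fexp : formal R := fun m => (m == 0)%:R.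

Definition fmulx p u : formal R := fun m => p%:F * u m.
Definition fmulz q u : formal R :=
  fun m => \sum_(i < size q) (q`_i)%:P%:F * u (m - i%:Z).

(* d_x (f z^m e^{-xz}) = (f' z^m - f z^(m+1)) e^{-xz} *)
Definition fdx u : formal R := fun m => rderiv (u m) - u (m - 1).
(* d_z (f z^m e^{-xz}) = (m f z^(m-1) - x f z^m) e^{-xz} *)
Definition fdz u : formal R :=
  fun m => (m + 1)%:~R * u (m + 1) - 'X%:F * u m.

Definition actx P u : formal R :=
  fun m => \sum_(k < size P) fmulx P`_k (iter k fdx u) m.
Definition actz P u : formal R :=
  fun m => \sum_(k < size P) fmulz P`_k (iter k fdz u) m.

(* psi = (1 + \sum_(j >= 1) a_j(x) z^-j) e^{-xz}.  At zero higher times this is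
   the only condition on a KP wave function: the hierarchy can be solved
   formally from any such initial value. *)
Definition kp_wave psi : Prop :=
  psi 0 = 1 /\ forall m : int, 0 < m -> psi m = 0.

(* psi = (p(x) q(z))^-1 P . e^{-xz} *)
Definition from_exp psi P p q : Prop :=
  [/\ p != 0, q != 0 & actx P fexp =1 fmulx p (fmulz q psi)].
(* e^{-xz} = (p(x) q(z))^-1 P . psi *)
Definition to_exp psi P p q : Prop :=
  [/\ p != 0, q != 0 & actx P psi =1 fmulx p (fmulz q fexp)].

(** ** Involutions *)

(* [A] stands for \sum_j (A j)(x) d_x^-j *)
Definition psido := nat -> ratfun R.
Implicit Types A B : psido.

(* the coefficient 'C(-i, k) of d^-i f = \sum_k 'C(-i, k) f^(k) d^(-i-k) *)
Definition negbin (i k : nat) : ratfun R := (-1) ^+ k * 'C((i + k).-1, k)%:R.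

Definition psido1 : psido := fun n => (n == 0)%:R.
Definition psidoM A B : psido := fun n =>
  \sum_(i < n.+1) \sum_(k < (n - i).+1)
    A i * (negbin i k * iter k (@rderiv R) (B (n - i - k)%N)).
(* (f d^-i)^* = (-1)^i d^-i f *)
Definition psido_adj A : psido := fun n =>
  \sum_(i < n.+1)
    (-1) ^+ i * (negbin i (n - i) * iter (n - i) (@rderiv R) (A i)).

(* the W with psi = W . e^{-xz}, where d_x^-j . e^{-xz} = (-z)^-j e^{-xz} *)
Definition dressing psi : psido := fun j => (-1) ^+ j * psi (- j%:Z).

(* phi = a(psi), i.e. phi = (W^* )^-1 . e^{-xz} for psi = W . e^{-xz} *)
Definition adjoint_wave psi phi : Prop :=
  [/\ kp_wave phi,
      psidoM (psido_adj (dressing psi)) (dressing phi) =1 psido1 &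
      psidoM (dressing phi) (psido_adj (dressing psi)) =1 psido1].

(* c(psi) *)
Definition schwartz_wave psi : formal R := fun m => rconj (psi m).

Definition ac_fixed psi : Prop := adjoint_wave (schwartz_wave psi) psi.

(** ** The right generalized Fourier algebra *)

(* a differential operator [denominator]^-1 [numerator] with rational
   coefficients *)
Record ratdiffop := RatDiffop {
  numerator : diffop R;
  denominator : {poly R[i]};
  denominator_neq0 : denominator != 0 }.
Implicit Type D : ratdiffop.

Definition rorder D : nat := diffop_order (numerator D).

Definition scalar_op D : Prop :=
  exists c : R[i], numerator D = (c *: denominator D)%:P.

(* L . psi = D . psi with L and D cleared of their denominators *)
Definition right_fourier psi D : Prop := exists L : ratdiffop,
  fmulz (denominator D) (actx (numerator L) psi) =1
  fmulx (denominator L) (actz (numerator D) psi).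

End FormalWaves.

(** * Integral operators *)

(* \d_ of the fractions used above is shadowed from here on *)
From mathcomp Require Import all_classical all_reals all_analysis.
Import numFieldNormedType.Exports.
Local Open Scope classical_set_scope.

Section ComplexFunctions.
Variable R : realType.
Local Notation mu := (@lebesgue_measure R).
Implicit Types (A B : set R) (f g : R -> R[i]).

Definition cderiv f : R -> R[i] :=
  fun x => ((fun y => complex.Re (f y))^`() x) +i* ((fun y => complex.Im (f y))^`() x).

Definition cderivable f x : Prop :=
  derivable (fun y => complex.Re (f y)) x 1 /\ derivable (fun y => complex.Im (f y)) x 1.

Definition cderivable_n n f x : Prop :=
  forall k, (k < n)%N -> cderivable (iter k cderiv f) x.

Definition cintegrable A f : Prop :=
  mu.-integrable A (fun x => (complex.Re (f x))%:E) /\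
  mu.-integrable A (fun x => (complex.Im (f x))%:E).

Definition cintegral A f : R[i] :=
  (\int[mu]_(x in A) complex.Re (f x)) +i* (\int[mu]_(x in A) complex.Im (f x)).

Definition sqnormL2 A f : \bar R :=
  (\int[mu]_(x in A) (complex.Re (f x) ^+ 2 + complex.Im (f x) ^+ 2)%:E)%E.

Definition L2 A : set (R -> R[i]) := [set f |
  [/\ measurable_fun A (fun x => complex.Re (f x)),
      measurable_fun A (fun x => complex.Im (f x)) &
      (sqnormL2 A f < +oo)%E]].

Definition dense_subspace A (D : set (R -> R[i])) : Prop :=
  [/\ D `<=` L2 A,
      D (fun=> 0),
      forall (a : R[i]) f g, D f -> D g -> D (fun x => a * f x + g x) &
      forall g (e : R), L2 A g -> 0 < e ->
        exists2 f, D f & (sqnormL2 A (fun x => (f x - g x)%R) < e%:E)%E].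

Definition integral_op A (k : R -> R -> R[i]) f : R -> R[i] :=
  fun z => cintegral A (fun y => k z y * f y).

Definition integral_op_on_L2 A B (k : R -> R -> R[i]) : Prop :=
  forall f, L2 A f ->
    {ae mu, forall z, B z -> cintegrable A (fun y => k z y * f y)} /\
    L2 B (integral_op A k f).

(** ** The operators of a wave function *)

Variables (psi : R -> R -> R[i]) (s t : R).

Definition Epsi : (R -> R[i]) -> R -> R[i] :=
  integral_op `]s, +oo[ (fun z y => psi y z).

Definition Epsi_adj : (R -> R[i]) -> R -> R[i] :=
  integral_op `]t, +oo[ (fun x w => conjc (psi x w)).

Definition EEpsi_adj f : R -> R[i] := Epsi (Epsi_adj f).

Definition truncation_defined : Prop :=
  integral_op_on_L2 `]s, +oo[ `]t, +oo[ (fun z y => psi y z) /\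
  integral_op_on_L2 `]t, +oo[ `]s, +oo[ (fun x w => conjc (psi x w)).

End ComplexFunctions.

Section Reflection.
Variable R : realType.
Implicit Types (f : R -> R[i]) (P : diffop R) (D : ratdiffop R) (z : R).

(* the values at real points of (p(x) q(z))^-1 P(x, d_x) . e^{-xz}, where
   P(x, d_x) . e^{-xz} = P(x, -z) e^{-xz} *)
Definition wave_fun P (p q : {poly R[i]}) : R -> R -> R[i] := fun x z =>
  P.[(- z%:C)%:P].[x%:C] / (p.[x%:C] * q.[z%:C]) * (expR (- (x * z)))%:C.

Definition ratdiffop_act D f : R -> R[i] := fun z =>
  (\sum_(k < size (numerator D)) ((numerator D)`_k).[z%:C] * iter k (@cderiv R) f z)
  / (denominator D).[z%:C].

(* D(-z, -d_z) *)
Definition ratdiffop_act_reflected D f : R -> R[i] := fun z =>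
  (\sum_(k < size (numerator D))
     (-1) ^+ k * ((numerator D)`_k).[- z%:C] * iter k (@cderiv R) f z)
  / (denominator D).[- z%:C].

(* T o D(-z, -d_z) = D(z, d_z) o T on a dense subspace of L^2(t, oo) *)
Definition reflects (t : R) (T : (R -> R[i]) -> R -> R[i]) D : Prop :=
  exists2 S : set (R -> R[i]), dense_subspace `]t, +oo[ S &
  forall f, S f ->
    [/\ forall z, t < z -> cderivable_n (rorder D) f z,
        L2 `]t, +oo[ (ratdiffop_act_reflected D f) &
        forall z, t < z -> (denominator D).[z%:C] != 0 ->
          cderivable_n (rorder D) (T f) z /\
          T (ratdiffop_act_reflected D f) z = ratdiffop_act D (T f) z].

End Reflection.

(* Main.v *)
(** Write psi = W e^{-xz}; being fixed under ac means that W is the inverse of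
the conjugate adjoint of W.  Hence A e^{-xz} = r(z) psi, for a differential
operator A in x, implies C psi = r#(z) e^{-xz}, where C is the conjugate adjoint
of A and r#(z) = conj (r (- conj z)).  Taking for A either P / p, or the conjugate
adjoint of Pt / pt, one gets such an A of order at most d = min (d1, d2).  Then
D = r#(z) (- d_z - s)^d r(z) acts on psi as A (x - s)^d C, so that D belongs to
the right Fourier algebra.

For the reflection, let f be smooth with compact support in (t, oo), T the
integral operator, and F the Laplace transform of r(-w) f(w).  Transposing A in
the integral over (s, oo) shows that r(z) (T f)(z) is the Laplace transform of F
over (s, oo) minus e^{-sz} times a polynomial in z of degree less than d, which
(- d_z - s)^d annihilates.  On the other side, (d_w - s)^d (r(-w) f) has the
Laplace transform (y - s)^d F(y), which vanishes to order d at s, and there are no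
boundary terms.  Both D T f and T D(-z, -d_z) f are therefore r#(z) times the
Laplace transform over (s, oo) of (y - s)^d F(y).

All these integrals converge because t >= 0: for t < 0 the operator would not be
defined on all of L^2. *)

From HB Require Import structures.
Require Import Defs.
From mathcomp Require Import all_boot all_order all_algebra.
From mathcomp Require Import complex.
From mathcomp Require Import all_classical all_reals all_analysis.
From mathcomp Require Import measurable_realfun.
From mathcomp Require Import ring lra zify.
Import Order.TTheory GRing.Theory Num.Theory.
Import numFieldNormedType.Exports.

Set Implicit Arguments.
Unset Strict Implicit.
Unset Printing Implicit Defensive.

Local Open Scope ring_scope.
Local Open Scope complex_scope.

(** * Rational functions *)

(** Formal waves have no values, so the argument runs at two levels. Formally, a differential
    operator in x is determined by its action on e^{-xz}; at the level of functions the same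
    identities are evaluated on [s, oo) x [t, oo). The obstacle in passing from one to the other is
    that only p and q are known to have no zeros on these half-lines, while A and r may come from
    Pt, pt and qt. The poles of A are controlled through the coefficients of psi, and r may vanish,
    so that nothing is ever divided by r. The factorization q psi = A0 e^{-xz}, with A0 = P / p, is
    therefore kept beside r psi = A e^{-xz}: q serves to solve for psi, r to keep the order low. The
    two are linked by C A0 e^{-xz} = q r# e^{-xz}, which says that C A0 has constant coefficients
    and hence acts on Laplace transforms as multiplication by a polynomial under the integral.

    Convergence is a matter of exponents: a support in [a, b] with a > t >= 0 gives Laplace
    transforms that decay like e^{-a y}, and rational coefficients cost an arbitrarily small
    exponent. The operator D has order d, within the bound 2 d. *)

Section RationalFunctions.
Variable R : rcfType.
Implicit Types (f g : ratfun R) (n d p : {poly R[i]}).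

Lemma ratfunP f : exists n d, d != 0 /\ f = n%:F / d%:F.
Proof.
exists (frac (repr f)).1, (frac (repr f)).2; split; first exact: denom_ratioP.
exact: ratfun_numden.
Qed.

Lemma tofrac_neq0 p : (p%:F != 0 :> ratfun R) = (p != 0).
Proof. by rewrite tofrac_eq0. Qed.

Lemma poly_over1 p : p%:F = p%:F / 1%:F :> ratfun R.
Proof. by rewrite tofrac1 divr1. Qed.

Lemma rderiv_poly p : rderiv p%:F = p^`()%:F :> ratfun R.
Proof.
rewrite poly_over1 rderivE ?oner_neq0 // derivC mulr0 subr0 mulr1 expr1n.
by rewrite tofrac1 divr1.
Qed.

Lemma rderivD f g : rderiv (f + g) = rderiv f + rderiv g.
Proof.
have [n [d [d0 ->]]] := ratfunP f; have [n' [d' [d'0 ->]]] := ratfunP g.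
rewrite addf_div ?tofrac_neq0 // -!tofracM -tofracD !rderivE ?mulf_neq0 //.
rewrite addf_div ?tofrac_neq0 ?expf_neq0 // -!tofracM -tofracD.
apply/eqP; rewrite ratfun_eq ?mulf_neq0 ?expf_neq0 ?mulf_neq0 //; apply/eqP.
by rewrite ?(derivD, derivM) !expr2; ring.
Qed.

Lemma rderivM f g : rderiv (f * g) = rderiv f * g + f * rderiv g.
Proof.
have [n [d [d0 ->]]] := ratfunP f; have [n' [d' [d'0 ->]]] := ratfunP g.
rewrite mulf_div -!tofracM !rderivE ?mulf_neq0 // !mulf_div -!tofracM.
rewrite addf_div ?tofrac_neq0 ?mulf_neq0 ?expf_neq0 // -!tofracM -tofracD.
apply/eqP; rewrite ratfun_eq ?mulf_neq0 ?expf_neq0 ?mulf_neq0 //; apply/eqP.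
by rewrite ?(derivD, derivM) !expr2; ring.
Qed.

Lemma rderiv_is_additive : {morph @rderiv R : f g / f - g}.
Proof.
move=> f g; rewrite rderivD; congr (_ + _); apply/eqP; rewrite -addr_eq0.
by rewrite -rderivD addNr -tofrac0 rderiv_poly linear0 tofrac0.
Qed.

HB.instance Definition _ :=
  GRing.isZmodMorphism.Build _ _ (@rderiv R) rderiv_is_additive.

Lemma rconj_poly p : rconj p%:F = (map_poly (@conjc R) p)%:F :> ratfun R.
Proof. by rewrite poly_over1 rconjE ?oner_neq0 // rmorph1 tofrac1 divr1. Qed.

Lemma map_conj_neq0 p : (map_poly (@conjc R) p != 0) = (p != 0).
Proof. by rewrite map_poly_eq0. Qed.

Lemma map_conjK p : map_poly (@conjc R) (map_poly (@conjc R) p) = p.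
Proof.
apply/polyP => i; rewrite !coef_map_id0 ?rmorph0 //; exact: conjcK.
Qed.

Lemma rconjD f g : rconj (f + g) = rconj f + rconj g.
Proof.
have [n [d [d0 ->]]] := ratfunP f; have [n' [d' [d'0 ->]]] := ratfunP g.
rewrite addf_div ?tofrac_neq0 // -!tofracM -tofracD !rconjE ?mulf_neq0 //.
rewrite addf_div ?tofrac_neq0 ?map_conj_neq0 // -!tofracM -tofracD.
by rewrite rmorphD !rmorphM.
Qed.

Lemma rconjM f g : rconj (f * g) = rconj f * rconj g.
Proof.
have [n [d [d0 ->]]] := ratfunP f; have [n' [d' [d'0 ->]]] := ratfunP g.
rewrite mulf_div -!tofracM !rconjE ?mulf_neq0 // mulf_div -!tofracM.
by rewrite !rmorphM.
Qed.

Lemma rconj_is_additive : {morph @rconj R : f g / f - g}.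
Proof.
move=> f g; rewrite rconjD; congr (_ + _); apply/eqP; rewrite -addr_eq0.
by rewrite -rconjD addNr -tofrac0 rconj_poly rmorph0 tofrac0.
Qed.

Lemma rconj_is_multiplicative : monoid_morphism (@rconj R).
Proof.
by split=> [|f g]; [rewrite -tofrac1 rconj_poly rmorph1 tofrac1|exact: rconjM].
Qed.

HB.instance Definition _ :=
  GRing.isZmodMorphism.Build _ _ (@rconj R) rconj_is_additive.
HB.instance Definition _ :=
  GRing.isMonoidMorphism.Build _ _ (@rconj R) rconj_is_multiplicative.

Lemma rconjK : involutive (@rconj R).
Proof.
move=> f; have [n [d [d0 ->]]] := ratfunP f.
by rewrite !rconjE ?map_conj_neq0 // !map_conjK.
Qed.

Lemma rconj_rderiv f : rconj (rderiv f) = rderiv (rconj f).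
Proof.
have [n [d [d0 ->]]] := ratfunP f.
rewrite rderivE // !rconjE ?expf_neq0 // rderivE ?map_conj_neq0 //.
by rewrite rmorphXn rmorphB !rmorphM /= !deriv_map.
Qed.

End RationalFunctions.

(** * Operators over a differential ring *)

(** Operators of different orders are compared by extending their sums of coefficients to a common
    range. *)
Lemma sum_ord_widen (V : nmodType) (F : nat -> V) m n : (m <= n)%N ->
  (forall k, (m <= k)%N -> F k = 0) -> \sum_(k < m) F k = \sum_(k < n) F k.
Proof.
move=> mn F0; rewrite (big_ord_widen n F mn) big_mkcond; apply: eq_bigr => k _.
by case: ltnP => // /F0.
Qed.

Section Operators.
Variables (K : comNzRingType) (delta : {additive K -> K}).
Hypothesis deltaM : forall a b, delta (a * b) = delta a * b + a * delta b.
Implicit Types (a b : K) (A B N : {poly K}).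

(* A polynomial \sum_k A_k X^k is read as the operator \sum_k A_k d^k with
   coefficients on the left; [dl N] is then the composite of d and N. *)
Definition dl N : {poly K} := map_poly delta N + N * 'X.

Lemma dlD A B : dl (A + B) = dl A + dl B.
Proof. by rewrite /dl [map_poly _ _]raddfD mulrDl addrACA. Qed.

Lemma dlZ a A : dl (a *: A) = delta a *: A + a *: dl A.
Proof.
apply/polyP => i; rewrite /dl !(coefD, coefZ, coef_map, coefMX) /= deltaM.
by case: eqP => _; rewrite ?addr0 // mulrDr addrA.
Qed.

Lemma dlC a : dl a%:P = (delta a)%:P + a *: 'X.
Proof. by rewrite /dl map_polyC mul_polyC. Qed.

Lemma dlMX A : dl (A * 'X) = dl A * 'X.
Proof.
rewrite /dl mulrDl; congr (_ + _).
by apply/polyP => -[|i]; rewrite !(coef_map, coefMX) /= ?raddf0.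
Qed.

(** This interface has four instances: operators acting on operators, d_x on waves, multiplication
    by z on waves, and d_z on waves. The facts on [oact] are proved once for all of them. *)
Record is_action (V : zmodType) (mul : K -> V -> V) (D : V -> V) : Prop := {
  act_mulDl : forall a b v, mul (a + b) v = mul a v + mul b v;
  act_mulDr : forall a u v, mul a (u + v) = mul a u + mul a v;
  act_mulA : forall a b v, mul (a * b) v = mul a (mul b v);
  act_mul1 : forall v, mul 1 v = v;
  act_derD : forall u v, D (u + v) = D u + D v;
  act_derM : forall a v, D (mul a v) = mul (delta a) v + mul a (D v) }.

Definition oact (V : zmodType) (mul : K -> V -> V) (D : V -> V) A (v : V) : V :=
  \sum_(k < size A) mul A`_k (iter k D v).

Section Action.
Variables (V : zmodType) (mul : K -> V -> V) (D : V -> V).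
Hypothesis act : is_action mul D.
Local Notation "A @! v" := (oact mul D A v) (at level 20).
Implicit Types u v : V.

Lemma act_mul0l v : mul 0 v = 0.
Proof. by apply: (addrI (mul 0 v)); rewrite -(act_mulDl act) !addr0. Qed.

Lemma act_mul0r a : mul a 0 = 0.
Proof. by apply: (addrI (mul a 0)); rewrite -(act_mulDr act) !addr0. Qed.

Lemma act_der0 : D 0 = 0.
Proof. by apply: (addrI (D 0)); rewrite -(act_derD act) !addr0. Qed.

Lemma act_mul_sum a (I : Type) (r : seq I) (P : pred I) (F : I -> V) :
  mul a (\sum_(i <- r | P i) F i) = \sum_(i <- r | P i) mul a (F i).
Proof. by apply: big_morph; [exact: (act_mulDr act)|exact: act_mul0r]. Qed.

Lemma act_der_sum (I : Type) (r : seq I) (P : pred I) (F : I -> V) :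
  D (\sum_(i <- r | P i) F i) = \sum_(i <- r | P i) D (F i).
Proof. by apply: big_morph; [exact: (act_derD act)|exact: act_der0]. Qed.

Lemma act_iterD k u v : iter k D (u + v) = iter k D u + iter k D v.
Proof. by elim: k => //= k ->; rewrite (act_derD act). Qed.

Lemma oactE n A v : (size A <= n)%N ->
  A @! v = \sum_(k < n) mul A`_k (iter k D v).
Proof.
move=> An; apply: (sum_ord_widen (F := fun k => mul A`_k (iter k D v)) An) => k Ak.
by rewrite nth_default ?act_mul0l.
Qed.

Lemma oactDl A B v : (A + B) @! v = A @! v + B @! v.
Proof.
pose n := maxn (size A) (size B).
rewrite (@oactE n (A + B)) ?(leq_trans (size_polyD _ _)) //.
rewrite (@oactE n A) ?leq_maxl // (@oactE n B) ?leq_maxr // -big_split.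
by apply: eq_bigr => k _; rewrite coefD (act_mulDl act).
Qed.

Lemma oactDr A u v : A @! (u + v) = A @! u + A @! v.
Proof.
rewrite -big_split; apply: eq_bigr => k _.
by rewrite act_iterD (act_mulDr act).
Qed.

Lemma oact0l v : 0 @! v = 0.
Proof. by rewrite /oact size_poly0 big_ord0. Qed.

Lemma oactZ a A v : (a *: A) @! v = mul a (A @! v).
Proof.
rewrite (@oactE (size A)) ?size_scale_leq // act_mul_sum.
by apply: eq_bigr => k _; rewrite coefZ (act_mulA act).
Qed.

Lemma oactC a v : a%:P @! v = mul a v.
Proof. by rewrite (@oactE 1) ?size_polyC_leq1 // big_ord1 coefC. Qed.

Lemma oactMX A v : (A * 'X) @! v = A @! (D v).
Proof.
rewrite (@oactE (size A).+1); last first.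
  by have [->|A0] := eqVneq A 0; rewrite ?mul0r ?size_poly0 // size_mulX.
rewrite big_ord_recl coefMX /= act_mul0l add0r; apply: eq_bigr => k _.
by rewrite coefMX /= -iterSr.
Qed.

Lemma oactN A v : (- A) @! v = - (A @! v).
Proof. by apply: (addrI (A @! v)); rewrite -oactDl !subrr oact0l. Qed.

Lemma oact_suml (I : Type) (r : seq I) (P : pred I) (F : I -> {poly K}) v :
  (\sum_(i <- r | P i) F i) @! v = \sum_(i <- r | P i) F i @! v.
Proof.
by apply: (big_morph (fun A => A @! v)) => [A B|]; [exact: oactDl|exact: oact0l].
Qed.

Lemma oact_dl A v : dl A @! v = D (A @! v).
Proof.
rewrite oactDl oactMX (@oactE (size A)) ?size_poly // act_der_sum.
rewrite -big_split; apply: eq_bigr => k _ /=.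
by rewrite coef_map /= (act_derM act) -iterSr iterS.
Qed.

Lemma oact_iter_dl k A v : iter k dl A @! v = iter k D (A @! v).
Proof. by elim: k => //= k IH; rewrite oact_dl IH. Qed.

End Action.

(** Operators form a left module over themselves, with d acting by [dl]; composition is the action
    of A on the element B of this module. *)
Definition ocomp A B : {poly K} := oact *:%R dl A B.

Lemma poly_is_action : is_action *:%R dl.
Proof.
split.
- by move=> *; rewrite scalerDl.
- by move=> *; rewrite scalerDr.
- by move=> *; rewrite scalerA.
- exact: scale1r.
- exact: dlD.
- exact: dlZ.
Qed.

Lemma ocomp_act V mul D (act : @is_action V mul D) A B v :
  oact mul D (ocomp A B) v = oact mul D A (oact mul D B v).
Proof.
rewrite (oact_suml act); apply: eq_bigr => k _.
by rewrite (oactZ act) (oact_iter_dl act).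
Qed.

(** The formal adjoint \sum_k (-d)^k a_k, with the coefficients moved back to the left:
    [iter k dl a%:P] is d^k after multiplication by a. *)
Definition oadj A : {poly K} :=
  \sum_(k < size A) (-1) ^+ k *: iter k dl (A`_k)%:P.

Lemma iter_dl0 k : iter k dl 0%:P = 0.
Proof. by elim: k => //= k ->; rewrite /dl raddf0 mul0r addr0. Qed.

Lemma oadjE n A : (size A <= n)%N ->
  oadj A = \sum_(k < n) (-1) ^+ k *: iter k dl (A`_k)%:P.
Proof.
move=> An; apply: (sum_ord_widen (F := fun k => (-1) ^+ k *: iter k dl (A`_k)%:P) An).
by move=> k Ak; rewrite nth_default // iter_dl0 scaler0.
Qed.

Lemma iter_dlD k A B : iter k dl (A + B) = iter k dl A + iter k dl B.
Proof. exact: act_iterD poly_is_action _ _ _. Qed.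

Lemma oadjD A B : oadj (A + B) = oadj A + oadj B.
Proof.
pose n := maxn (size A) (size B).
rewrite (@oadjE n (A + B)) ?(leq_trans (size_polyD _ _)) //.
rewrite (@oadjE n A) ?leq_maxl // (@oadjE n B) ?leq_maxr // -big_split.
by apply: eq_bigr => k _ /=; rewrite coefD polyCD iter_dlD scalerDr.
Qed.

Lemma oadj0 : oadj 0 = 0.
Proof. by rewrite /oadj size_poly0 big_ord0. Qed.

Lemma delta1 : delta 1 = 0.
Proof. by have /eqP := deltaM 1 1; rewrite !mulr1 mul1r -subr_eq0 opprD addNKr oppr_eq0 => /eqP. Qed.

Lemma delta_sign k : delta ((-1) ^+ k) = 0.
Proof.
by rewrite -signr_odd; case: (odd k); rewrite ?expr0 ?expr1 ?raddfN ?delta1 ?oppr0.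
Qed.

Lemma iter_dl_sign k j A : iter k dl ((-1) ^+ j *: A) = (-1) ^+ j *: iter k dl A.
Proof. by elim: k => //= k ->; rewrite dlZ delta_sign scale0r add0r. Qed.

Lemma oadj_mono a k : oadj (a *: 'X^k) = (-1) ^+ k *: iter k dl a%:P.
Proof.
rewrite (@oadjE k.+1); last first.
  by rewrite (leq_trans (size_scale_leq _ _)) // size_polyXn.
rewrite big_ord_recr /= coefZ coefXn eqxx mulr1 big1 ?add0r // => i _.
by rewrite coefZ coefXn ltn_eqF ?ltn_ord // mulr0 iter_dl0 scaler0.
Qed.

Lemma poly_mono_ind (Q : {poly K} -> Prop) :
  (forall a k, Q (a *: 'X^k)) -> (forall A B, Q A -> Q B -> Q (A + B)) ->
  forall A, Q A.
Proof.
move=> Qm QD A; rewrite -[A]coefK poly_def; apply: big_ind => //.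
by rewrite -(scale0r 'X^0).
Qed.

Lemma ocompDl A B N : ocomp (A + B) N = ocomp A N + ocomp B N.
Proof. exact: oactDl poly_is_action _ _ _. Qed.

Lemma ocompDr A B N : ocomp N (A + B) = ocomp N A + ocomp N B.
Proof. exact: oactDr poly_is_action _ _ _. Qed.

Lemma ocompZ a A N : ocomp (a *: A) N = a *: ocomp A N.
Proof. exact: oactZ poly_is_action _ _ _. Qed.

Lemma ocompC a N : ocomp a%:P N = a *: N.
Proof. exact: oactC poly_is_action _ _. Qed.

Lemma ocomp_iter_dl k A N : ocomp (iter k dl A) N = iter k dl (ocomp A N).
Proof. exact: oact_iter_dl poly_is_action _ _ _. Qed.

(** Multiplication by ['X] on the right is composition with d on the right, so the rule reads (d
    A)^* = - A^* d. It is checked on monomials, where the term with the derivative of the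
    coefficient cancels. *)
Lemma oadj_dl A : oadj (dl A) = - (oadj A * 'X).
Proof.
have iter_dlMX k N : iter k dl (N * 'X) = iter k dl N * 'X.
  by elim: k => //= k ->; rewrite dlMX.
elim/poly_mono_ind: A => [a k|A B hA hB]; last first.
  by rewrite dlD (oadjD (dl A)) (oadjD A) hA hB mulrDl opprD.
have -> : dl (a *: 'X^k) = delta a *: 'X^k + a *: 'X^(k.+1).
  rewrite dlZ; congr (_ + _ *: _); elim: k => [|k IH].
    by rewrite expr0 expr1 -polyC1 dlC delta1 polyC0 add0r scale1r.
  by rewrite exprSr dlMX IH -exprSr.
rewrite oadjD !oadj_mono iterSr dlC iter_dlD exprS mulN1r scaleNr scalerDr opprD.
by rewrite addrA subrr add0r -[a *: 'X]mul_polyC iter_dlMX scalerAl.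
Qed.

Lemma oadj_iter_dl k A : oadj (iter k dl A) = (-1) ^+ k *: (oadj A * 'X^k).
Proof.
elim: k => [|k IH]; first by rewrite expr0 scale1r mulr1.
by rewrite iterS oadj_dl IH exprS mulN1r scaleNr -scalerAl -mulrA -exprSr.
Qed.

Lemma oadj_sign k A : oadj ((-1) ^+ k *: A) = (-1) ^+ k *: oadj A.
Proof.
rewrite (@oadjE (size A)) ?size_scale_leq // scaler_sumr; apply: eq_bigr => i _.
rewrite coefZ polyCM mul_polyC iter_dl_sign.
by rewrite !scalerA mulrC.
Qed.

Lemma oadjC a : oadj a%:P = a%:P.
Proof. by rewrite -[a%:P]mulr1 mul_polyC -(expr0 'X) oadj_mono expr0 scale1r alg_polyC. Qed.

Lemma oadjK : involutive oadj.
Proof.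
elim/poly_mono_ind => [a k|A B hA hB]; last by rewrite !oadjD hA hB.
rewrite oadj_mono oadj_sign oadj_iter_dl oadjC scalerA -exprMn mulrNN mulr1.
by rewrite expr1n scale1r mul_polyC.
Qed.

Lemma oadj_scale a B : oadj (a *: B) = ocomp (oadj B) a%:P.
Proof.
elim/poly_mono_ind: B => [b k|A B hA hB]; last first.
  by rewrite scalerDr !oadjD hA hB ocompDl.
rewrite scalerA !oadj_mono ocompZ ocomp_iter_dl ocompC; congr (_ *: iter k _ _).
by rewrite mulrC polyCM mul_polyC.
Qed.

Lemma ocomp_mono a k B : ocomp (a *: 'X^k) B = a *: iter k dl B.
Proof.
rewrite ocompZ; congr (_ *: _); elim: k B => [|k IH] B.
  by rewrite expr0 -polyC1 ocompC scale1r.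
by rewrite exprSr /ocomp (oactMX poly_is_action) iterSr; exact: IH.
Qed.

Lemma ocompMXn A k B : ocomp (A * 'X^k) B = ocomp A (iter k dl B).
Proof.
elim: k B => [|k IH] B; first by rewrite mulr1.
by rewrite exprSr mulrA /ocomp (oactMX poly_is_action) iterSr; exact: IH.
Qed.

(** Additivity in A leaves the case a d^k, which is treated by moving a and then the powers of d
    across: [oadj_scale] and [oadj_iter_dl]. *)
Lemma oadjM A B : oadj (ocomp A B) = ocomp (oadj B) (oadj A).
Proof.
elim/poly_mono_ind: A => [a k|A A' hA hA']; last first.
  by rewrite ocompDl !oadjD hA hA' ocompDr.
rewrite ocomp_mono oadj_scale oadj_iter_dl ocompZ ocompMXn oadj_mono.
rewrite (act_mul_sum poly_is_action) /ocomp /oact; apply: eq_bigr => i _.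
by rewrite iter_dl_sign !scalerA mulrC.
Qed.
End Operators.

(** * Operators with negative powers of the derivation *)

Section NegativePowers.
Variables (K : comNzRingType) (delta : {additive K -> K}).
Hypothesis deltaM : forall a b, delta (a * b) = delta a * b + a * delta b.
Implicit Types (f c : K) (w a b : nat -> K) (i j k n N : nat).

(* w stands for \sum_n w_n d^-n, and [dinv w] for the composite of d^-1 and w:
   it is the solution v of w_n = v_(n+1) + delta v_n. *)
Fixpoint dinv w n : K := if n is n'.+1 then w n' - delta (dinv w n') else 0.

(** The binomial coefficient of -i over k, as in [negbin] but over any ring. At i = 0 the
    predecessor on naturals still yields 1 for k = 0 and 0 for k > 0. *)
Definition nbin i k : K := (-1) ^+ k * 'C((i + k).-1, k)%:R.

Lemma delta_nbin i k f : delta (nbin i k * f) = nbin i k * delta f.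
Proof.
have d1 := delta1 deltaM.
have dn n : delta n%:R = 0 by rewrite raddfMn d1 mul0rn.
by rewrite /nbin !deltaM (delta_sign deltaM) dn mulr0 mul0r addr0 mul0r add0r.
Qed.

Lemma nbin0 i : nbin i 0 = 1.
Proof. by rewrite /nbin bin0 mulr1. Qed.

Lemma nbin0S k : nbin 0 k.+1 = 0.
Proof. by rewrite /nbin add0n bin_small ?mulr0. Qed.

Lemma nbinS i k : nbin i.+1 k.+1 = nbin i k.+1 - nbin i.+1 k.
Proof.
by rewrite /nbin !addSn !addnS /= binS natrD mulrDr exprS mulN1r !mulNr.
Qed.

Lemma dinv_ext w w' n : (forall m, (m <= n)%N -> w m = w' m) ->
  forall i m, (m <= n)%N -> iter i dinv w m = iter i dinv w' m.
Proof.
move=> ww' i; elim: i => [|i IH] //=; elim=> [|m IHm] mn //=.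
by rewrite IH ?IHm // ltnW.
Qed.

Lemma dinv_small w i n : (n < i)%N -> iter i dinv w n = 0.
Proof.
elim: i n => // i IH [|n] //= ni; rewrite IH // sub0r.
have -> : dinv (iter i dinv w) n = 0; last by rewrite raddf0 oppr0.
elim: n ni => // n IHn ni /=; rewrite IH; last exact: ltnW.
rewrite IHn ?raddf0 ?addr0 //; exact: ltnW.
Qed.

Lemma dinv_sum (I : Type) (r : seq I) (P : pred I) (F : I -> nat -> K) i n :
  iter i dinv (fun m => \sum_(j <- r | P j) F j m) n =
  \sum_(j <- r | P j) iter i dinv (F j) n.
Proof.
elim: i n => [|i IH] //=; elim=> [|n IHn] /=; first by rewrite big1.
by rewrite IH IHn raddf_sum -sumrB.
Qed.

Lemma dinvZ c w i n : delta c = 0 ->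
  iter i dinv (fun m => c * w m) n = c * iter i dinv w n.
Proof.
move=> c0; elim: i n => [|i IH] //=; elim=> [|n IHn] /=; first by rewrite mulr0.
by rewrite IH IHn deltaM c0 mul0r add0r mulrBr.
Qed.

(** The Leibniz rule for d^-i, which ties the recursive [dinv] to the explicit sums in [psidoM] and
    [psido_adj]. The double induction rests on Pascal's rule [nbinS]. *)
Lemma dinvE w i n : iter i dinv w n =
  \sum_(k < n.+1 | (i + k <= n)%N) nbin i k * iter k delta (w (n - i - k)%N).
Proof.
elim: i n => [|i IH] n.
  rewrite big_mkcond big_ord_recl /= nbin0 mul1r !subn0 big1 ?addr0 // => k _.
  by rewrite nbin0S mul0r if_same.
elim: n => [|n IHn] /=; first by rewrite big1 // => k; rewrite addSn ltn0.
rewrite -[dinv _ n]/(iter i.+1 dinv w n) IHn IH raddf_sum.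
rewrite [in X in X - _]big_mkcond [X in _ - X]big_mkcond [RHS]big_mkcond.
rewrite big_ord_recl [RHS]big_ord_recl [X in _ - X]big_ord_recr /=.
have in0 : (i.+1 + n <= n)%N = false by rewrite addSn ltnNge leq_addl.
have in1 : (i.+1 + bump 0 n <= n.+1)%N = false.
  by rewrite /bump add1n addSn addnS !ltnS ltnNge leq_addl.
rewrite in0 addr0 !addn0 ltnS subSS !nbin0 -addrA; congr (_ + _).
rewrite [RHS]big_ord_recr /= in1 addr0 -sumrB; apply: eq_bigr => k _.
rewrite /bump !add1n !addSn !addnS !ltnS; case: ifP => _; last by rewrite subr0.
by rewrite nbinS mulrBl delta_nbin /= add0n -!subnDA addSnnS.
Qed.

(** Expands d^-j f into terms with f^(k) on the left. The series may be cut at any N > n, because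
    d^-(j+k) w has no coefficient of index n once j + k > n. *)
Lemma dinv_leibniz f w j n N : (n < N)%N ->
  iter j dinv (fun m => f * w m) n =
  \sum_(k < N) nbin j k * iter k delta f * iter (j + k) dinv w n.
Proof.
elim: j n N => [|j IHj] n N nN.
  case: N nN => // N nN; rewrite big_ord_recl /= nbin0 mul1r big1 ?addr0 // => k _.
  by rewrite nbin0S !mul0r.
elim: n nN => [|n IHn] nN /=; first by rewrite big1 // => k _; rewrite mulr0.
rewrite -[dinv _ n]/(iter j.+1 dinv (fun m => f * w m) n).
have nN' := ltnW nN; rewrite (IHj n N nN') IHn //.
under [RHS]eq_bigr do rewrite mulrBr.
rewrite raddf_sum /= sumrB; apply/eqP; rewrite -subr_eq0; apply/eqP.
rewrite -!sumrB /=.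
case: N nN {nN' IHn} => // N nN.
(* By Pascal's rule G (k+1) = H k. What is left over is G 0, which cancels, and the last H, which
   vanishes by [dinv_small]. *)
pose G k := nbin j k * iter k delta f * iter (j + k) dinv w n
  - nbin j.+1 k * iter k delta f * iter (j + k) dinv w n.
pose H k := nbin j.+1 k * iter k.+1 delta f * iter (j + k).+1 dinv w n.
transitivity (\sum_(k < N.+1) G k - \sum_(k < N.+1) H k).
  rewrite -sumrB; apply: eq_bigr => k _; rewrite /G /H.
  rewrite deltaM delta_nbin /=.
  set x := nbin j k; set y := nbin j.+1 k; set f0 := iter k delta f.
  by set v := iter (j + k) dinv w n; set v' := dinv _ n; ring.
rewrite big_ord_recl [X in _ - X]big_ord_recr /=.
rewrite {1}/G {2}/H !nbin0 subrr add0r dinv_small ?mulr0 ?addr0; last first.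
  by rewrite ltnS; apply: leq_trans (leq_addl _ _); rewrite -ltnS ltnW.
rewrite -sumrB big1 // => k _; rewrite /G /H /bump add1n addnS nbinS /=.
by set x := dinv _ n; ring.
Qed.

(** Both sides are the coefficient of d^-n in W_a^* W_b. The left side has W_a^* expanded with
    coefficients on the left, the right side keeps it as \sum_j (-d)^-j a_j; [dinv_leibniz] and an
    exchange of sums relate them. *)
Lemma adjoint_symbol_comp a b n :
  \sum_(i < n.+1)
    (\sum_(j < i.+1) (-1) ^+ j * (nbin j (i - j) * iter (i - j) delta (a j))) *
    iter i dinv b n =
  \sum_(j < n.+1) iter j dinv (fun m => (-1) ^+ j * a j * b m) n.
Proof.
pose F i j := (-1) ^+ j * (nbin j (i - j) * iter (i - j) delta (a j)) *
  iter i dinv b n.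
transitivity (\sum_(0 <= i < n.+1) \sum_(0 <= j < n.+1 | (j <= i)%N) F i j).
  rewrite big_mkord; apply: eq_bigr => i _; rewrite mulr_suml.
  rewrite -(big_mkord xpredT (F i)) (big_nat_widen _ _ n.+1); last by rewrite ltnS -ltnS.
  by apply: eq_bigl => j.
rewrite (exchange_big_dep_nat xpredT) //= big_mkord; apply: eq_bigr => j _.
rewrite (_ : (fun m => _) = fun m => (-1) ^+ j * (a j * b m)); last first.
  by apply/funext => m; rewrite mulrA.
rewrite dinvZ ?(delta_sign deltaM) // (@dinv_leibniz _ _ _ _ n.+1) // mulr_sumr.
rewrite -(big_mkord xpredT (fun k => (-1) ^+ j * (nbin j k * iter k delta (a j) *
  iter (j + k) dinv b n))).
have jn : (j <= n.+1)%N by rewrite ltnW.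
rewrite [RHS](@big_cat_nat _ _ _ (n.+1 - j)) ?leq_subr //= [X in _ = _ + X]big_nat_cond.
rewrite [X in _ = _ + X]big1 ?addr0; last first.
  move=> k /andP[/andP[k1 _] _]; rewrite dinv_small ?mulr0 //.
  by rewrite leq_subLR in k1.
rewrite [LHS](big_cat_nat (leq0n j) jn) //= [X in X + _ = _]big_nat_cond.
rewrite [X in X + _ = _]big1 ?add0r; last first.
  by move=> i /andP[/andP[_ ij] ji]; rewrite leqNgt ij in ji.
rewrite -{1}[val j]add0n big_addn [LHS]big_nat_cond [RHS]big_nat_cond /=.
rewrite (eq_bigl (fun i => (0 <= i < n.+1 - j)%N && true)); last first.
  by move=> i; rewrite leq_addl andbT.
by apply: eq_bigr => i _; rewrite /F addnK [(i + j)%N]addnC !mulrA.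
Qed.

(* The symbols [c] are those of q W^*-type products: c_l is the coefficient of
   d^(N-l) in \sum_i q_i d^i \sum_j d^-j b_j. *)
Lemma dinv_convolution a b (c q : nat -> K) N n :
  (forall m, \sum_(j < m.+1) iter j dinv (fun m => b j * a m) m = (m == 0%N)%:R) ->
  (forall i, delta (q i) = 0) ->
  (forall l, c l = \sum_(i < N.+1 | (i <= l)%N) q (N - i)%N * b (l - i)%N) ->
  (forall l, (N < l)%N -> c l = 0) ->
  \sum_(l < N.+1) iter l dinv (fun m => c l * a m) n =
  \sum_(i < N.+1) q (N - i)%N * iter i dinv (fun m => (m == 0%N)%:R) n.
Proof.
(* The range is extended to M so that, after a shift by any i <= N, the inner sum still contains
   every index up to n, all that the coefficient of index n depends on. *)
move=> ab q0 cE c0; pose M := (N + n).+1.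
pose F l := iter l dinv (fun m => c l * a m) n.
transitivity (\sum_(0 <= l < M) F l).
  rewrite (@big_cat_nat _ _ _ N.+1) //= ?ltnS ?leq_addr // big_mkord.
  rewrite [X in _ + X]big_nat_cond [X in _ + X]big1 ?addr0 //.
  move=> l /andP[/andP[l1 _] _]; rewrite /F c0 //.
  rewrite (_ : (fun m => _) = fun m => 0 * a m) //.
  by rewrite dinvZ ?mul0r ?raddf0.
transitivity (\sum_(0 <= l < M) \sum_(0 <= i < N.+1 | (i <= l)%N)
   q (N - i)%N * iter l dinv (fun m => b (l - i)%N * a m) n).
  apply: eq_bigr => l _; rewrite /F cE big_mkord.
  rewrite (_ : (fun m => _) = fun m =>
    \sum_(i < N.+1 | (i <= l)%N) q (N - i)%N * (b (l - i)%N * a m)); last first.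
    by apply/funext => m; rewrite mulr_suml; apply: eq_bigr => i _; rewrite mulrA.
  by rewrite dinv_sum; apply: eq_bigr => i _; rewrite dinvZ.
rewrite (exchange_big_dep_nat xpredT) //= big_mkord; apply: eq_bigr => i _.
rewrite -big_distrr /=; congr (_ * _).
have iM : (i <= M)%N by rewrite (leq_trans (ltnW (ltn_ord i))) // ltnS leq_addr.
rewrite (big_cat_nat (leq0n i) iM) //= [X in X + _ = _]big_nat_cond.
rewrite [X in X + _ = _]big1 ?add0r; last first.
  by move=> l /andP[/andP[_ il] li]; rewrite leqNgt il in li.
rewrite -{1}[val i]add0n big_addn.
transitivity (iter i dinv
    (fun m => \sum_(0 <= j < M - i) iter j dinv (fun m => b j * a m) m) n).
  rewrite dinv_sum big_nat_cond [RHS]big_nat_cond.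
  apply: eq_big => [j|j _]; first by rewrite leq_addl andbT.
  by rewrite addnK addnC iterD.
apply: (@dinv_ext _ _ n) => // m mn; rewrite -ab.
have mM : (m.+1 <= M - i)%N.
  by rewrite ltn_subRL ltnS leq_add // -ltnS.
rewrite (big_cat_nat (leq0n _) mM) //= big_mkord.
rewrite [X in _ + X]big_nat_cond [X in _ + X]big1 ?addr0 // => j.
by move=> /andP[/andP[mj _] _]; exact: dinv_small.
Qed.

End NegativePowers.

(** * Formal waves *)

Section FormalActions.
Variable R : rcfType.
Local Notation K := (ratfun R).
Local Notation fml := (int -> ratfun R).
Local Notation delta := (@rderiv R).
Implicit Types (u v psi : fml) (A B : {poly K}) (p q r : {poly R[i]}).

Definition fscale (a : K) (u : fml) : fml := fun m => a * u m.
Definition fshift (u : fml) : fml := fun m => u (m - 1).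
Definition cst (c : R[i]) : K := c%:P%:F.

Lemma cstD c d : cst (c + d) = cst c + cst d.
Proof. by rewrite /cst polyCD tofracD. Qed.

Lemma cstM c d : cst (c * d) = cst c * cst d.
Proof. by rewrite /cst polyCM tofracM. Qed.

Lemma cst1 : cst 1 = 1.
Proof. by rewrite /cst tofrac1. Qed.

Lemma cst0 : cst 0 = 0.
Proof. by rewrite /cst tofrac0. Qed.

Lemma cst_sign k : cst ((-1) ^+ k) = (-1) ^+ k.
Proof.
rewrite -signr_odd -[in RHS]signr_odd; case: odd; rewrite ?expr0 ?expr1 ?cst1 //.
by rewrite /cst polyCN tofracN tofrac1.
Qed.

Lemma rderiv_cst c : delta (cst c) = 0.
Proof. by rewrite /cst rderiv_poly derivC tofrac0. Qed.

Lemma rconj_cst c : rconj (cst c) = cst (conjc c).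
Proof. by rewrite /cst rconj_poly map_polyC. Qed.

Lemma x_action : is_action delta (V := (fml : zmodType)) fscale (@fdx R).
Proof.
split=> *; apply/funext => m; rewrite /fscale /fdx /=.
- by rewrite !fctE mulrDl.
- by rewrite !fctE mulrDr.
- by rewrite mulrA.
- by rewrite mul1r.
- by rewrite !fctE rderivD opprD addrACA.
- by rewrite !fctE rderivM mulrBr addrA.
Qed.

(** Multiplication by z shifts the coefficients of a wave and commutes with constants, so a
    polynomial in z is an operator in the shift for the zero derivation. *)
Lemma shift_action :
  is_action (\0 : R[i] -> R[i]) (V := (fml : zmodType)) (fun c => fscale (cst c)) fshift.
Proof.
split=> *; apply/funext => m; rewrite /fscale /fshift /=.
- by rewrite !fctE cstD mulrDl.
- by rewrite !fctE mulrDr.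
- by rewrite cstM mulrA.
- by rewrite cst1 mul1r.
- by rewrite !fctE.
- by rewrite !fctE /= cst0 mul0r add0r.
Qed.

Lemma fct_sum (I : Type) (s : seq I) (P : pred I) (F : I -> fml) m :
  (\sum_(i <- s | P i) F i) m = \sum_(i <- s | P i) F i m.
Proof. by rewrite fct_sumE. Qed.

Lemma iter_fshift k u m : iter k fshift u m = u (m - k%:Z).
Proof.
elim: k m => [|k IH] m; first by rewrite subr0.
by rewrite iterS /fshift IH -addn1 PoszD addrAC opprD addrA.
Qed.

Lemma fmulz_oact q u :
  fmulz q u = oact (V := (fml : zmodType)) (fun c => fscale (cst c)) fshift q u.
Proof.
by apply/funext => m; rewrite /oact fct_sum; apply: eq_bigr => i _; rewrite /fscale iter_fshift.
Qed.

Lemma fmulzDl p q u : fmulz (p + q) u = fmulz p u + fmulz q u.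
Proof. by rewrite !fmulz_oact (oactDl shift_action). Qed.

Lemma fmulzDr q u v : fmulz q (u + v) = fmulz q u + fmulz q v.
Proof. by rewrite !fmulz_oact (oactDr shift_action). Qed.

Lemma fmulzC c u : fmulz c%:P u = fscale (cst c) u.
Proof. by rewrite fmulz_oact (oactC shift_action). Qed.

Lemma fmulz1 u : fmulz 1 u = u.
Proof. by rewrite fmulzC (act_mul1 shift_action). Qed.

Lemma fmulzMX q u : fmulz (q * 'X) u = fmulz q (fshift u).
Proof. by rewrite !fmulz_oact (oactMX shift_action). Qed.

Lemma fmulz_comm (T : fml -> fml) : {morph T : u v / u + v} ->
  (forall c u, T (fscale (cst c) u) = fscale (cst c) (T u)) ->
  (forall u, T (fshift u) = fshift (T u)) ->
  forall q u, T (fmulz q u) = fmulz q (T u).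
Proof.
move=> TD TZ Ts q; elim/poly_ind: q => [|q c IH] u.
  by rewrite -polyC0 !fmulzC TZ.
by rewrite !fmulzDl !fmulzMX !fmulzC TD TZ IH Ts.
Qed.

Lemma fmulzM p q u : fmulz (p * q) u = fmulz p (fmulz q u).
Proof.
elim/poly_ind: p u => [|p c IH] u.
  by rewrite mul0r -polyC0 !fmulzC cst0 !(act_mul0l x_action).
rewrite mulrDl !fmulzDl fmulzMX mulrAC fmulzMX IH fmulzC mul_polyC; congr (_ + _).
  congr (fmulz p _); symmetry; apply: (fmulz_comm (T := fshift)) => //.
by rewrite !fmulz_oact (oactZ shift_action).
Qed.

Lemma fdz_fshift u : fdz (fshift u) = u + fshift (fdz u).
Proof.
apply/funext => m; rewrite !fctE /fdz /fshift addrK subrK addrA; congr (_ - _).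
by rewrite rmorphD mulrDl mul1r addrC.
Qed.

Lemma fdzD u v : fdz (u + v) = fdz u + fdz v.
Proof. by apply/funext => m; rewrite !fctE /fdz !mulrDr opprD addrACA. Qed.

Lemma fdz_fscale a u : fdz (fscale a u) = fscale a (fdz u).
Proof.
by apply/funext => m; rewrite /fdz /fscale mulrBr !(mulrCA a).
Qed.

Lemma fdz_fmulz q u : fdz (fmulz q u) = fmulz q^`() u + fmulz q (fdz u).
Proof.
elim/poly_ind: q u => [|q c IH] u.
  by rewrite -polyC0 derivC !fmulzC fdz_fscale cst0 !(act_mul0l x_action) addr0.
rewrite derivMXaddC !fmulzDl fdzD !fmulzMX !fmulzC fdz_fscale IH fdz_fshift.
by rewrite fmulzDr !addrA [fmulz q^`() _ + _]addrC.
Qed.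

Lemma z_action : is_action (@deriv R[i]) (V := (fml : zmodType)) (@fmulz R) (@fdz R).
Proof.
split.
- exact: fmulzDl.
- exact: fmulzDr.
- exact: fmulzM.
- exact: fmulz1.
- exact: fdzD.
- exact: fdz_fmulz.
Qed.

Lemma fdz_fdx u : fdz (fdx u) = fdx (fdz u).
Proof.
apply/funext => m; rewrite /fdz /fdx rderiv_is_additive !rderivM !rderiv_poly derivX.
have -> : rderiv ((m + 1)%:~R : K) = 0.
  have -> : (m + 1)%:~R = cst (m + 1)%:~R :> K by rewrite /cst !rmorph_int.
  exact: rderiv_cst.
rewrite tofrac1 mul0r add0r addrK subrK rmorphD /=; ring.
Qed.

Definition xact A u : fml := oact (V := (fml : zmodType)) fscale (@fdx R) A u.
Definition zact (P : diffop R) u : fml :=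
  oact (V := (fml : zmodType)) (@fmulz R) (@fdz R) P u.
Definition clift (P : diffop R) : {poly K} := map_poly (@FracField.tofrac _) P.

Lemma actx_xact (P : diffop R) u : actx P u = xact (clift P) u.
Proof.
apply/funext => m; rewrite /xact /oact fct_sum size_map_inj_poly ?tofrac0 //; last first.
  by move=> x y /eqP; rewrite tofrac_eq => /eqP.
by apply: eq_bigr => i _; rewrite coef_map.
Qed.

Lemma actz_zact (P : diffop R) u : actz P u = zact P u.
Proof. by apply/funext => m; rewrite /zact /oact fct_sum. Qed.

Lemma xact_comm (T : fml -> fml) : {morph T : u v / u + v} ->
  (forall a u, T (fscale a u) = fscale a (T u)) ->
  (forall u, T (fdx u) = fdx (T u)) ->
  forall A u, T (xact A u) = xact A (T u).
Proof.
move=> TD TZ Td A u.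
have T0 : T 0 = 0 by apply: (addrI (T 0)); rewrite -TD !addr0.
rewrite /xact /oact (big_morph T TD T0); apply: eq_bigr => k _.
by rewrite TZ; congr fscale; elim: (val k) => //= n <-; rewrite Td.
Qed.

Lemma fdx_fmulz q u : fdx (fmulz q u) = fmulz q (fdx u).
Proof.
apply: (fmulz_comm (T := @fdx R)) => [v w|c v|v].
- exact: (act_derD x_action).
- by rewrite (act_derM x_action) /= rderiv_cst (act_mul0l x_action) add0r.
- by [].
Qed.

Lemma xact_fmulz A q u : xact A (fmulz q u) = fmulz q (xact A u).
Proof.
symmetry; apply: (xact_comm (T := fmulz q)) => [v w|a v|v].
- exact: fmulzDr.
- rewrite (fmulz_comm (T := fscale a)) // => [v' w'|c w].
    exact: (act_mulDr x_action).
  by rewrite -!(act_mulA x_action) mulrC.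
- by rewrite fdx_fmulz.
Qed.

Lemma xact_fdz A u : xact A (fdz u) = fdz (xact A u).
Proof.
symmetry; apply: (xact_comm (T := @fdz R)) => [v w|a v|v].
- exact: fdzD.
- exact: fdz_fscale.
- exact: fdz_fdx.
Qed.

Lemma fdz_fexp : fdz (fexp R) = fscale (- 'X%:F) (fexp R).
Proof.
apply/funext => m; rewrite /fdz /fscale /fexp mulNr.
by case: eqP => [->|_]; rewrite ?mul0r ?mulr0 sub0r.
Qed.

Lemma iter_fdx_fexp k m : iter k (@fdx R) (fexp R) m = (-1) ^+ k * (m == k%:Z)%:R.
Proof.
elim: k m => [|k IH] m /=; first by rewrite mul1r.
rewrite /fdx !IH rderivM (delta_sign (@rderivM R)) mul0r add0r.
have -> b : rderiv (b%:R : K) = 0.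
  by rewrite raddfMn (delta1 (@rderivM R)) mul0rn.
rewrite mulr0 sub0r exprS mulN1r mulNr subr_eq.
by rewrite -addn1 PoszD.
Qed.

(** Since d_x^k e^{-xz} = (-z)^k e^{-xz}, the coefficients of an operator can be read off from its
    action on the exponential. All passages from waves back to operators go through this. *)
Lemma xact_fexp A (k : nat) : xact A (fexp R) k = (-1) ^+ k * A`_k.
Proof.
pose n := maxn (size A) k.+1.
rewrite /xact (@oactE _ _ _ _ _ x_action n) ?leq_maxl // fct_sum.
have kn : (k < n)%N by rewrite leq_maxr.
rewrite (bigD1 (Ordinal kn)) //= big1 ?addr0 => [|i].
  by rewrite /fscale iter_fdx_fexp eqxx mulr1 mulrC.
rewrite -val_eqE /= /fscale iter_fdx_fexp eqz_nat eq_sym => /negbTE ->.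
by rewrite !mulr0.
Qed.

Lemma xact_fexp_neg A (k : nat) : xact A (fexp R) (Negz k) = 0.
Proof.
rewrite /xact /oact fct_sum big1 // => i _.
by rewrite /fscale iter_fdx_fexp !mulr0.
Qed.

Lemma xact_fexp_inj A B : xact A (fexp R) = xact B (fexp R) -> A = B.
Proof.
move=> AB; apply/polyP => k; have := congr1 (@^~ k%:Z) AB.
by rewrite !xact_fexp => /lreg_sign; exact.
Qed.

Lemma xact_comp A B u : xact (ocomp delta A B) u = xact A (xact B u).
Proof. exact: (ocomp_act x_action). Qed.

End FormalActions.

(** * The adjoint involution on factorizations *)

Section AdjointWave.
Variable R : rcfType.
Local Notation K := (ratfun R).
Local Notation fml := (int -> ratfun R).
Local Notation delta := (@rderiv R).
Implicit Types (u v psi : fml) (A B : {poly K}) (p q r : {poly R[i]}).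
Implicit Types (w a b : nat -> K).

Definition qsharp q : {poly R[i]} := (map_poly (@conjc R) q) \Po (- 'X).
Definition oconj A : {poly K} := map_poly (@rconj R) A.

Lemma coef_compNX (S : comNzRingType) (q : {poly S}) i : (q \Po (- 'X))`_i = (-1) ^+ i * q`_i.
Proof.
have E j : ((- 'X : {poly S}) ^+ j)`_i = (-1) ^+ j * (i == j)%:R.
  rewrite (exprNn 'X) -[in LHS]signr_odd -[in RHS]signr_odd.
  by case: odd; rewrite ?expr0 ?expr1 ?mul1r ?mulN1r ?coefN coefXn.
rewrite coef_comp_poly; have [iq|qi] := ltnP i (size q); last first.
  rewrite [in RHS]nth_default // mulr0 big1 // => j _.
  by rewrite E gtn_eqF ?mulr0 // (leq_trans (ltn_ord j)).
rewrite (bigD1 (Ordinal iq)) //= big1 ?addr0 => [|j ji].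
  by rewrite E eqxx mulr1 mulrC.
by rewrite -val_eqE /= eq_sym in ji; rewrite E (negbTE ji) !mulr0.
Qed.

Lemma coef_qsharp q i : (qsharp q)`_i = (-1) ^+ i * conjc q`_i.
Proof. by rewrite coef_compNX coef_map. Qed.

Lemma conjc_sign i : conjc ((-1) ^+ i) = (-1) ^+ i :> R[i].
Proof.
by rewrite -signr_odd; case: odd; rewrite ?expr0 ?expr1 ?rmorphN ?rmorph1.
Qed.

Lemma qsharpK : involutive qsharp.
Proof.
move=> q; apply/polyP => i; rewrite !coef_qsharp rmorphM /= conjcK.
by rewrite conjc_sign signrMK.
Qed.

Lemma qsharpM p q : qsharp (p * q) = qsharp p * qsharp q.
Proof. by rewrite /qsharp rmorphM comp_polyM. Qed.

Lemma size_qsharp_leq q : (size (qsharp q) <= size q)%N.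
Proof.
by apply/leq_sizeP => j qj; rewrite coef_qsharp nth_default // conjc0 mulr0.
Qed.

Lemma size_qsharp q : size (qsharp q) = size q.
Proof.
by apply/eqP; rewrite eqn_leq size_qsharp_leq -{1}[q]qsharpK size_qsharp_leq.
Qed.

Lemma qsharp_eq0 q : (qsharp q == 0) = (q == 0).
Proof. by rewrite -!size_poly_eq0 size_qsharp. Qed.

Lemma horner_qsharp q (z : R[i]) : (qsharp q).[z] = conjc q.[- conjc z].
Proof.
rewrite horner_comp hornerN hornerX -[- z in LHS]conjcK horner_map /=.
by rewrite rmorphN.
Qed.

Lemma coef_oconj A i : (oconj A)`_i = rconj A`_i.
Proof. by rewrite coef_map. Qed.

Lemma oconjK : involutive oconj.
Proof. by move=> A; apply/polyP => i; rewrite !coef_oconj rconjK. Qed.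

Lemma size_oconj A : size (oconj A) = size A.
Proof. exact: size_map_poly. Qed.

Lemma oconj_dl A : oconj (dl delta A) = dl delta (oconj A).
Proof.
apply/polyP => i; rewrite /dl coef_oconj !(coefD, coefMX, coef_map) /=.
rewrite rconjD; congr (_ + _); first exact: rconj_rderiv.
by case: eqP => _; rewrite ?rmorph0.
Qed.

Lemma oconj_comp A B : oconj (ocomp delta A B) = ocomp delta (oconj A) (oconj B).
Proof.
have oconj_iter k N : oconj (iter k (dl delta) N) = iter k (dl delta) (oconj N).
  by elim: k => //= k <-; rewrite oconj_dl.
rewrite /ocomp /oact size_oconj /oconj rmorph_sum; apply: eq_bigr => k _ /=.
rewrite -oconj_iter coef_map; apply/polyP => i.
rewrite [in RHS]coefZ coef_oconj [LHS]coef_map coefZ; exact: rconjM.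
Qed.

Lemma fmulz_fexp q (k : nat) : fmulz q (fexp R) k = cst q`_k.
Proof.
rewrite /fmulz /fexp; have [kq|qk] := ltnP k (size q); last first.
  rewrite nth_default // cst0 big1 // => i _.
  by rewrite subr_eq0 eqz_nat gtn_eqF ?mulr0 // (leq_trans (ltn_ord i)).
rewrite (bigD1 (Ordinal kq)) //= subrr eqxx mulr1 big1 ?addr0 // => i ik.
by rewrite subr_eq0 eqz_nat eq_sym -val_eqE /= in ik *; rewrite (negbTE ik) mulr0.
Qed.

Lemma fmulz_fexp_neg q (k : nat) : fmulz q (fexp R) (Negz k) = 0.
Proof.
by rewrite /fmulz big1 // => i _; rewrite /fexp subr_eq0 /= mulr0.
Qed.

(* the wave (\sum_n w_n d_x^-n) . e^{-xz} *)
Definition fseq w : fml := fun m => 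
  match m with Posz 0 => w 0%N | Posz _ => 0 | Negz n => (-1) ^+ n.+1 * w n.+1 end.

Lemma fseq_dressing psi : kp_wave psi -> fseq (dressing psi) = psi.
Proof.
case=> _ psi0; apply/funext => -[[|m]|m] //=.
- by rewrite /dressing mul1r oppr0.
- by rewrite psi0.
- by rewrite /dressing signrMK NegzE.
Qed.

(** On waves, d_x undoes [dinv]: the recursion of [dinv] is this statement coefficient by
    coefficient. A composite d^N d^-l with l <= N thus reduces to d^(N-l). *)
Lemma fdx_fseq w : fdx (fseq (dinv delta w)) = fseq w.
Proof.
have d0 : delta 0 = 0 by exact: raddf0.
apply/funext => -[[|m]|m]; rewrite /fdx.
- by rewrite /= d0 sub0r subr0 expr1 mulN1r opprK.
- have -> : m.+1%:Z - 1 = m%:Z by lia.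
  by case: m => [|m] /=; rewrite d0 subrr.
have -> : Negz m - 1 = Negz m.+1 by lia.
rewrite /= rderivM (delta_sign (@rderivM R)) mul0r add0r.
by rewrite [in X in _ - X]exprS mulN1r mulNr opprK -mulrDr addrC subrK.
Qed.

Lemma iter_fdx_fseq k w : iter k (@fdx R) (fseq (iter k (dinv delta) w)) = fseq w.
Proof. by elim: k w => // k IH w; rewrite iterSr fdx_fseq IH. Qed.

Lemma iter_fdx_fseq_leq k n w : (k <= n)%N ->
  iter n (@fdx R) (fseq (iter k (dinv delta) w)) = iter (n - k) (@fdx R) (fseq w).
Proof. by move=> kn; rewrite -{1}(subnK kn) iterD iter_fdx_fseq. Qed.

Lemma fscale_fseq c w : fscale c (fseq w) = fseq (fun m => c * w m).
Proof.
by apply/funext => -[[|m]|m]; rewrite /fscale /= ?mulr0 // mulrCA.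
Qed.

Lemma fseq_sum (I : Type) (s : seq I) (P : pred I) (F : I -> nat -> K) :
  fseq (fun m => \sum_(i <- s | P i) F i m) = \sum_(i <- s | P i) fseq (F i).
Proof.
apply/funext => -[[|m]|m]; rewrite fct_sum //=; first by rewrite big1.
by rewrite mulr_sumr.
Qed.

Lemma fseq_fexp : fseq (fun m => (m == 0%N)%:R) = fexp R.
Proof. by apply/funext => -[[|m]|m]; rewrite /fexp //= mulr0. Qed.

(** The coefficient of d^-n in (conjugate adjoint of W) W = 1, with the adjoint left unexpanded. The
    sign of the adjoint cancels that of [dressing], which leaves the plain conjugates of the
    coefficients of psi. *)
Lemma ac_fixed_symbol psi : ac_fixed psi -> forall n,
  \sum_(j < n.+1)
    iter j (dinv delta) (fun m => rconj (psi (- j%:Z)) * dressing psi m) n =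
  (n == 0%N)%:R.
Proof.
case=> _ H _ n; rewrite -[RHS]/(psido1 R n) -H.
transitivity (\sum_(j < n.+1) iter j (dinv delta)
    (fun m => (-1) ^+ j * dressing (schwartz_wave psi) j * dressing psi m) n).
  apply: eq_bigr => j _; congr (iter j _ _ n); apply/funext => m; congr (_ * _).
  by rewrite /dressing signrMK.
rewrite -(adjoint_symbol_comp (@rderivM R)) /psidoM; apply: eq_bigr => i _.
rewrite (dinvE (@rderivM R)) mulr_sumr.
rewrite -(big_mkord (fun k => (i + k <= n)%N) (fun k => _ * (nbin _ i k * 
  iter k delta (dressing psi (n - i - k)%N)))).
rewrite -(big_mkord xpredT (fun k => _ * (negbin R i k * 
  iter k delta (dressing psi (n - i - k)%N)))).
have ni : ((n - i).+1 <= n.+1)%N by rewrite ltnS leq_subr.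
rewrite [RHS](_ : _ = \sum_(0 <= k < n.+1 | (i + k <= n)%N) psido_adj (dressing (schwartz_wave psi)) i *
    (negbin R i k * iter k delta (dressing psi (n - i - k)%N))) //.
rewrite (big_nat_widen _ _ n.+1) //; apply: eq_bigl => k /=.
by rewrite ltnS leq_subRL // -ltnS.
Qed.

(** Coefficients are counted downwards from z^N, where N bounds the degree of q. As psi has no
    positive powers of z, only the top coefficients of q, those with i <= l, contribute. *)
Lemma fmulz_kp q psi N (l : nat) : kp_wave psi -> (size q <= N.+1)%N ->
  fmulz q psi (N%:Z - l%:Z) =
  \sum_(i < N.+1 | (i <= l)%N) cst q`_(N - i) * psi (- (l - i)%N%:Z).
Proof.
case=> _ psi0 qN.
have -> : fmulz q psi (N%:Z - l%:Z) =
    \sum_(i < N.+1) cst q`_i * psi (N%:Z - l%:Z - i%:Z).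
  rewrite fmulz_oact (@oactE _ _ _ _ _ (shift_action R) N.+1) // fct_sum.
  by apply: eq_bigr => i _; rewrite /fscale iter_fshift.
rewrite (reindex_inj rev_ord_inj) [RHS]big_mkcond; apply: eq_bigr => i _ /=.
have iN : (i <= N)%N by rewrite -ltnS.
have -> : N%:Z - l%:Z - (N - i)%N%:Z = i%:Z - l%:Z by lia.
case: leqP => [il|li]; last by rewrite subSS psi0 ?mulr0 // subr_gt0 ltz_nat.
by rewrite subSS -subzn // opprB.
Qed.

Lemma iter_fdx_sum j (I : finType) (F : I -> fml) :
  iter j (@fdx R) (\sum_i F i) = \sum_i iter j (@fdx R) (F i).
Proof. by elim: j => //= j ->; exact: (act_der_sum (x_action R)). Qed.

Lemma iter_fdx_fscale j (y : K) u : delta y = 0 ->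
  iter j (@fdx R) (fscale y u) = fscale y (iter j (@fdx R) u).
Proof.
move=> y0; elim: j => [|j IH] //=.
by rewrite IH (act_derM (x_action R)) /= y0 (act_mul0l (x_action R)) add0r.
Qed.

(** The coefficients of A are, up to sign, those of q psi, so C = \sum_k d^k c_(N-k) with conjugated
    coefficients c. Pulling out d^N leaves a series in d^-1 that is the product of conj q and the
    conjugate adjoint of W. Applied to psi = W e^{-xz}, the latter cancels W, and \sum_i conj(q_i)
    d^i acts on e^{-xz} as q#. *)
Lemma adjoint_factor psi A q : kp_wave psi -> ac_fixed psi ->
  xact A (fexp R) = fmulz q psi ->
  xact (oadj delta (oconj A)) psi = fmulz (qsharp q) (fexp R).
Proof.
move=> kp ac Aq; pose N := size q.
have AE (k : nat) : A`_k = (-1) ^+ k * fmulz q psi k.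
  by rewrite -Aq xact_fexp signrMK.
have qpsi0 (m : int) : (N%:Z < m)%R -> fmulz q psi m = 0.
  move=> Nm; case: kp => _ psi0; rewrite /fmulz big1 // => i _.
  by rewrite psi0 ?mulr0 // subr_gt0 (lt_trans _ Nm) // ltz_nat ltn_ord.
have AN : (size (oconj A) <= N.+1)%N.
  by rewrite size_oconj; apply/leq_sizeP => j Nj; rewrite AE qpsi0 ?mulr0 // ltz_nat.
(* For l > N these vanish because q psi = A e^{-xz} has no negative power of z; this is where A
   being a differential operator enters. *)
pose c l : K := rconj (fmulz q psi (N%:Z - l%:Z)).
pose a := dressing psi; have aE : fseq a = psi by exact: fseq_dressing.
transitivity (\sum_(k < N.+1) iter k (@fdx R) (fscale (c (N - k)%N) psi)).
  rewrite (oadjE _ AN) /xact (oact_suml (x_action R)); apply: eq_bigr => k _.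
  rewrite (oactZ (x_action R)) (oact_iter_dl (x_action R)) (oactC (x_action R)).
  have kN : (k <= N)%N by rewrite -ltnS.
  rewrite coef_oconj AE rmorphM /= rmorphXn rmorphN rmorph1 /= /c -subzn // subKr.
  set x := rconj _.
  rewrite -iter_fdx_fscale ?(delta_sign (@rderivM R)) // -(act_mulA (x_action R)).
  by rewrite signrMK.
rewrite (reindex_inj rev_ord_inj) /=.
(* Each d^(N-l) is rewritten as d^N d^-l, which brings the sum into the form of
   [dinv_convolution]. *)
transitivity (iter N (@fdx R)
    (\sum_(l < N.+1) fseq (iter l (dinv delta) (fun m => c l * a m)))).
  rewrite iter_fdx_sum; apply: eq_bigr => l _; have lN : (l <= N)%N by rewrite -ltnS.
  by rewrite subSS subKn // iter_fdx_fseq_leq // -fscale_fseq aE.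
rewrite -fseq_sum.
rewrite (_ : (fun m => _) = fun m =>
    \sum_(i < N.+1) cst (conjc q`_(N - i)) *
       iter i (dinv delta) (fun m => (m == 0%N)%:R) m); last first.
  apply/funext => n.
  apply: (dinv_convolution (@rderivM R) (b := fun j => rconj (psi (- j%:Z)))
     (q := fun i => cst (conjc q`_i))).
  - exact: ac_fixed_symbol.
  - by move=> i; exact: rderiv_cst.
  - move=> l; rewrite /c (fmulz_kp _ kp) // rmorph_sum; apply: eq_bigr => i _.
    by rewrite rmorphM /= rconj_cst.
  - move=> l Nl; rewrite /c -Aq.
    have -> : N%:Z - l%:Z = Negz (l - N).-1.
      by rewrite NegzE prednK ?subn_gt0 // -subzn ?opprB // ltnW.
    by rewrite xact_fexp_neg rmorph0.
rewrite (_ : (fun m => _) = fun m => \sum_(i < N.+1)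
    (fun m => cst (conjc q`_(N - i)) *
       iter i (dinv delta) (fun m => (m == 0%N)%:R) m) m) // fseq_sum.
transitivity (\sum_(i < N.+1) fscale (cst (conjc q`_(N - i)))
    (iter (N - i) (@fdx R) (fexp R))).
  rewrite iter_fdx_sum; apply: eq_bigr => i _; have iN : (i <= N)%N by rewrite -ltnS.
  rewrite -fscale_fseq.
  by rewrite iter_fdx_fscale ?rderiv_cst // iter_fdx_fseq_leq // fseq_fexp.
rewrite (reindex_inj rev_ord_inj) /=.
apply/funext => m; rewrite fct_sum.
case: m => m; last first.
  rewrite fmulz_fexp_neg big1 // => i _.
  by rewrite /fscale iter_fdx_fexp !mulr0.
rewrite fmulz_fexp coef_qsharp.
have [mN|Nm] := ltnP m N.+1; last first.
  rewrite nth_default ?conjc0 ?mulr0 ?cst0 ?(ltnW Nm) // big1 // => i _.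
  by rewrite /fscale iter_fdx_fexp eqz_nat gtn_eqF ?mulr0 // subSS (leq_trans _ Nm) // ltnS leq_subr.
rewrite (bigD1 (Ordinal mN)) //= big1 ?addr0 => [|i im].
  by rewrite subSS subKn // /fscale iter_fdx_fexp eqxx mulr1 cstM cst_sign [_ * (-1) ^+ m]mulrC.
rewrite subSS subKn; last by rewrite -ltnS.
rewrite /fscale iter_fdx_fexp eqz_nat eq_sym.
by rewrite -val_eqE /= in im; rewrite (negbTE im) !mulr0.
Qed.

End AdjointWave.

(** * Compatibility of the adjoint with ring morphisms *)

Section OperatorMorphism.
Variables (K : comNzRingType) (delta : {additive K -> K}) (sigma : {rmorphism K -> K}).
Hypothesis sigma_delta : forall a, sigma (delta a) = delta (sigma a).

Lemma map_poly_iter_dl k (A : {poly K}) :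
  map_poly sigma (iter k (dl delta) A) = iter k (dl delta) (map_poly sigma A).
Proof.
elim: k => //= k <-; set N := iter k _ _; rewrite /dl rmorphD rmorphM /= map_polyX.
by congr (_ + _); apply/polyP => i; rewrite !coef_map /= sigma_delta.
Qed.

Lemma map_poly_oadj (A : {poly K}) :
  map_poly sigma (oadj delta A) = oadj delta (map_poly sigma A).
Proof.
rewrite (@oadjE _ _ (size A) (map_poly _ _)) ?size_poly // rmorph_sum.
apply: eq_bigr => k _; rewrite /= map_polyZ map_poly_iter_dl rmorphXn rmorphN rmorph1.
by rewrite map_polyC coef_map.
Qed.

End OperatorMorphism.

(** * A factorization of minimal order and the operator D *)

Section Factorization.
Variable R : rcfType.
Local Notation K := (ratfun R).
Local Notation fml := (int -> ratfun R).
Local Notation delta := (@rderiv R).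
Implicit Types (u v psi : fml) (A B C N : {poly K}) (p q r : {poly R[i]}).

Lemma oconj_oadj A : oconj (oadj delta A) = oadj delta (oconj A).
Proof. by apply: map_poly_oadj => a; rewrite /= rconj_rderiv. Qed.

Lemma size_oadj A : (size (oadj delta A) <= size A)%N.
Proof.
rewrite /oadj (leq_trans (size_sum _ _ _)) //; apply/bigmax_leqP => k _.
rewrite (leq_trans (size_scale_leq _ _)) //.
suff H j : (size (iter j (dl delta) (A`_k)%:P) <= j.+1)%N.
  by rewrite (leq_trans (H _)).
elim: j => [|j IH] /=; first exact: size_polyC_leq1.
rewrite /dl (leq_trans (size_polyD _ _)) // geq_max.
rewrite (leq_trans (size_poly _ _)) ?(leqW IH) //=.
by rewrite (leq_trans (size_polyMleq _ _)) // size_polyX addn2.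
Qed.

Lemma rconj_sign j : rconj ((-1) ^+ j) = (-1) ^+ j :> K.
Proof. exact: rmorph_sign. Qed.

(** Each d_x raises the top degree in z by one and changes the sign of the top coefficient, since
    only the term -z of d_x reaches that degree. *)
Lemma iter_fdx_top u (M : int) k : (forall m, (M < m)%R -> u m = 0) ->
  (forall m, (M + k%:Z < m)%R -> iter k (@fdx R) u m = 0) /\
  iter k (@fdx R) u (M + k%:Z) = (-1) ^+ k * u M.
Proof.
have d0 : delta 0 = 0 by exact: raddf0.
move=> u0; elim: k => [|k [IH1 IH2]]; first by rewrite addr0 mul1r; split.
split=> [m Mm|] /=; rewrite /fdx.
  have H1 : M + k%:Z < m by lia.
  have H2 : M + k%:Z < m - 1 by lia.
  by rewrite (IH1 _ H1) (IH1 _ H2) d0 subr0.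
have H : M + k%:Z < M + k.+1%:Z by lia.
rewrite (IH1 _ H) d0 sub0r.
have -> : M + k.+1%:Z - 1 = M + k%:Z by lia.
by rewrite IH2 exprS mulN1r mulNr.
Qed.

Lemma int_down_ind (Q : int -> Prop) (M : int) : (forall m, (M < m)%R -> Q m) ->
  (forall m, (forall j, (m < j)%R -> Q j) -> Q m) -> forall m, Q m.
Proof.
move=> QM QS; have H (n : nat) : forall m, (M - n%:Z < m)%R -> Q m.
  elim: n => [|n IH] m mn; first by apply: QM; rewrite subr0 in mn.
  by apply: QS => j mj; apply: IH; lia.
by move=> m; apply: (H `|M - m|.+1%N); lia.
Qed.

(** If C has order d, the coefficient of z^(m+d) in C u is, up to sign, the leading coefficient of C
    times u m, when m is the top degree. Waves bounded in degree therefore vanish from the top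
    downwards. *)
Lemma xact_inj C u (M : int) : C != 0 -> (forall m, (M < m)%R -> u m = 0) ->
  xact C u = 0 -> u = 0.
Proof.
move=> C0 uM Cu; apply/funext; apply: (int_down_ind (M := M)) => // m um.
pose d := (size C).-1; have dE : size C = d.+1 by rewrite prednK // size_poly_gt0.
have := congr1 (@^~ (m + d%:Z)) Cu.
rewrite /xact /oact dE big_ord_recr /= fctE fct_sum big1; last first.
  move=> i _; rewrite /fscale (proj1 (iter_fdx_top i um)) ?mulr0 //.
  by rewrite ltrD2l ltz_nat ltn_ord.
rewrite add0r /fscale (proj2 (iter_fdx_top d um)) => /eqP.
by rewrite !mulf_eq0 signr_eq0 -/(lead_coef C) lead_coef_eq0 (negbTE C0) => /eqP.
Qed.

Lemma xactD A u v : xact A (u + v) = xact A u + xact A v.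
Proof. exact: (oactDr (x_action R)). Qed.

Lemma xactN A u : xact A (- u) = - xact A u.
Proof.
apply: (addrI (xact A u)); rewrite -xactD !subrr; apply: (addrI (xact A 0)).
by rewrite -xactD !addr0.
Qed.

Lemma xact_bounded A u (M : int) : (forall m, (M < m)%R -> u m = 0) ->
  forall m, (M + (size A)%:Z < m)%R -> xact A u m = 0.
Proof.
move=> uM m Mm; rewrite /xact /oact fct_sum big1 // => i _.
rewrite /fscale (proj1 (iter_fdx_top i uM)) ?mulr0 //.
by rewrite (le_lt_trans _ Mm) // lerD2l lez_nat ltnW // ltn_ord.
Qed.

Lemma fmulz_bounded q u (M : int) : (forall m, (M < m)%R -> u m = 0) ->
  forall m, (M + (size q)%:Z < m)%R -> fmulz q u m = 0.
Proof.
move=> uM m Mm; rewrite /fmulz big1 // => i _.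
by rewrite uM ?mulr0 // ltrBrDr (lt_trans _ Mm) // ltrD2l ltz_nat ltn_ord.
Qed.

Lemma fexp_bounded m : (0 < m)%R -> fexp R m = 0.
Proof. by rewrite /fexp => /gt_eqF ->. Qed.

(** The hypothesis forces the coefficients of N to be constants, so forming the adjoint involves no
    derivative of them and only the signs and conjugates remain. *)
Lemma xact_oadj_fexp N g : xact N (fexp R) = fmulz g (fexp R) ->
  xact (oadj delta (oconj N)) (fexp R) = fmulz (qsharp g) (fexp R).
Proof.
move=> Ng; apply/funext => -[k|k]; last by rewrite xact_fexp_neg fmulz_fexp_neg.
have NE (j : nat) : N`_j = (-1) ^+ j * cst g`_j.
  by rewrite -fmulz_fexp -Ng xact_fexp signrMK.
rewrite xact_fexp fmulz_fexp coef_qsharp cstM cst_sign; congr (_ * _).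
have iterC j a : delta a = 0 -> iter j (dl delta) a%:P = a *: 'X^j.
  move=> a0; elim: j => [|j IH] /=; first by rewrite expr0 alg_polyC.
  rewrite IH (dlZ (@rderivM R)) /= a0 scale0r add0r; congr (_ *: _).
  rewrite /dl; suff -> : map_poly delta 'X^j = 0 by rewrite add0r exprSr.
  apply/polyP => i; rewrite coef_map coefXn coef0 /=.
  by case: eqP => _; rewrite ?raddf0 //; exact: (delta1 (@rderivM R)).
pose n := maxn (size (oconj N)) k.+1.
rewrite (@oadjE _ _ n) ?leq_maxl // coef_sum.
have kn : (k < n)%N by rewrite leq_maxr.
have E j : iter j (dl delta) ((oconj N)`_j)%:P = (-1) ^+ j *: (cst (conjc g`_j) *: 'X^j).
  rewrite coef_oconj NE rconjM rconj_sign rconj_cst iterC ?scalerA //.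
  by rewrite -cst_sign -cstM; exact: rderiv_cst.
rewrite (bigD1 (Ordinal kn)) //= big1 ?addr0 => [|i ik].
  by rewrite E scalerA -exprMn mulrNN mulr1 expr1n scale1r coefZ coefXn eqxx mulr1.
rewrite E !coefZ coefXn; rewrite -val_eqE /= eq_sym in ik.
by rewrite (negbTE ik) !mulr0.
Qed.

Lemma xact_cleared (P : diffop R) p u v : p != 0 -> actx P u =1 fmulx p v ->
  xact (p%:F^-1 *: clift P) u = v.
Proof.
move=> p0 Pu; rewrite /xact (oactZ (x_action R)) -[oact _ _ _ _]/(xact _ _) -actx_xact.
apply/funext => m; rewrite /fscale Pu /fmulx mulrA mulVf ?mul1r //.
by rewrite tofrac_neq0.
Qed.

(** If P has the smaller order, A = P / p and [adjoint_factor] is all that is needed. Otherwise A is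
    the conjugate adjoint of B = Pt / pt, so that C is B itself; the identity still missing is A
    e^{-xz} = r psi, and it is obtained after applying an injective operator to both sides. *)
Lemma symmetric_factorization psi (P : diffop R) p q (Pt : diffop R) pt qt :
  kp_wave psi -> from_exp psi P p q -> to_exp psi Pt pt qt -> ac_fixed psi ->
  exists A r, [/\ r != 0,
    (size A <= (minn (diffop_order P) (diffop_order Pt)).+1)%N,
    xact A (fexp R) = fmulz r psi &
    xact (oadj delta (oconj A)) psi = fmulz (qsharp r) (fexp R)].
Proof.
move=> kp [p0 q0 Pe] [pt0 qt0 Ptpsi] ac.
have size_lift (Q : diffop R) a : (size (a *: clift Q) <= (diffop_order Q).+1)%N.
  rewrite (leq_trans (size_scale_leq _ _)) // (leq_trans (size_poly _ _)) //.
  exact: leqSpred.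
pose A0 : {poly K} := p%:F^-1 *: clift P.
have A0e : xact A0 (fexp R) = fmulz q psi by exact: xact_cleared Pe.
pose B : {poly K} := pt%:F^-1 *: clift Pt.
have Bpsi : xact B psi = fmulz qt (fexp R) by exact: xact_cleared Ptpsi.
have C0psi := adjoint_factor kp ac A0e.
have [PPt|PtP] := leqP (diffop_order P) (diffop_order Pt).
  by exists A0, q; split=> //; rewrite -/(minn _ _) size_lift.
exists (oadj delta (oconj B)), (qsharp qt); split.
- by rewrite qsharp_eq0.
- by rewrite (leq_trans (size_oadj _)) // size_oconj size_lift.
- set A := oadj _ _; set r := qsharp qt; set C0 := oadj _ (oconj A0) in C0psi.
  have C00 : C0 != 0.
    apply/eqP => C00; move: C0psi; rewrite C00 /xact oact0l => /esym e0.
    move: q0; rewrite -qsharp_eq0 => /eqP; apply; apply/polyP => k.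
    have := congr1 (@^~ k%:Z) e0; rewrite fmulz_fexp coef0 => /eqP.
    by rewrite tofrac_eq0 polyC_eq0 => /eqP.
  (* B A0 has constant coefficients. Its conjugate adjoint is C0 A, whence C0 A e^{-xz} = q# r
     e^{-xz} = C0 (r psi), and C0 can be cancelled by [xact_inj]. *)
  have BA0 : xact (ocomp delta B A0) (fexp R) = fmulz (q * qt) (fexp R).
    by rewrite xact_comp A0e xact_fmulz Bpsi fmulzM.
  have := xact_oadj_fexp BA0.
  rewrite oconj_comp (oadjM (@rderivM R)) xact_comp -/A -/C0 qsharpM mulrC.
  rewrite fmulzM -C0psi -xact_fmulz -/r => /eqP; rewrite -subr_eq0 => /eqP C0u.
  apply/eqP; rewrite -subr_eq0; apply/eqP.
  pose M : int := (size A)%:Z + (size r)%:Z.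
  apply: (xact_inj (M := M) C00); last first.
    by rewrite xactD xactN.
  move=> m Mm; rewrite !fctE (xact_bounded fexp_bounded) ?(fmulz_bounded (proj2 kp)) ?subrr //.
    by rewrite (le_lt_trans _ Mm) // /M lerD2r.
  by rewrite (le_lt_trans _ Mm) // /M addrC lerD2l.
- by rewrite oconj_oadj oconjK (oadjK (@rderivM R)) qsharpK.
Qed.

Lemma clear_denominators N : exists (Q : diffop R) (d : {poly R[i]}),
  d != 0 /\ clift Q = d%:F *: N.
Proof.
elim/poly_ind: N => [|N c [Q [d [d0 QE]]]].
  by exists 0, 1; rewrite oner_neq0 scaler0 /clift raddf0.
have [n [e [e0 ->]]] := ratfunP c.
exists (e *: Q * 'X + (d * n)%:P), (d * e); split; first by rewrite mulf_neq0.
rewrite /clift rmorphD rmorphM /= map_polyX map_polyC /= map_polyZ /= -/(clift Q) QE.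
rewrite scalerDr !tofracM -!scalerAl scalerA [e%:F * _]mulrC; congr (_ + _).
rewrite -mul_polyC -polyCM; congr (_%:P).
by rewrite -mulrA; congr (_ * _); rewrite mulrCA divff ?mulr1 // tofrac_neq0.
Qed.

(* the composite of - d_z - s and Q *)
Definition zstep (s : R[i]) (Q : diffop R) : diffop R :=
  - (dl (@deriv R[i]) Q + s%:P *: Q).

Definition reflecting_numerator r (s : R[i]) d : diffop R :=
  qsharp r *: iter d (zstep s) r%:P.

Lemma size_zstep s (Q : diffop R) d : size Q = d.+1 -> size (zstep s Q) = d.+2.
Proof.
move=> Qd; have Q0 : Q != 0 by rewrite -size_poly_gt0 Qd.
rewrite /zstep size_polyN /dl addrAC addrC size_polyDl ?size_mulX ?Qd //.
rewrite ltnS (leq_trans (size_polyD _ _)) // geq_max.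
by rewrite -Qd size_poly size_scale_leq.
Qed.

Lemma size_reflecting_numerator r s d : r != 0 ->
  size (reflecting_numerator r s d) = d.+1.
Proof.
move=> r0; rewrite /reflecting_numerator size_scale ?qsharp_eq0 //.
elim: d => [|d IH]; first by rewrite size_polyC r0.
by rewrite iterS (size_zstep _ IH).
Qed.

(** Operators in z commute with operators in x, and - d_z - s acts on e^{-xz} as x - s. Applied to r
    psi = A e^{-xz}, the power of - d_z - s thus passes through A and turns into (x - s)^d at the
    exponential; r# e^{-xz} is then replaced by C psi. *)
Lemma right_fourier_reflecting psi A r (s : R[i]) d
    (h : (1 : {poly R[i]}) != 0) :
  xact A (fexp R) = fmulz r psi ->
  xact (oadj delta (oconj A)) psi = fmulz (qsharp r) (fexp R) ->
  right_fourier psi (RatDiffop (reflecting_numerator r s d) h).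
Proof.
move=> Ae Cpsi; set C := oadj _ _ in Cpsi.
pose y : {poly R[i]} := ('X - s%:P) ^+ d.
have [Q [e [e0 QE]]] := clear_denominators (ocomp delta A (y%:F *: C)).
exists (RatDiffop Q e0) => m /=; rewrite fmulz1 actx_xact QE actz_zact.
rewrite /xact (oactZ (x_action R)) /fscale /fmulx; congr (_ * _).
rewrite -[oact _ _ _ _]/(xact _ _) xact_comp.
have -> : xact (y%:F *: C) psi = fscale y%:F (fmulz (qsharp r) (fexp R)).
  by rewrite /xact (oactZ (x_action R)) -[oact _ _ _ _]/(xact _ _) Cpsi.
have fscale_fmulz a q u : fscale a (fmulz q u) = fmulz q (fscale a u).
  apply: (fmulz_comm (T := fscale a)) => // [v w|c w].
    exact: (act_mulDr (x_action R)).
  by rewrite -!(act_mulA (x_action R)) mulrC.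
rewrite fscale_fmulz xact_fmulz /zact (oactZ (z_action R)); congr (fmulz _ _ m).
pose Z u : fml := - (fdz u + fmulz s%:P u).
have -> : oact (V := (fml : zmodType)) (@fmulz R) (@fdz R) (iter d (zstep s) r%:P) psi =
    iter d Z (fmulz r psi).
  elim: d {y Q e e0 QE} => [|d IH] /=; first by rewrite (oactC (z_action R)).
  rewrite (oactN (z_action R)) (oactDl (z_action R)) (oact_dl (z_action R)).
  by rewrite (oactZ (z_action R)) IH.
rewrite -Ae.
have -> : iter d Z (xact A (fexp R)) = xact A (iter d Z (fexp R)).
  elim: d {y Q e e0 QE} => //= d ->; rewrite /Z.
  by rewrite xactN xactD xact_fdz xact_fmulz.
congr xact.
elim: d @y {Q e e0 QE} => [|d IH] /=; first by rewrite expr0 tofrac1 (act_mul1 (x_action R)).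
rewrite -IH exprS tofracM [LHS](act_mulA (x_action R)) /Z.
set a := _%:F; rewrite fdz_fscale fdz_fexp !fmulzC.
have -> : a = 'X%:F - cst s by rewrite /a tofracB.
move: (_ ^+ d)%:F (cst s) ('X%:F) (fexp R) => b c x e.
by apply/funext => n; rewrite !fctE /fscale; ring.
Qed.

End Factorization.

(** * Laplace transforms *)

Section TailIntegrals.
Variable R : realType.
Local Notation mu := (@lebesgue_measure R).
Local Open Scope classical_set_scope.
Implicit Types (f F : R -> R) (c s x C : R).

Lemma is_derive_expRM s x :
  is_derive x 1 (fun y => expR (s * y)) (s * expR (s * x)).
Proof.
have H : is_derive x 1 (fun y => s * y) s.
  have := is_deriveZ s (is_derive_id x (1 : R)).
  by rewrite /GRing.scale /= mulr1.
have := is_derive1_comp (is_derive_expR (s * x)) H.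
by rewrite mulrC.
Qed.

Lemma continuous_expRM s x : {for x, continuous (fun y => expR (s * y))}.
Proof.
have [+ _] := is_derive_expRM s x.
by move=> /derivable1_diffP /differentiable_continuous.
Qed.

Lemma cvgy0_expR_bound F C s c : s < 0 ->
  (forall x, c <= x -> `|F x| <= C * expR (s * x)) -> F x @[x --> +oo] --> 0.
Proof.
move=> s0 FC.
have E0 : (C * expR (s * x)) @[x --> +oo] --> 0.
  rewrite -[X in _ --> X](mulr0 C); apply: cvgMr.
  rewrite (_ : (fun x => expR (s * x)) = (fun z => expR (- z)) \o (fun z => (- s) * z)).
    apply: (@cvg_comp _ _ _ _ _ _ (pinfty_nbhs R)); last exact: cvgr_expR.
    by apply: gt0_cvgMry => //; rewrite oppr_gt0.
  by apply/funext => x /=; rewrite mulNr opprK.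
apply: (@squeeze_cvgr _ _ _ _ (fun x => - (C * expR (s * x)))
  (fun x => C * expR (s * x))) => //.
  near=> x; rewrite -ler_norml FC //; near: x; exact: nbhs_pinfty_ge.
by rewrite -oppr0; exact: cvgN.
Unshelve. all: by end_near. Qed.

Lemma measurable_tail c : measurable (`]c, +oo[ : set R).
Proof. exact: measurable_itv. Qed.

Lemma within_continuous_ge f c : (forall x, c <= x -> {for x, continuous f}) ->
  {within `[c, +oo[, continuous f}.
Proof.
move=> cf; apply: continuous_in_subspaceT => x.
by rewrite inE /= in_itv /= andbT => /cf.
Qed.

Lemma measurable_fun_ge f c : (forall x, c <= x -> {for x, continuous f}) ->
  measurable_fun `]c, +oo[ f.
Proof.
move=> cf; apply: open_continuous_measurable_fun => //.
by move=> x; rewrite inE /= in_itv /= andbT => /ltW /cf.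
Qed.

Lemma ge0_integral_tail f F C s c : s < 0 ->
  (forall x, c <= x -> 0 <= f x) ->
  (forall x, c <= x -> {for x, continuous f}) ->
  (forall x, c <= x -> is_derive x 1 F (f x)) ->
  (forall x, c <= x -> `|F x| <= C * expR (s * x)) ->
  (\int[mu]_(x in `]c, +oo[) (f x)%:E = (- F c)%:E)%E.
Proof.
move=> s0 f0 cf dF FC.
rewrite integral_itv_obnd_cbnd; last first.
  by apply/measurable_EFinP; exact: measurable_fun_ge cf.
rewrite (@ge0_continuous_FTC2y _ f F c 0) ?sub0e //.
- exact: within_continuous_ge.
- exact: cvgy0_expR_bound FC.
- by move=> x /ltW /dF [].
- apply: cvg_at_right_filter; have [dFc _] := dF c (lexx c).
  exact/differentiable_continuous/derivable1_diffP.
- move=> x; rewrite in_itv /= andbT => /ltW /dF.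
  by rewrite derive1E => /(@derive_val _ _ _ _ _ _ _).
Qed.

Lemma integral_expR s c : s < 0 ->
  (\int[mu]_(x in `]c, +oo[) (expR (s * x))%:E = (- (s^-1 * expR (s * c)))%:E)%E.
Proof.
move=> s0; apply: (@ge0_integral_tail _ (fun x => s^-1 * expR (s * x)) `|s^-1| s) => //.
- by move=> x _; exact: continuous_expRM.
- move=> x _; have := is_deriveZ (s^-1) (is_derive_expRM s x).
  by rewrite /GRing.scale /= mulKf // lt_eqF.
- by move=> x _; rewrite normrM [X in _ * X]ger0_norm // expR_ge0.
Qed.

Lemma integrable_expR s c : s < 0 ->
  mu.-integrable `]c, +oo[ (EFin \o (fun x => expR (s * x))).
Proof.
move=> s0; apply/integrableP; split.
  apply/measurable_EFinP; apply: (@measurable_fun_ge (fun x => expR (s * x))) => x _.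
  exact: continuous_expRM.
under eq_integral do rewrite /= ger0_norm ?expR_ge0 //.
by rewrite integral_expR // ltry.
Qed.

Lemma integrable_expR_bound f C s c : s < 0 ->
  (forall x, c <= x -> {for x, continuous f}) ->
  (forall x, c <= x -> `|f x| <= C * expR (s * x)) ->
  mu.-integrable `]c, +oo[ (EFin \o f).
Proof.
move=> s0 cf fC.
have iE : mu.-integrable `]c, +oo[ (fun x => C%:E * (expR (s * x))%:E)%E.
  by refine (integrableZl _ C (integrable_expR c s0)); exact: measurable_tail.
refine (le_integrable _ _ _ iE); first exact: measurable_tail.
  by apply/measurable_EFinP; exact: measurable_fun_ge cf.
move=> x /=; rewrite in_itv /= andbT => /ltW cx.
by rewrite lee_fin (le_trans (fC _ cx)) // ler_norm.
Qed.

(** Adding C e^{s x}, whose integral is known, makes the integrand nonnegative and reduces the claim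
    to [ge0_integral_tail]. *)
Lemma Rintegral_tail f F C s c : s < 0 ->
  (forall x, c <= x -> {for x, continuous f}) ->
  (forall x, c <= x -> is_derive x 1 F (f x)) ->
  (forall x, c <= x -> `|f x| <= C * expR (s * x)) ->
  (forall x, c <= x -> `|F x| <= C * expR (s * x)) ->
  \int[mu]_(x in `]c, +oo[) f x = - F c.
Proof.
move=> s0 cf dF fC FC.
pose g x := f x + C * expR (s * x).
pose G x := F x + C * (s^-1 * expR (s * x)).
have gE : (\int[mu]_(x in `]c, +oo[) (g x)%:E = (- G c)%:E)%E.
  apply: (@ge0_integral_tail _ G (`|C| + `|C * s^-1|) s) => // x cx.
  - by rewrite /g -lerBlDr sub0r lerNl (le_trans _ (fC _ cx)) // ler_normr lexx orbT.
  - by apply: cvgD; [exact: cf|apply: cvgMr; exact: continuous_expRM].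
  - apply: is_deriveD; first exact: dF.
    have := is_deriveZ (C * s^-1) (is_derive_expRM s x).
    rewrite /GRing.scale /= => H.
    have -> : (fun x => C * (s^-1 * expR (s * x))) = (fun x => C * s^-1 * expR (s * x)).
      by apply/funext => y; rewrite mulrA.
    by have -> : C * expR (s * x) = C / s * (s * expR (s * x)) by rewrite mulrA divfK // lt_eqF.
  - rewrite mulrDl (le_trans (ler_normD _ _)) // lerD //.
      by rewrite (le_trans (FC _ cx)) // ler_wpM2r ?expR_ge0 // ler_norm.
    by rewrite mulrA normrM [`|expR _|]ger0_norm // expR_ge0.
have if_ := integrable_expR_bound s0 cf fC.
have iE : mu.-integrable `]c, +oo[ (EFin \o (fun x => C * expR (s * x))).
  by refine (integrableZl _ C (integrable_expR c s0)); exact: measurable_tail.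
have : \int[mu]_(x in `]c, +oo[) g x = - G c by rewrite /Rintegral gE.
rewrite RintegralD // RintegralZl //; last exact: integrable_expR.
rewrite /Rintegral integral_expR //= /G opprD mulrN => /eqP.
by rewrite (inj_eq (addIr _)) => /eqP.
Qed.

End TailIntegrals.

(** * Complex-valued functions of a real variable *)

Section ComplexCalculus.
Variable R : realType.
Local Open Scope classical_set_scope.
Implicit Types (f g : R -> R[i]) (x : R) (z w v : R[i]).
Local Notation Re := complex.Re.
Local Notation Im := complex.Im.

Lemma cReD z w : Re (z + w) = Re z + Re w. Proof. by case: z w => [? ?] []. Qed.
Lemma cImD z w : Im (z + w) = Im z + Im w. Proof. by case: z w => [? ?] []. Qed.
Lemma cReN z : Re (- z) = - Re z. Proof. by case: z. Qed.
Lemma cImN z : Im (- z) = - Im z. Proof. by case: z. Qed.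
Lemma cReM z w : Re (z * w) = Re z * Re w - Im z * Im w.
Proof. by case: z w => [? ?] []. Qed.
Lemma cImM z w : Im (z * w) = Re z * Im w + Im z * Re w.
Proof. by case: z w => [? ?] []. Qed.
Lemma cReJ z : Re (conjc z) = Re z. Proof. by case: z. Qed.
Lemma cImJ z : Im (conjc z) = - Im z. Proof. by case: z. Qed.
Definition cpartE := (cReD, cImD, cReN, cImN, cReM, cImM, cReJ, cImJ).

Lemma cpart_eq z w : Re z = Re w -> Im z = Im w -> z = w.
Proof. by case: z w => [? ?] [? ?] /= -> ->. Qed.

Definition is_cder f x v : Prop :=
  is_derive x 1 (fun y => Re (f y)) (Re v) /\ is_derive x 1 (fun y => Im (f y)) (Im v).

Definition ccont f x : Prop :=
  {for x, continuous (fun y => Re (f y))} /\ {for x, continuous (fun y => Im (f y))}.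

Lemma derivable_continuous (h : R -> R) x : derivable h x 1 -> {for x, continuous h}.
Proof. by move=> /derivable1_diffP /differentiable_continuous. Qed.

Lemma is_cder_ccont f x v : is_cder f x v -> ccont f x.
Proof. by case=> [[? _] [? _]]; split; exact: derivable_continuous. Qed.

Lemma is_cder_cderiv f x v : is_cder f x v -> cderiv f x = v.
Proof.
case=> [d1 d2]; apply: cpart_eq; rewrite /cderiv /= derive1E.
  by have [_ ->] := d1.
by have [_ ->] := d2.
Qed.

Lemma is_cder_cderivable f x v : is_cder f x v -> cderivable f x.
Proof. by case=> [[? _] [? _]]. Qed.

Lemma cderivable_is_cder f x : cderivable f x -> is_cder f x (cderiv f x).
Proof.
by case=> d1 d2; split; rewrite /= derive1E; split.
Qed.

Lemma is_cder_near f g x v : (\forall y \near x, f y = g y) ->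
  is_cder f x v -> is_cder g x v.
Proof.
move=> fg [d1 d2]; split.
  apply: near_eq_is_derive d1.
  by apply: filterS fg => y; rewrite /= => ->.
apply: near_eq_is_derive d2.
by apply: filterS fg => y; rewrite /= => ->.
Qed.

Lemma is_cder_cst z x : is_cder (fun=> z) x 0.
Proof. by split; exact: is_derive_cst. Qed.

Lemma is_cder_real (h : R -> R) x (d : R) :
  is_derive x 1 h d -> is_cder (fun y => (h y)%:C) x d%:C.
Proof. by move=> hd; split=> //=; exact: is_derive_cst. Qed.

Lemma is_cder_id x : is_cder (fun y => y%:C) x 1.
Proof. exact: is_cder_real. Qed.

Lemma is_cderD f g x v w : is_cder f x v -> is_cder g x w ->
  is_cder (fun y => f y + g y) x (v + w).
Proof.
move=> [f1 f2] [g1 g2]; split; rewrite !cpartE.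
  rewrite (_ : (fun y => _) = (fun y => Re (f y)) + (fun y => Re (g y))).
    exact: is_deriveD.
  by apply/funext => y; rewrite cpartE.
rewrite (_ : (fun y => _) = (fun y => Im (f y)) + (fun y => Im (g y))).
  exact: is_deriveD.
by apply/funext => y; rewrite cpartE.
Qed.

Lemma is_deriveM_ (h k : R -> R) x (a b : R) : is_derive x 1 h a -> is_derive x 1 k b ->
  is_derive x 1 (fun y => h y * k y) (a * k x + h x * b).
Proof.
move=> ha kb; have := is_deriveM ha kb.
by rewrite /GRing.scale /= addrC [k x * a]mulrC.
Qed.

Lemma is_cderM f g x v w : is_cder f x v -> is_cder g x w ->
  is_cder (fun y => f y * g y) x (v * g x + f x * w).
Proof.
move=> [f1 f2] [g1 g2]; split; rewrite !cpartE.
  rewrite (_ : (fun y => _) = (fun y => Re (f y) * Re (g y)) - (fun y => Im (f y) * Im (g y))).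
    apply: is_derive_eq (is_deriveB (is_deriveM_ f1 g1) (is_deriveM_ f2 g2)) _.
    by rewrite opprD addrACA.
  by apply/funext => y; rewrite cpartE.
rewrite (_ : (fun y => _) = (fun y => Re (f y) * Im (g y)) + (fun y => Im (f y) * Re (g y))).
  apply: is_derive_eq (is_deriveD (is_deriveM_ f1 g2) (is_deriveM_ f2 g1)) _.
  by rewrite addrACA.
by apply/funext => y; rewrite cpartE.
Qed.

Lemma is_cderZ z f x v : is_cder f x v -> is_cder (fun y => z * f y) x (z * v).
Proof.
by move=> fv; have := is_cderM (is_cder_cst z x) fv; rewrite mul0r add0r.
Qed.

Lemma is_cderN f x v : is_cder f x v -> is_cder (fun y => - f y) x (- v).
Proof.
move=> /(is_cderZ (-1)); rewrite mulN1r.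
by rewrite (_ : (fun y => _) = fun y => - f y) //; apply/funext => y; rewrite mulN1r.
Qed.

Lemma is_cder_sum (I : Type) (r : seq I) (F : I -> R -> R[i]) (V : I -> R[i]) x :
  (forall i, is_cder (F i) x (V i)) ->
  is_cder (fun y => \sum_(i <- r) F i y) x (\sum_(i <- r) V i).
Proof.
move=> FV; elim: r => [|i r IH].
  rewrite big_nil (_ : (fun y => _) = fun=> 0); first exact: is_cder_cst.
  by apply/funext => y; rewrite big_nil.
rewrite big_cons (_ : (fun y => _) = fun y => F i y + \sum_(i <- r) F i y).
  exact: is_cderD.
by apply/funext => y; rewrite big_cons.
Qed.

Lemma is_cderJ f x v : is_cder f x v -> is_cder (fun y => conjc (f y)) x (conjc v).
Proof.
move=> [f1 f2]; split; rewrite !cpartE.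
  by rewrite (_ : (fun y => _) = fun y => Re (f y)) //; apply/funext => y; rewrite cpartE.
rewrite (_ : (fun y => _) = - (fun y => Im (f y))); first exact: is_deriveN.
by apply/funext => y; rewrite cpartE.
Qed.

(** Reduces to real functions by 1 / f = conj f / |f|^2, an identity that also holds at zeros of f
    by the convention on inverses. *)
Lemma is_cderV f x v : f x != 0 -> is_cder f x v ->
  is_cder (fun y => (f y)^-1) x (- v / f x ^+ 2).
Proof.
move=> fx0 fv; have [f1 f2] := fv.
pose n y := Re (f y) * Re (f y) + Im (f y) * Im (f y).
have nE y : (n y)%:C = f y * conjc (f y).
  by apply: cpart_eq; rewrite !cpartE /= /n ?mulrN ?opprK // mulrC addNr.
have nx0 : n x != 0.
  apply: contra fx0 => /eqP n0; have := nE x; rewrite n0 => /esym/eqP.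
  by rewrite mulf_eq0 conjc_eq0 orbb.
have dn : is_derive x 1 n (2 * (Re (f x) * Re v + Im (f x) * Im v)).
  apply: is_derive_eq (is_deriveD (is_deriveM_ f1 f1) (is_deriveM_ f2 f2)) _; ring.
have dV : is_derive x 1 (fun y => (n y)^-1) (- n x ^- 2 * (2 * (Re (f x) * Re v + Im (f x) * Im v))).
  by have := is_deriveV nx0 dn.
have fE y : (f y)^-1 = conjc (f y) * (n y)^-1%:C.
  have [fy0|fy0] := eqVneq (f y) 0; first by rewrite fy0 conjc0 mul0r invr0.
  have -> : (n y)^-1%:C = (n y)%:C^-1 by rewrite fmorphV.
  by rewrite nE invfM mulrCA mulfV ?mulr1 // conjc_eq0.
rewrite (_ : (fun y => _) = fun y => conjc (f y) * (n y)^-1%:C); last first.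
  by apply/funext => y; rewrite fE.
have := is_cderM (is_cderJ fv) (is_cder_real dV).
set d := (X in is_cder _ _ X) => H; suff -> : - v / f x ^+ 2 = d by exact: H.
rewrite /d {H d}.
have dE : (2 * (Re (f x) * Re v + Im (f x) * Im v))%:C = v * conjc (f x) + f x * conjc v.
  by apply: cpart_eq; rewrite !cpartE /=; ring.
have -> : (- n x ^- 2 * (2 * (Re (f x) * Re v + Im (f x) * Im v)))%:C =
   - (n x)%:C ^- 2 * (v * conjc (f x) + f x * conjc v).
  by rewrite -dE -rmorphXn -fmorphV -rmorphN -rmorphM.
have -> : ((n x)^-1)%:C = (f x * conjc (f x))^-1 by rewrite -nE; exact: fmorphV.
rewrite nE.
have cfx0 : conjc (f x) != 0 by rewrite conjc_eq0.
move: (f x) (conjc (f x)) (conjc v) fx0 cfx0 => a b c a0 b0.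
by field; rewrite a0 b0.
Qed.

Lemma is_cder_horner (p : {poly R[i]}) x :
  is_cder (fun y => p.[y%:C]) x p^`().[x%:C].
Proof.
elim/poly_ind: p => [|p c IH].
  rewrite deriv0 horner0 (_ : (fun y => _) = fun=> 0); first exact: is_cder_cst.
  by apply/funext => y; rewrite horner0.
rewrite derivMXaddC !hornerE.
rewrite (_ : (fun y => _) = fun y => p.[y%:C] * y%:C + c).
  have := is_cderD (is_cderM IH (is_cder_id x)) (is_cder_cst c x).
  by rewrite mulr1 addr0 addrC.
by apply/funext => y; rewrite !hornerE.
Qed.

Lemma is_cder_exprN k x :
  is_cder (fun y => (- y%:C) ^+ k) x (k%:R * - 1 * (- x%:C) ^+ k.-1).
Proof.
have E (j : nat) (z : R[i]) : ((- 'X) ^+ j).[z] = (- z) ^+ j.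
  by rewrite horner_exp hornerN hornerX.
have := is_cder_horner ((- 'X) ^+ k) x.
rewrite deriv_exp derivN derivX hornerMn hornerM hornerN hornerC E -mulr_natl mulrA.
have -> // : (fun y : R => ((- 'X) ^+ k : {poly R[i]}).[y%:C]) = fun y : R => (- y%:C) ^+ k.
by apply/funext => y; exact: E.
Qed.

Lemma ccontM f g x : ccont f x -> ccont g x -> ccont (fun y => f y * g y) x.
Proof.
move=> [f1 f2] [g1 g2]; split.
  rewrite (_ : (fun y => _) = fun y => Re (f y) * Re (g y) - Im (f y) * Im (g y)).
    by apply: cvgB; apply: cvgM.
  by apply/funext => y; rewrite cpartE.
rewrite (_ : (fun y => _) = fun y => Re (f y) * Im (g y) + Im (f y) * Re (g y)).
  by apply: cvgD; apply: cvgM.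
by apply/funext => y; rewrite cpartE.
Qed.

Lemma ccontD f g x : ccont f x -> ccont g x -> ccont (fun y => f y + g y) x.
Proof.
move=> [f1 f2] [g1 g2]; split.
  rewrite (_ : (fun y => _) = fun y => Re (f y) + Re (g y)); first exact: cvgD.
  by apply/funext => y; rewrite cpartE.
rewrite (_ : (fun y => _) = fun y => Im (f y) + Im (g y)); first exact: cvgD.
by apply/funext => y; rewrite cpartE.
Qed.

Lemma ccont_cst z x : ccont (fun=> z) x.
Proof. exact: is_cder_ccont (is_cder_cst z x). Qed.

(** The l^1 norm replaces the modulus: it is real-valued, submultiplicative, and dominates both
    parts, which is all that the estimates require. *)
Definition cnorm1 z : R := `|Re z| + `|Im z|.

Lemma cnorm1_ge0 z : 0 <= cnorm1 z.
Proof. by rewrite addr_ge0. Qed.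

Lemma cnorm1D z w : cnorm1 (z + w) <= cnorm1 z + cnorm1 w.
Proof. by rewrite /cnorm1 !cpartE addrACA lerD // ler_normD. Qed.

Lemma cnorm1M z w : cnorm1 (z * w) <= cnorm1 z * cnorm1 w.
Proof.
rewrite /cnorm1 !cpartE mulrDl !mulrDr -!normrM addrACA.
rewrite [leLHS](_ : _ = `|Re z * Re w + - (Im z * Im w)| + `|Re z * Im w + Im z * Re w|) //.
apply: le_trans (lerD (ler_normD _ _) (ler_normD _ _)) _.
rewrite normrN; set a := `|Re z * Re w|; set b := `|Im z * Im w|.
by set c := `|Re z * Im w|; set d := `|Im z * Re w|; lra.
Qed.

Lemma cnorm1_real (a : R) : cnorm1 a%:C = `|a|.
Proof. by rewrite /cnorm1 /= normr0 addr0. Qed.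

Lemma cnorm1_ReIm z : `|Re z| <= cnorm1 z /\ `|Im z| <= cnorm1 z.
Proof. by rewrite lerDl lerDr !normr_ge0. Qed.

End ComplexCalculus.

(** * Integrals of complex-valued functions *)

Section ComplexIntegral.
Variable R : realType.
Local Notation mu := (@lebesgue_measure R).
Local Open Scope classical_set_scope.
Implicit Types (f g : R -> R[i]) (A : set R) (z w v : R[i]).
Local Notation Re := complex.Re.
Local Notation Im := complex.Im.

Lemma eq_cintegral A f g : (forall x, A x -> f x = g x) ->
  cintegral A f = cintegral A g.
Proof.
by move=> fg; apply: cpart_eq => /=; apply: eq_Rintegral => x; rewrite inE => /fg ->.
Qed.

Lemma eq_cintegral_tail (c : R) f g : (forall x, c < x -> f x = g x) ->
  cintegral `]c, +oo[ f = cintegral `]c, +oo[ g.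
Proof. by move=> fg; apply: eq_cintegral => x; rewrite /= in_itv /= andbT => /fg. Qed.

Lemma cintegrableZ A z f : measurable A -> cintegrable A f ->
  cintegrable A (fun x => z * f x).
Proof.
move=> mA [f1 f2]; split.
  rewrite (_ : (fun x => _) = (fun x => (Re z)%:E * (Re (f x))%:E - (Im z)%:E * (Im (f x))%:E)%E).
    refine (integrableB _ (integrableZl _ _ f1) (integrableZl _ _ f2)); exact: mA.
  by apply/funext => x; rewrite cpartE.
rewrite (_ : (fun x => _) = (fun x => (Re z)%:E * (Im (f x))%:E + (Im z)%:E * (Re (f x))%:E)%E).
  refine (integrableD _ (integrableZl _ _ f2) (integrableZl _ _ f1)); exact: mA.
by apply/funext => x; rewrite cpartE.
Qed.

Lemma cintegrableD A f g : measurable A -> cintegrable A f -> cintegrable A g ->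
  cintegrable A (fun x => f x + g x).
Proof.
move=> mA [f1 f2] [g1 g2]; split.
  rewrite (_ : (fun x => _) = (fun x => (Re (f x))%:E + (Re (g x))%:E)%E).
    refine (integrableD _ f1 g1); exact: mA.
  by apply/funext => x; rewrite cpartE.
rewrite (_ : (fun x => _) = (fun x => (Im (f x))%:E + (Im (g x))%:E)%E).
  refine (integrableD _ f2 g2); exact: mA.
by apply/funext => x; rewrite cpartE.
Qed.

Lemma cintegralZ A z f : measurable A -> cintegrable A f ->
  cintegral A (fun x => z * f x) = z * cintegral A f.
Proof.
move=> mA [f1 f2].
have i1 a : mu.-integrable A (fun x => (a * Re (f x))%:E).
  by refine (integrableZl _ a f1); exact: mA.
have i2 a : mu.-integrable A (fun x => (a * Im (f x))%:E).
  by refine (integrableZl _ a f2); exact: mA.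
apply: cpart_eq; rewrite cpartE /=; under eq_Rintegral do rewrite cpartE.
  by rewrite RintegralB ?RintegralZl //; [exact: i1|exact: i2].
by rewrite RintegralD ?RintegralZl //; [exact: i2|exact: i1].
Qed.

Lemma cintegralD A f g : measurable A -> cintegrable A f -> cintegrable A g ->
  cintegral A (fun x => f x + g x) = cintegral A f + cintegral A g.
Proof.
move=> mA [f1 f2] [g1 g2].
by apply: cpart_eq; rewrite cpartE /=; under eq_Rintegral do rewrite cpartE;
  rewrite RintegralD.
Qed.

Lemma cintegral_sum A n (F : nat -> R -> R[i]) : measurable A ->
  (forall k, cintegrable A (F k)) ->
  cintegrable A (fun x => \sum_(k < n) F k x) /\
  cintegral A (fun x => \sum_(k < n) F k x) = \sum_(k < n) cintegral A (F k).
Proof.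
move=> mA iF; elim: n => [|n [IH1 IH2]].
  have -> : (fun x => \sum_(k < 0) F k x) = fun x => 0 * F 0%N x.
    by apply/funext => x; rewrite big_ord0 mul0r.
  by rewrite cintegralZ // mul0r big_ord0; split=> //; exact: cintegrableZ.
have -> : (fun x => \sum_(k < n.+1) F k x) = fun x => \sum_(k < n) F k x + F n x.
  by apply/funext => x; rewrite big_ord_recr.
by rewrite cintegralD // IH2 big_ord_recr; split=> //; exact: cintegrableD.
Qed.

End ComplexIntegral.

(** * Functions of exponential growth and their Laplace transforms *)

Section Tame.
Variable R : realType.
Local Notation mu := (@lebesgue_measure R).
Local Open Scope classical_set_scope.
Implicit Types (f g F v u : R -> R[i]) (x y z c s : R).
Local Notation Re := complex.Re.
Local Notation Im := complex.Im.

(** Continuity and growth of exponential rate s, which may be negative. The rates add up in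
    products, so that the existence of an integral becomes the sign of a sum of rates. *)
Definition tame c s v : Prop :=
  (forall x, c <= x -> ccont v x) /\
  exists C, forall x, c <= x -> cnorm1 (v x) <= C * expR (s * x).

Lemma tame_bound c s v : tame c s v ->
  exists C, 0 <= C /\ forall x, c <= x -> cnorm1 (v x) <= C * expR (s * x).
Proof.
case=> _ [C HC]; exists `|C|; split=> // x cx.
by rewrite (le_trans (HC x cx)) // ler_wpM2r ?expR_ge0 // ler_norm.
Qed.

Lemma tame_weaken c s s' v : s <= s' -> tame c s v -> tame c s' v.
Proof.
move=> ss' vs; split; first by case: vs.
have [C [C0 HC]] := tame_bound vs; exists (C * expR ((s - s') * c)) => x cx.
rewrite (le_trans (HC x cx)) // -mulrA ler_wpM2l // -expRD ler_expR.
by rewrite -lerBlDr -mulrBl ler_wnM2l // subr_le0.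
Qed.

Lemma tameD c s f g : tame c s f -> tame c s g -> tame c s (fun x => f x + g x).
Proof.
move=> [cf [C HC]] [cg [D HD]]; split=> [x cx|]; first exact: ccontD (cf _ _) (cg _ _).
exists (C + D) => x cx; rewrite (le_trans (cnorm1D _ _)) // mulrDl.
by rewrite lerD ?HC ?HD.
Qed.

Lemma tameM c s s' f g : tame c s f -> tame c s' g -> tame c (s + s') (fun x => f x * g x).
Proof.
move=> tf tg; split=> [x cx|].
  by case: tf tg => cf _ [cg _]; exact: ccontM (cf _ _) (cg _ _).
have [C [C0 HC]] := tame_bound tf; have [D [D0 HD]] := tame_bound tg.
exists (C * D) => x cx; rewrite (le_trans (cnorm1M _ _)) // (mulrDl s) expRD mulrACA.
by rewrite ler_pM ?cnorm1_ge0 ?HC ?HD.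
Qed.

Lemma tame_cst c a : tame c 0 (fun=> a).
Proof.
split=> [x _|]; first exact: ccont_cst.
by exists (cnorm1 a) => x _; rewrite mul0r expR0 mulr1.
Qed.

Lemma tameZ c s a f : tame c s f -> tame c s (fun x => a * f x).
Proof. by move=> /(tameM (tame_cst c a)); rewrite add0r. Qed.

Lemma tameN c s f : tame c s f -> tame c s (fun x => - f x).
Proof.
move=> /(tameZ (-1)); rewrite (_ : (fun x => _) = fun x => - f x) //.
by apply/funext => x; rewrite mulN1r.
Qed.

Lemma tame0 c s : tame c s (fun=> 0).
Proof.
split=> [x _|]; first exact: ccont_cst.
by exists 0 => x _; rewrite mul0r /cnorm1 /= normr0 addr0.
Qed.

Lemma tame_sum c s (I : Type) (r : seq I) (F : I -> R -> R[i]) :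
  (forall i, tame c s (F i)) -> tame c s (fun x => \sum_(i <- r) F i x).
Proof.
move=> tF; elim: r => [|i r IH].
  rewrite (_ : (fun x => _) = fun=> 0); first exact: tame0.
  by apply/funext => x; rewrite big_nil.
rewrite (_ : (fun x => _) = fun x => F i x + \sum_(i <- r) F i x); first exact: tameD.
by apply/funext => x; rewrite big_cons.
Qed.

Lemma tame_expR c s : tame c s (fun x => (expR (s * x))%:C).
Proof.
split=> [x _|].
  exact: is_cder_ccont (is_cder_real (is_derive_expRM s x)).
by exists 1 => x _; rewrite mul1r cnorm1_real ger0_norm // expR_ge0.
Qed.

Lemma normr_le_expR c s : 0 < s ->
  exists C, 0 <= C /\ forall x, c <= x -> `|x| <= C * expR (s * x).
Proof.
(* The first summand serves for x >= 0, by 1 + s x <= e^{s x}; the second for c <= x < 0, where |x|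
   <= |c|. *)
move=> s0; exists (s^-1 + `|c| * expR (s * `|c|)); split.
  by rewrite addr_ge0 ?invr_ge0 ?(ltW s0) // mulr_ge0 ?expR_ge0.
move=> x cx; rewrite mulrDl; have [x0|x0] := leP 0 x.
  rewrite ger0_norm //; apply: ler_wpDr; first by rewrite !mulr_ge0 ?expR_ge0.
  rewrite -ler_pdivrMl ?invr_gt0 // invrK (le_trans _ (expR_ge1Dx _)) //.
  by rewrite lerDr.
apply: ler_wpDl; first by rewrite mulr_ge0 ?expR_ge0 // invr_ge0 ltW.
have xc : `|x| <= `|c|.
  by rewrite (ltr0_norm x0) (ltr0_norm (le_lt_trans cx x0)) lerN2.
rewrite -mulrA -expRD -mulrDr -[leLHS]mulr1 ler_pM // -[leLHS]expR0 ler_expR.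
by rewrite mulr_ge0 ?(ltW s0) // -lerBlDr sub0r -(ltr0_norm x0).
Qed.

Lemma tame_id c s : 0 < s -> tame c s (fun x => x%:C).
Proof.
move=> s0; split=> [x _|]; first exact: is_cder_ccont (is_cder_id x).
by have [C [_ HC]] := normr_le_expR c s0; exists C => x cx; rewrite cnorm1_real HC.
Qed.

Lemma tame_cintegrable c s v : s < 0 -> tame c s v -> cintegrable `]c, +oo[ v.
Proof.
move=> s0 [cv [C HC]]; split; apply: (@integrable_expR_bound _ _ C s) => // x cx.
- by case: (cv x cx).
- by rewrite (le_trans _ (HC x cx)) //; case: (cnorm1_ReIm (v x)).
- by case: (cv x cx).
- by rewrite (le_trans _ (HC x cx)) //; case: (cnorm1_ReIm (v x)).
Qed.

Lemma tame_L2 c s f : s < 0 -> tame c s f -> L2 `]c, +oo[ f.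
Proof.
move=> s0 tf; have [cf _] := tf; have [C [C0 HC]] := tame_bound tf.
have cR x : c <= x -> {for x, continuous (fun x => complex.Re (f x))} by move=> /cf [].
have cI x : c <= x -> {for x, continuous (fun x => complex.Im (f x))} by move=> /cf [].
split; [exact: measurable_fun_ge|exact: measurable_fun_ge|].
pose F x := complex.Re (f x) ^+ 2 + complex.Im (f x) ^+ 2.
have F0 x : 0 <= F x by rewrite addr_ge0 ?sqr_ge0.
have iF : mu.-integrable `]c, +oo[ (EFin \o F).
  apply: (@integrable_expR_bound _ _ (C * C) (s + s)) => [|x cx|x cx].
  - by lra.
  - by apply: cvgD; rewrite expr2; apply: cvgM; (exact: cR || exact: cI).
  - rewrite ger0_norm // mulrDl expRD mulrACA.
    have := HC x cx; rewrite /cnorm1 /F -(real_normK (num_real (complex.Re (f x)))).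
    rewrite -(real_normK (num_real (complex.Im (f x)))).
    have := normr_ge0 (complex.Re (f x)); have := normr_ge0 (complex.Im (f x)).
    set u := `|_|; set v := `|_|; set w := C * _ => u0 v0 uvw.
    by nra.
have [_] := integrableP _ _ _ iF.
by under eq_integral do rewrite /= ger0_norm //.
Qed.

Lemma cintegral_tail c s f F : s < 0 -> tame c s f -> tame c s F ->
  (forall x, c <= x -> is_cder F x (f x)) -> cintegral `]c, +oo[ f = - F c.
Proof.
move=> s0 tf tF dF.
have [C [C0 HC]] := tame_bound tf; have [D [D0 HD]] := tame_bound tF.
have [cf _] := tf.
have CD : C <= C + D by rewrite lerDl.
have DC : D <= C + D by rewrite lerDr.
have H (h : R[i] -> R) : (forall w, `|h w| <= cnorm1 w) ->
    (forall x, c <= x -> {for x, continuous (fun y => h (f y))}) ->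
    (forall x, c <= x -> is_derive x 1 (fun y => h (F y)) (h (f x))) ->
    \int[mu]_(x in `]c, +oo[) h (f x) = - h (F c).
  move=> hn ch dh; apply: (@Rintegral_tail _ _ (fun y => h (F y)) (C + D) s) => // x cx.
    by rewrite (le_trans (hn _)) // (le_trans (HC x cx)) // ler_wpM2r ?expR_ge0.
  by rewrite (le_trans (hn _)) // (le_trans (HD x cx)) // ler_wpM2r ?expR_ge0.
apply: cpart_eq; rewrite cpartE /=; apply: H => [w|x /cf []|x /dF []] //.
  by case: (cnorm1_ReIm w).
by case: (cnorm1_ReIm w).
Qed.

Definition Lap c v : R -> R[i] :=
  fun z => cintegral `]c, +oo[ (fun y => (expR (- (y * z)))%:C * v y).

Lemma tame_kernel c s v z : tame c s v ->
  tame c (s - z) (fun y => (expR (- (y * z)))%:C * v y).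
Proof.
move=> tv; rewrite addrC; apply: tameM => //.
rewrite (_ : (fun x => _) = fun x => (expR (- z * x))%:C); first exact: tame_expR.
by apply/funext => x; rewrite mulNr mulrC.
Qed.

Lemma Lap_integrable c s v z : s < z -> tame c s v ->
  cintegrable `]c, +oo[ (fun y => (expR (- (y * z)))%:C * v y).
Proof.
move=> sz tv; apply: (tame_cintegrable (s := s - z)); first by rewrite subr_lt0.
exact: tame_kernel.
Qed.

(** Differentiation under the integral sign, with an integrable bound on the derivative of the
    integrand that is uniform for parameters near z. *)
Lemma is_derive_under_kernel (h : R -> R) c s z C : s < z -> 0 <= C ->
  (forall x, c <= x -> {for x, continuous h}) ->
  (forall x, c <= x -> `|h x| <= C * expR (s * x)) ->
  is_derive z 1 (fun z => \int[mu]_(y in `]c, +oo[) (expR (- (y * z)) * h y))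
    (\int[mu]_(y in `]c, +oo[) (expR (- (y * z)) * (- y * h y))).
Proof.
move=> sz C0 ch hC.
(* On ]u, w[ the kernel keeps a rate below -u, hence a margin u - s > 0 over the growth of h; half
   of the margin pays for the factor y. *)
pose u := (s + z) / 2; pose w := z + 1.
have su : s < u by rewrite /u; lra.
have Iz : `]u, w[ z by rewrite /= in_itv /=; apply/andP; split; rewrite /u /w; lra.
have us : 0 < (u - s) / 2 by rewrite divr_gt0 // subr_gt0.
have [B [B0 HB]] := normr_le_expR c us.
have cE x y : {for y, continuous (fun y => expR (- (y * x)))}.
  rewrite (_ : (fun y => _) = fun y => expR (- x * y)); first exact: continuous_expRM.
  by apply/funext => y'; rewrite mulNr mulrC.
(* When c < 0, the kernel at negative y increases with the parameter instead of decreasing; M bounds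
   its ratio to the value at u for c <= y < 0. *)
pose M := expR (`|c| * (w - u)).
have EM x y : `]u, w[ x -> c <= y -> expR (- (y * x)) <= M * expR (- (y * u)).
  rewrite /= in_itv /= => /andP[ux xw] cy; rewrite -expRD ler_expR.
  have -> : - (y * x) = - y * (x - u) + - (y * u) by ring.
  rewrite lerD2r; have [y0|y0] := leP 0 y.
    apply: (@le_trans _ _ 0); first by rewrite mulNr oppr_le0 mulr_ge0 // subr_ge0 ltW.
    by rewrite mulr_ge0 // subr_ge0 ltW // (lt_trans ux).
  have c0 : c < 0 by exact: le_lt_trans y0.
  rewrite ler_pM ?subr_ge0 ?oppr_ge0 ?(ltW y0) ?(ltW ux) //.
    by rewrite ltr0_norm // lerN2.
  by rewrite lerD2r ltW.
pose G y := M * (`|y| * (expR (- (y * u)) * `|h y|)).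
have G0 y : 0 <= G y by rewrite !mulr_ge0 ?expR_ge0.
have intG : mu.-integrable `]c, +oo[ (EFin \o G).
  apply: (@integrable_expR_bound _ _ (M * (B * C)) (s - u + (u - s) / 2)); first by lra.
    move=> x cx; apply: cvgM; first exact: cvg_cst.
    apply: cvgM; first exact: cvg_norm.
    apply: cvgM; first exact: cE.
    by apply: cvg_norm; exact: ch.
  move=> x cx; rewrite ger0_norm // /G -!mulrA ler_wpM2l ?expR_ge0 //.
  have -> : (s - u + (u - s) / 2) * x = (u - s) / 2 * x + (- (x * u) + s * x) by ring.
  rewrite !expRD.
  rewrite [leRHS](_ : _ = (B * expR ((u - s) / 2 * x)) * (expR (- (x * u)) * (C * expR (s * x)))); last by ring.
  by rewrite ler_pM ?mulr_ge0 ?expR_ge0 // ?HB // ler_wpM2l ?expR_ge0 // hC.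
have dk x y : is_derive x 1 (fun x => expR (- (y * x)) * h y) (expR (- (y * x)) * (- y * h y)).
  have := is_deriveM_ (is_derive_expRM (- y) x) (is_derive_cst (h y) x 1).
  rewrite mulr0 addr0 (_ : (fun x => expR (- y * x) * _) = fun x => expR (- (y * x)) * h y).
    by move=> H; apply: is_derive_eq H _; rewrite /= [- y * x]mulNr; ring.
  by apply/funext => x'; rewrite mulNr.
have pE x y : partial1of2 (fun z y => expR (- (y * z)) * h y) x y = expR (- (y * x)) * (- y * h y).
  by rewrite partial1of2E; have [_ ->] := dk x y.
have intf x : `]u, w[ x -> mu.-integrable `]c, +oo[ (EFin \o (fun y => expR (- (y * x)) * h y)).
  rewrite /= in_itv /= => /andP[ux _].
  apply: (@integrable_expR_bound _ _ C (s - x)); first by rewrite subr_lt0 (lt_trans su).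
    by move=> y cy; apply: cvgM; [exact: cE|exact: ch].
  move=> y cy; rewrite normrM ger0_norm ?expR_ge0 // mulrBl expRD mulrCA [x * y]mulrC.
  rewrite (_ : _ * (C * _) = expR (- (y * x)) * (C * expR (s * y))); last by ring.
  by rewrite ler_wpM2l ?expR_ge0 // hC.
have dG x y : `]u, w[ x -> `]c, +oo[ y ->
    `|partial1of2 (fun z y => expR (- (y * z)) * h y) x y| <= G y.
  move=> Ix; rewrite /= in_itv /= andbT => /ltW cy.
  rewrite pE !normrM normrN ger0_norm ?expR_ge0 // mulrCA /G [leRHS]mulrCA.
  by rewrite ler_wpM2l // mulrA ler_wpM2r // EM.
have mD := measurable_tail c.
have d1 x y : `]u, w[ x -> `]c, +oo[ y -> derivable (fun x => expR (- (y * x)) * h y) x 1.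
  by move=> _ _; have [] := dk x y.
apply: DeriveDef; first by refine (derivable_under_integral _ Iz intf d1 G0 intG dG); exact: mD.
rewrite -derive1E; refine (eq_trans (differentiation_under_integral _ Iz intf d1 G0 intG dG) _).
  exact: mD.
by apply: eq_Rintegral => y _; rewrite pE.
Qed.

Lemma is_cder_Lap c s v z : s < z -> tame c s v ->
  is_cder (Lap c v) z (Lap c (fun y => - y%:C * v y) z).
Proof.
move=> sz tv; have [C [C0 HC]] := tame_bound tv; have [cv _] := tv.
split.
  rewrite (_ : (fun y => Re _) = fun z => \int[mu]_(y in `]c, +oo[) (expR (- (y * z)) * Re (v y))).
    rewrite (_ : Re _ = \int[mu]_(y in `]c, +oo[) (expR (- (y * z)) * (- y * Re (v y)))).
      apply: (is_derive_under_kernel sz C0) => x cx; first by case: (cv x cx).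
      by rewrite (le_trans _ (HC x cx)) //; case: (cnorm1_ReIm (v x)).
    apply: eq_Rintegral => x _.
    by rewrite !cpartE /= oppr0 !mul0r !subr0.
  apply/funext => y; apply: eq_Rintegral => x _.
  by rewrite cpartE /= mul0r subr0.
rewrite (_ : (fun y => Im _) = fun z => \int[mu]_(y in `]c, +oo[) (expR (- (y * z)) * Im (v y))).
  rewrite (_ : Im _ = \int[mu]_(y in `]c, +oo[) (expR (- (y * z)) * (- y * Im (v y)))).
    apply: (is_derive_under_kernel sz C0) => x cx; first by case: (cv x cx).
    by rewrite (le_trans _ (HC x cx)) //; case: (cnorm1_ReIm (v x)).
  apply: eq_Rintegral => x _.
  by rewrite !cpartE /= oppr0 !mul0r !addr0.
apply/funext => y; apply: eq_Rintegral => x _.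
by rewrite cpartE /= mul0r addr0.
Qed.

End Tame.

(** * Operators with rational coefficients *)

Section RationalValues.
Variable R : realType.
Local Open Scope classical_set_scope.
Local Notation Re := complex.Re.
Local Notation Im := complex.Im.
Implicit Types (f g : ratfun R) (n d p : {poly R[i]}) (x c : R).

(* the value at the real point x; 0 if f has a pole there *)
Definition reval f x : R[i] := xget 0 [set v | exists n d,
  [/\ d.[x%:C] != 0, f = n%:F / d%:F & v = n.[x%:C] / d.[x%:C]]].

Definition rreg c f : Prop := exists n d,
  (forall x, c <= x -> d.[x%:C] != 0) /\ f = n%:F / d%:F.

Lemma horner_neq0 p (z : R[i]) : p.[z] != 0 -> p != 0.
Proof. by apply: contraNneq => ->; rewrite horner0. Qed.

Lemma revalE n d x : d.[x%:C] != 0 -> reval (n%:F / d%:F) x = n.[x%:C] / d.[x%:C].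
Proof.
move=> dx; rewrite /reval; case: xgetP => [v _ [n' [d' [d'x e ->]]]|/(_ (n.[x%:C] / d.[x%:C]))].
  apply/esym/eqP; rewrite eqr_div // -!hornerM; apply/eqP; congr horner.
  by apply/eqP; rewrite -ratfun_eq ?e // ?(horner_neq0 dx) ?(horner_neq0 d'x).
by case; exists n, d.
Qed.

Lemma reval_poly p x : reval p%:F x = p.[x%:C].
Proof. by rewrite poly_over1 revalE hornerC ?oner_neq0 // divr1. Qed.

Lemma rreg_poly c p : rreg c p%:F.
Proof.
by exists p, 1; split; [move=> x _; rewrite hornerC oner_neq0|exact: poly_over1].
Qed.

Lemma rreg_neq0 c d : (forall x, c <= x -> d.[x%:C] != 0) -> d != 0.
Proof. by move=> /(_ c (lexx c)); exact: horner_neq0. Qed.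

Lemma rregV c d : (forall x, c <= x -> d.[x%:C] != 0) -> rreg c (d%:F^-1).
Proof. by move=> dc; exists 1, d; rewrite tofrac1 mul1r. Qed.

Lemma rreg_reval_add c f g : rreg c f -> rreg c g ->
  rreg c (f + g) /\ forall x, c <= x -> reval (f + g) x = reval f x + reval g x.
Proof.
move=> [n [d [dc ->]]] [n' [d' [dc' ->]]].
rewrite addf_div ?tofrac_neq0 ?(rreg_neq0 dc) ?(rreg_neq0 dc') //.
rewrite -!tofracM -tofracD.
have dd x : c <= x -> (d * d').[x%:C] != 0.
  by move=> cx; rewrite hornerM mulf_neq0 ?dc ?dc'.
split=> [|x cx]; first by exists (n * d' + n' * d), (d * d').
rewrite !revalE ?dd ?dc ?dc' // addf_div ?dc ?dc' //.
by rewrite hornerD !hornerM.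
Qed.

Lemma rreg_reval_mul c f g : rreg c f -> rreg c g ->
  rreg c (f * g) /\ forall x, c <= x -> reval (f * g) x = reval f x * reval g x.
Proof.
move=> [n [d [dc ->]]] [n' [d' [dc' ->]]].
rewrite mulf_div -!tofracM.
have dd x : c <= x -> (d * d').[x%:C] != 0.
  by move=> cx; rewrite hornerM mulf_neq0 ?dc ?dc'.
split=> [|x cx]; first by exists (n * n'), (d * d').
by rewrite !revalE ?dd ?dc ?dc' // mulf_div !hornerM.
Qed.

Lemma rregD c f g : rreg c f -> rreg c g -> rreg c (f + g).
Proof. by move=> rf rg; case: (rreg_reval_add rf rg). Qed.

Lemma rregM c f g : rreg c f -> rreg c g -> rreg c (f * g).
Proof. by move=> rf rg; case: (rreg_reval_mul rf rg). Qed.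

Lemma revalD c f g x : rreg c f -> rreg c g -> c <= x ->
  reval (f + g) x = reval f x + reval g x.
Proof. by move=> rf rg; case: (rreg_reval_add rf rg) => _; apply. Qed.

Lemma revalM c f g x : rreg c f -> rreg c g -> c <= x ->
  reval (f * g) x = reval f x * reval g x.
Proof. by move=> rf rg; case: (rreg_reval_mul rf rg) => _; apply. Qed.

Lemma rreg0 c : rreg c 0.
Proof. by rewrite -tofrac0; exact: rreg_poly. Qed.

Lemma reval0 x : reval 0 x = 0.
Proof. by rewrite -tofrac0 reval_poly horner0. Qed.

Lemma rreg_cst c a : rreg c (cst a).
Proof. exact: rreg_poly. Qed.

Lemma reval_cst a x : reval (cst a) x = a.
Proof. by rewrite reval_poly hornerC. Qed.

Lemma rregN c f : rreg c f -> rreg c (- f).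
Proof.
have -> : - f = cst (-1) * f by rewrite /cst polyCN tofracN tofrac1 mulN1r.
by apply: rregM; exact: rreg_cst.
Qed.

Lemma rreg_sum c (I : Type) (r : seq I) (P : pred I) (F : I -> ratfun R) :
  (forall i, rreg c (F i)) -> rreg c (\sum_(i <- r | P i) F i).
Proof.
by move=> rF; apply: big_ind => // [|f g]; [exact: rreg0|exact: rregD].
Qed.

Lemma rreg_sign c k f : rreg c f -> rreg c ((-1) ^+ k * f).
Proof.
rewrite -signr_odd; case: odd; rewrite ?expr0 ?mul1r ?expr1 ?mulN1r //.
exact: rregN.
Qed.

Lemma horner_map_conj p x : (map_poly (@conjc R) p).[x%:C] = conjc p.[x%:C].
Proof. by rewrite -[in LHS](conjc_real x) horner_map. Qed.

Lemma rreg_rconj c f : rreg c f -> rreg c (rconj f).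
Proof.
move=> [n [d [dc ->]]]; rewrite rconjE ?(rreg_neq0 dc) //.
exists (map_poly (@conjc R) n), (map_poly (@conjc R) d); split=> // x cx.
by rewrite horner_map_conj conjc_eq0 dc.
Qed.

Lemma reval_rconj c f x : rreg c f -> c <= x -> reval (rconj f) x = conjc (reval f x).
Proof.
move=> [n [d [dc ->]]] cx; rewrite rconjE ?(rreg_neq0 dc) //.
rewrite !revalE ?dc // !horner_map_conj ?conjc_eq0 ?dc // rmorphM /=; congr (_ * _).
by apply/esym; exact: fmorphV.
Qed.

Lemma rreg_rderiv c f : rreg c f -> rreg c (rderiv f).
Proof.
move=> [n [d [dc ->]]]; rewrite rderivE ?(rreg_neq0 dc) //.
exists (n^`() * d - n * d^`()), (d ^+ 2); split=> // x cx.
by rewrite horner_exp expf_neq0 ?dc.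
Qed.

(** The derivative is two-sided even at x = c, while regularity says nothing to the left of c.
    Continuity of the denominator supplies a neighbourhood on which [reval] is the quotient; the
    real or the imaginary part stays nonzero there. *)
Lemma is_cder_reval c f x : rreg c f -> c <= x ->
  is_cder (reval f) x (reval (rderiv f) x).
Proof.
move=> [n [d [dc ->]]] cx; have dx := dc x cx.
rewrite rderivE ?(rreg_neq0 dc) // revalE ?horner_exp ?expf_neq0 //.
have dE := is_cder_horner d x.
apply: (@is_cder_near _ (fun y => n.[y%:C] / d.[y%:C])); last first.
  have := is_cderM (is_cder_horner n x) (is_cderV dx dE).
  set v := (X in is_cder _ _ X) => H; set w := (X in is_cder _ _ X).
  suff -> : w = v by exact: H.
  rewrite /w /v hornerD hornerN !hornerM.
  by move: (n.[_]) (n^`().[_]) (d^`().[_]) (d.[_]) dx => a a' b' b b0; field.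
have [cRe cIm] := is_cder_ccont dE.
have H (h : R -> R) : {for x, continuous h} -> h x != 0 -> \forall y \near x, h y != 0.
  by move=> ch hx; exact: (cvgr_neq0 (h x) ch hx).
have [Re0|Re0] := eqVneq (Re d.[x%:C]) 0.
  have Im0 : Im d.[x%:C] != 0.
    by apply: contraNneq dx => Im0; apply/eqP/cpart_eq; rewrite ?Re0 ?Im0.
  apply: filterS (H _ cIm Im0) => y dy; rewrite revalE //.
  by apply: contraNneq dy => ->.
apply: filterS (H _ cRe Re0) => y dy; rewrite revalE //.
by apply: contraNneq dy => ->.
Qed.

Lemma tame_horner c s p : 0 < s -> tame c s (fun x => p.[x%:C]).
Proof.
elim/poly_ind: p s => [|p a IH] s s0.
  rewrite (_ : (fun x => _) = fun=> 0); first exact: tame0.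
  by apply/funext => x; rewrite horner0.
rewrite (_ : (fun x => _) = fun x => p.[x%:C] * x%:C + a); last first.
  by apply/funext => x; rewrite !hornerE.
have s20 : 0 < s / 2 by rewrite divr_gt0.
apply: tameD; last exact: tame_weaken (ltW s0) (tame_cst c a).
by rewrite [s]splitr; apply: tameM; [exact: IH|exact: tame_id].
Qed.

Lemma cnorm1_inv_le (z : R[i]) e : 0 < e -> e <= `|Re z| \/ e <= `|Im z| ->
  cnorm1 z^-1 <= 2 / e.
Proof.
case: z => a b e0 /= H.
have ab : 0 < a ^+ 2 + b ^+ 2.
  rewrite -(real_normK (num_real a)) -(real_normK (num_real b)).
  by case: H => H; have := normr_ge0 a; have := normr_ge0 b; nra.
have -> : cnorm1 (a +i* b)^-1 = (`|a| + `|b|) / (a ^+ 2 + b ^+ 2).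
  rewrite /cnorm1 /= normrN !normrM.
  have -> : `|(a ^+ 2 + b ^+ 2)^-1| = (a ^+ 2 + b ^+ 2)^-1 by rewrite ger0_norm // invr_ge0 ltW.
  by rewrite mulrDl.
rewrite ler_pdivrMr // mulrAC ler_pdivlMr //.
rewrite -(real_normK (num_real a)) -(real_normK (num_real b)).
move: (normr_ge0 a) (normr_ge0 b) H; set u := `|a|; set v := `|b| => u0 v0 H.
have [uv|vu] := leP u v.
  have ev : e <= v by case: H => // eu; exact: le_trans uv.
  by nra.
have eu : e <= u by case: H => // ev; exact: le_trans ev (ltW vu).
by nra.
Qed.

(** The point z stays at positive distance from the half-line: by its imaginary part, or, when z is
    real, because it lies to the left of c. *)
Lemma tame_inv_linear c (z : R[i]) : (forall x, c <= x -> x%:C != z) ->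
  tame c 0 (fun x => (x%:C - z)^-1).
Proof.
move=> zc; have nz x : c <= x -> x%:C - z != 0 by move=> cx; rewrite subr_eq0 zc.
split=> [x cx|].
  have dz : is_cder (fun y => y%:C - z) x 1.
    by have := is_cderD (is_cder_id x) (is_cder_cst (- z) x); rewrite addr0.
  exact: is_cder_ccont (is_cderV (nz x cx) dz).
have [e e0 He] : exists2 e, 0 < e &
    forall x, c <= x -> e <= `|Re (x%:C - z)| \/ e <= `|Im (x%:C - z)|.
  have [Im0|Im0] := eqVneq (Im z) 0.
    have zc' : Re z < c.
      rewrite ltNge; apply/negP => cz; have := zc _ cz.
      by case: z Im0 {zc nz cz} => a b /= ->; rewrite eqxx.
    exists (c - Re z); first by rewrite subr_gt0.
    move=> x cx; left; rewrite !cpartE /= ger0_norm ?lerD2r //.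
    by rewrite subr_ge0 (le_trans (ltW zc')).
  exists `|Im z|; first by rewrite normr_gt0.
  by move=> x cx; right; rewrite !cpartE /= add0r normrN.
by exists (2 / e) => x cx; rewrite mul0r expR0 mulr1 cnorm1_inv_le //; exact: He.
Qed.

(** Over the algebraically closed field [R[i]] the polynomial splits, and each inverse linear factor
    is bounded on the half-line. *)
Lemma tame_inv_horner c d : (forall x, c <= x -> d.[x%:C] != 0) ->
  tame c 0 (fun x => (d.[x%:C])^-1).
Proof.
move=> dc; have [rs dE] := closed_field_poly_normal d.
have d0 := rreg_neq0 dc.
have rsc z : z \in rs -> forall x, c <= x -> x%:C != z.
  move=> zrs x cx; apply: contraNneq (dc x cx) => ->.
  by rewrite -rootE dE rootZ ?lead_coef_eq0 // root_prod_XsubC.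
rewrite (_ : (fun x => _) = fun x => (lead_coef d)^-1 * \prod_(z <- rs) (x%:C - z)^-1).
  apply: tameZ; elim: rs rsc {dE} => [|z rs IH] rsc.
    rewrite (_ : (fun x => _) = fun=> 1); first exact: tame_cst.
    by apply/funext => x; rewrite big_nil.
  rewrite (_ : (fun x => _) = fun x => (x%:C - z)^-1 * \prod_(z <- rs) (x%:C - z)^-1).
    rewrite -[0]addr0; apply: tameM.
      by apply: tame_inv_linear; apply: rsc; rewrite mem_head.
    by apply: IH => w wrs; apply: rsc; rewrite inE wrs orbT.
  by apply/funext => x; rewrite big_cons.
apply/funext => x; rewrite {1}dE hornerZ invfM horner_prod -prodfV; congr (_ * _).
by apply: eq_bigr => z _; rewrite !hornerE.
Qed.

Lemma tame_reval c s f : 0 < s -> rreg c f -> tame c s (reval f).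
Proof.
move=> s0 rf; split=> [x cx|].
  exact: is_cder_ccont (is_cder_reval rf cx).
have [n [d [dc fE]]] := rf.
have [_ [C HC]] := tameM (tame_horner c n s0) (tame_inv_horner dc).
by exists C => x cx; have := HC x cx; rewrite addr0 fE revalE ?dc.
Qed.

End RationalValues.

(** * Values of differential operators and integration by parts *)

Section OperatorValues.
Variable R : realType.
Local Open Scope classical_set_scope.
Local Notation K := (ratfun R).
Local Notation delta := (@rderiv R).
Implicit Types (A B N M : {poly K}) (f : K) (x c s : R) (us ws : nat -> R -> R[i]).

Definition oreg c N : Prop := forall k, rreg c N`_k.

(** The sequence [us] stands for a function and its successive derivatives, a relation stated
    separately by [chain]. The explicit derivatives of exponentials and of Laplace transforms can so
    be inserted directly. *)
Definition rapply N us : R -> R[i] :=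
  fun x => \sum_(k < size N) reval N`_k x * us k x.

Definition chain c us : Prop :=
  forall k x, c <= x -> is_cder (us k) x (us k.+1 x).

Lemma rapplyE n N us x : (size N <= n)%N ->
  rapply N us x = \sum_(k < n) reval N`_k x * us k x.
Proof.
move=> Nn; apply: (sum_ord_widen (F := fun k => reval N`_k x * us k x) Nn) => k Nk.
by rewrite nth_default // reval0 mul0r.
Qed.

Lemma oregD c A B : oreg c A -> oreg c B -> oreg c (A + B).
Proof. by move=> rA rB k; rewrite coefD; exact: rregD. Qed.

Lemma oregZ c f A : rreg c f -> oreg c A -> oreg c (f *: A).
Proof. by move=> rf rA k; rewrite coefZ; exact: rregM. Qed.

Lemma oregC c f : rreg c f -> oreg c f%:P.
Proof. by move=> rf k; rewrite coefC; case: eqP => _ //; exact: rreg0. Qed.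

Lemma oreg_dl c N : oreg c N -> oreg c (dl delta N).
Proof.
move=> rN k; rewrite coefD coef_map coefMX /=.
apply: rregD; first exact: rreg_rderiv.
by case: eqP => _ //; exact: rreg0.
Qed.

Lemma oreg_iter_dl c k N : oreg c N -> oreg c (iter k (dl delta) N).
Proof. by move=> rN; elim: k => //= k; exact: oreg_dl. Qed.

Lemma oreg_sum c (I : Type) (r : seq I) (P : pred I) (F : I -> {poly K}) :
  (forall i, oreg c (F i)) -> oreg c (\sum_(i <- r | P i) F i).
Proof.
move=> rF; apply: big_ind => // [k|A B]; last exact: oregD.
by rewrite coef0; exact: rreg0.
Qed.

Lemma oreg_oadj c N : oreg c N -> oreg c (oadj delta N).
Proof.
move=> rN; apply: oreg_sum => k j; rewrite coefZ; apply: rreg_sign.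
by apply: oreg_iter_dl; exact: oregC.
Qed.

Lemma oreg_oconj c N : oreg c N -> oreg c (oconj N).
Proof. by move=> rN k; rewrite coef_oconj; exact: rreg_rconj. Qed.

Lemma rapplyD c A B us x : oreg c A -> oreg c B -> c <= x ->
  rapply (A + B) us x = rapply A us x + rapply B us x.
Proof.
move=> rA rB cx; pose n := maxn (size A) (size B).
rewrite (@rapplyE n (A + B)) ?(leq_trans (size_polyD _ _)) //.
rewrite (@rapplyE n A) ?leq_maxl // (@rapplyE n B) ?leq_maxr // -big_split.
by apply: eq_bigr => k _; rewrite coefD (revalD (rA k) (rB k) cx) mulrDl.
Qed.

Lemma rapply0 us x : rapply 0 us x = 0.
Proof. by rewrite /rapply size_poly0 big_ord0. Qed.

Lemma rapplyZ c f A us x : rreg c f -> oreg c A -> c <= x ->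
  rapply (f *: A) us x = reval f x * rapply A us x.
Proof.
move=> rf rA cx; rewrite (@rapplyE (size A)) ?size_scale_leq // mulr_sumr.
by apply: eq_bigr => k _; rewrite coefZ (revalM rf (rA k) cx) mulrA.
Qed.

Lemma rapplyC f us x : rapply f%:P us x = reval f x * us 0%N x.
Proof. by rewrite (@rapplyE 1) ?size_polyC_leq1 // big_ord1 coefC. Qed.

Lemma rapplyMX N us x : rapply (N * 'X) us x = rapply N (fun k => us k.+1) x.
Proof.
rewrite (@rapplyE (size N).+1); last first.
  by have [->|N0] := eqVneq N 0; rewrite ?mul0r ?size_poly0 // size_mulX.
rewrite big_ord_recl coefMX /= reval0 mul0r add0r; apply: eq_bigr => k _.
by rewrite coefMX.
Qed.

Lemma rapplyN c A us x : oreg c A -> c <= x -> rapply (- A) us x = - rapply A us x.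
Proof.
move=> rA cx; have -> : - A = cst (-1) *: A.
  by rewrite /cst polyCN tofracN tofrac1 scaleN1r.
by rewrite (rapplyZ _ (rreg_cst c _) rA cx) reval_cst mulN1r.
Qed.

Lemma rapply_sum c us x (I : Type) (r : seq I) (F : I -> {poly K}) :
  (forall i, oreg c (F i)) -> c <= x ->
  rapply (\sum_(i <- r) F i) us x = \sum_(i <- r) rapply (F i) us x.
Proof.
move=> rF cx; elim: r => [|i r IH]; first by rewrite !big_nil rapply0.
by rewrite !big_cons (rapplyD _ (rF i) _ cx) ?IH //; exact: oreg_sum.
Qed.

Lemma is_cder_rapply c N us x : oreg c N -> chain c us -> c <= x ->
  is_cder (rapply N us) x (rapply (dl delta N) us x).
Proof.
move=> rN cus cx.
have -> : rapply (dl delta N) us x =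
    \sum_(k < size N) (reval (delta N`_k) x * us k x + reval N`_k x * us k.+1 x).
  rewrite (@rapplyD c) ?rapplyMX //.
  - rewrite (@rapplyE (size N)) ?size_poly // big_split; congr (_ + _).
    by apply: eq_bigr => k _; rewrite coef_map.
  - by move=> k; rewrite coef_map; exact: rreg_rderiv.
  - by move=> k; rewrite coefMX; case: eqP => _ //; exact: rreg0.
by apply: is_cder_sum => k; apply: is_cderM; [exact: is_cder_reval (rN k) cx|exact: cus].
Qed.

Lemma chain_rapply c N us : oreg c N -> chain c us ->
  chain c (fun k => rapply (iter k (dl delta) N) us).
Proof. by move=> rN cus k x cx; exact: (is_cder_rapply (oreg_iter_dl k rN) cus cx). Qed.

Lemma rapply_comp c A B us x : oreg c A -> oreg c B -> c <= x ->
  rapply (ocomp delta A B) us x =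
  rapply A (fun k => rapply (iter k (dl delta) B) us) x.
Proof.
move=> rA rB cx; rewrite (rapply_sum _ _ _ cx) => [|k]; last first.
  by apply: oregZ => //; exact: oreg_iter_dl.
by apply: eq_bigr => k _; rewrite (rapplyZ _ (rA k) (oreg_iter_dl k rB) cx).
Qed.

Lemma tame_rapply c s s' N us : s < s' -> oreg c N -> (forall k, tame c s (us k)) ->
  tame c s' (rapply N us).
Proof.
move=> ss' rN tus; apply: tame_sum => k.
rewrite -[s'](subrK s); apply: tameM => //; apply: tame_reval => //.
by rewrite subr_gt0.
Qed.

Lemma oadjMX N : oadj delta (N * 'X) = - dl delta (oadj delta N).
Proof.
have := oadj_dl (@rderivM R) (oadj delta N).
rewrite (oadjK (@rderivM R)) => /(congr1 (oadj delta)).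
rewrite (oadjK (@rderivM R)) => ->; apply/eqP; rewrite -addr_eq0 -(oadjD (@rderivM R)).
by rewrite subrr oadj0.
Qed.

(** Repeated integration by parts. The point of the form is that b depends on N and [ws] only, not
    on [us]: for exponentials in z the boundary terms become e^{-cz} times one polynomial in z with
    fixed coefficients, and they disappear when the first n derivatives of [us] vanish at c. *)
Lemma rapply_transpose c s' n N ws : (size N <= n.+1)%N -> oreg c N ->
  chain c ws -> (forall k, tame c s' (ws k)) ->
  exists b : nat -> R[i], forall s us, s + s' < 0 -> chain c us ->
    (forall k, tame c s (us k)) ->
    cintegral `]c, +oo[ (fun x => rapply N us x * ws 0%N x) =
    cintegral `]c, +oo[ (fun x => us 0%N x * rapply (oadj delta N) ws x) -
    \sum_(i < n) us i c * b i.
Proof.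
move=> + + cws tws; elim: n N => [|n IH] N Nn rN.
  exists (fun=> 0) => s us ss' cus tus; rewrite big_ord0 subr0.
  rewrite (size1_polyC Nn) oadjC; apply: eq_cintegral => x _.
  by rewrite !rapplyC; ring.
elim/poly_ind: N Nn rN => [|N f _] Nn rN.
  exists (fun=> 0) => s us ss' cus tus; rewrite big1 ?subr0 => [|i _]; last by rewrite mulr0.
  by rewrite oadj0; apply: eq_cintegral => x _; rewrite !rapply0 mul0r mulr0.
have Nsize : (size N <= n.+1)%N.
  by move: Nn; rewrite size_MXaddC; case: ifP => // /andP[/eqP -> _]; rewrite size_poly0.
have rN' : oreg c N.
  by move=> k; have := rN k.+1; rewrite coefD coefMX coefC /= addr0.
have rf : rreg c f by have := rN 0%N; rewrite coefD coefMX coefC /= add0r.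
have [b Hb] := IH N Nsize rN'.
pose G := rapply (oadj delta N) ws.
(* With N d + f as the operator, moving the rightmost d off [us] leaves the boundary value of G
   against [us 0]; the terms of N concern the shifted sequence and move up by one index. *)
exists (fun i => if i is i'.+1 then b i' else G c) => s us ss' cus tus.
(* The rational coefficients cost an exponent e, chosen small enough for all products to remain
   integrable. *)
have [e e0 ess'] : exists2 e, 0 < e & e + (s + s') < 0.
  by exists (- (s + s') / 2); lra.
have cus' : chain c (fun k => us k.+1) by move=> k x; exact: cus.
have rA := oreg_oadj rN'.
have tint (u v : R -> R[i]) a b' : a + b' <= e + (s + s') -> tame c a u -> tame c b' v ->
    cintegrable `]c, +oo[ (fun x => u x * v x).
  move=> ab tu tv; apply: (tame_cintegrable ess').
  exact: tame_weaken ab (tameM tu tv).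
have ls a : a < a + e by rewrite ltrDl.
have i1 : cintegrable `]c, +oo[ (fun x => rapply N (fun k => us k.+1) x * ws 0%N x).
  apply: (tint _ _ (s + e) s') => //; last by exact: tame_rapply (ls s) rN' _.
  by rewrite -addrA addrCA addrA addrC [e + _]addrC addrA.
have i2 : cintegrable `]c, +oo[ (fun x => us 0%N x * (reval f x * ws 0%N x)).
  apply: (tint _ _ s (e + s')) => //; first by rewrite addrCA.
  by apply: tameM => //; exact: tame_reval.
have tG N' : oreg c N' -> tame c (s' + e) (rapply N' ws).
  by move=> rN''; exact: tame_rapply (ls s') rN'' _.
have mI := measurable_tail c.
have sse : s + (s' + e) = e + (s + s') by ring.
have i3 : cintegrable `]c, +oo[ (fun x => us 1%N x * G x).
  by apply: (tint _ _ s (s' + e)) => //; [rewrite sse|exact: tG].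
have i4 : cintegrable `]c, +oo[ (fun x => us 0%N x * rapply (dl delta (oadj delta N)) ws x).
  by apply: (tint _ _ s (s' + e)) => //; [rewrite sse|apply: tG; exact: oreg_dl].
have ibp : cintegral `]c, +oo[ (fun x => us 1%N x * G x) =
    - (us 0%N c * G c) -
    cintegral `]c, +oo[ (fun x => us 0%N x * rapply (dl delta (oadj delta N)) ws x).
  apply/eqP; rewrite eq_sym subr_eq -cintegralD // eq_sym; apply/eqP.
  apply: (@cintegral_tail _ _ (e + (s + s')) _ (fun x => us 0%N x * G x) ess').
  - by rewrite -sse; apply: tameD; apply: tameM => //; apply: tG => //; exact: oreg_dl.
  - by rewrite -sse; apply: tameM => //; exact: tG.
  - move=> x cx; apply: is_cderM; first exact: cus.
    exact: is_cder_rapply.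
have -> : cintegral `]c, +oo[ (fun x => rapply (N * 'X + f%:P) us x * ws 0%N x) =
    cintegral `]c, +oo[ (fun x => rapply N (fun k => us k.+1) x * ws 0%N x) +
    cintegral `]c, +oo[ (fun x => us 0%N x * (reval f x * ws 0%N x)).
  rewrite -cintegralD //; apply: eq_cintegral_tail => x /ltW cx.
  rewrite (@rapplyD c) ?rapplyMX ?rapplyC //; first by ring.
  - by move=> k; rewrite coefMX; case: eqP => _ //; exact: rreg0.
  - exact: oregC.
have -> : cintegral `]c, +oo[ (fun x => us 0%N x * rapply (oadj delta (N * 'X + f%:P)) ws x) =
    - cintegral `]c, +oo[ (fun x => us 0%N x * rapply (dl delta (oadj delta N)) ws x) +
    cintegral `]c, +oo[ (fun x => us 0%N x * (reval f x * ws 0%N x)).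
  rewrite -mulN1r -cintegralZ // -cintegralD //; last exact: cintegrableZ.
  apply: eq_cintegral_tail => x /ltW cx.
  rewrite (oadjD (@rderivM R)) oadjC oadjMX (@rapplyD c) // ?rapplyC.
  - by rewrite (@rapplyN c) //; [ring|exact: oreg_dl].
  - by move=> k; rewrite coefN; apply: rregN; apply: oreg_dl.
  - exact: oregC.
rewrite (Hb s _ ss' cus') // ibp big_ord_recl /= /bump /=.
by set S := \sum_(i < n) _; ring.
Qed.

End OperatorValues.

(** * Laplace transforms of compactly supported functions *)

Section CompactLaplace.
Variable R : realType.
Local Open Scope classical_set_scope.
Local Notation mu := (@lebesgue_measure R).
Local Notation Re := complex.Re.
Local Notation Im := complex.Im.
Implicit Types (v u f : R -> R[i]) (a b c s t x y : R).

Definition csupp a b v : Prop := forall x, ~~ (a <= x <= b) -> v x = 0.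

Definition cfun t a b v : Prop :=
  [/\ t < a, forall x, t <= x -> ccont v x & csupp a b v].

Lemma cfunM t a b u v : (forall x, t <= x -> ccont u x) -> cfun t a b v ->
  cfun t a b (fun x => u x * v x).
Proof.
move=> cu [ta cv sv]; split=> // [x tx|x abx]; first exact: ccontM (cu _ _) (cv _ _).
by rewrite sv ?mulr0.
Qed.

Lemma cfunX k t a b v : cfun t a b v -> cfun t a b (fun w => (- w%:C) ^+ k * v w).
Proof. by apply: cfunM => x _; exact: is_cder_ccont (is_cder_exprN k x). Qed.

Lemma cfun_bounded t a b v : cfun t a b v ->
  exists M, 0 <= M /\ forall x, cnorm1 (v x) <= M.
Proof.
move=> [ta cv sv]; have n0 : cnorm1 (0 : R[i]) = 0 by rewrite /cnorm1 /= normr0 addr0.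
have [ab|ba] := leP a b; last first.
  exists 0; split=> // x; rewrite sv ?n0 //.
  by apply/negP => /andP[ax xb]; have := le_lt_trans (le_trans ax xb) ba; rewrite ltxx.
have : {within `[a, b], continuous (fun x => cnorm1 (v x))}.
  apply: continuous_in_subspaceT => x; rewrite inE /= in_itv /= => /andP[ax xb].
  have [cR cI] := cv x (le_trans (ltW ta) ax).
  by apply: cvgD; apply: cvg_norm.
move=> /(EVT_max ab)[c cab cM]; exists (cnorm1 (v c)); split; first exact: cnorm1_ge0.
move=> x; have [xab|xab] := boolP (a <= x <= b); first by apply: cM; rewrite in_itv.
by rewrite sv // n0 cnorm1_ge0.
Qed.

(** A compact support allows every rate s, however negative, so these Laplace transforms exist and
    can be differentiated at every real point. *)
Lemma cfun_tame s t a b v : cfun t a b v -> tame t s v.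
Proof.
move=> cv; have [M [M0 HM]] := cfun_bounded cv; have [_ cc sv] := cv.
split=> //; exists (M * expR (`|s| * (`|a| + `|b|))) => x tx.
have [/andP[ax xb]|xab] := boolP (a <= x <= b); last first.
  by rewrite sv // /cnorm1 /= normr0 addr0 !mulr_ge0 ?expR_ge0.
rewrite (le_trans (HM x)) // -mulrA -[leLHS]mulr1 ler_wpM2l // -expRD -expR0 ler_expR.
have xn : `|x| <= `|a| + `|b|.
  rewrite ler_norml; apply/andP; split.
    rewrite (le_trans _ ax) // lerNl (le_trans _ (_ : `|a| <= _)) ?lerDl //.
    by rewrite -normrN ler_norm.
  by rewrite (le_trans xb) // (le_trans (ler_norm _)) // lerDr.
have : - (s * x) <= `|s| * (`|a| + `|b|).
  by rewrite (le_trans (ler_norm _)) // normrN normrM ler_wpM2l.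
by rewrite -subr_ge0 opprK.
Qed.

Lemma cfun_L2 t a b v : cfun t a b v -> L2 `]t, +oo[ v.
Proof.
by move=> cv; apply: (@tame_L2 _ t (-1)); [rewrite oppr_lt0|exact: cfun_tame cv].
Qed.

Lemma continuous_kernel y x : {for x, continuous (fun w : R => expR (- (w * y)))}.
Proof.
have -> : (fun w : R => expR (- (w * y))) = (fun w => expR (- y * w)).
  by apply/funext => w; rewrite mulNr mulrC.
exact: continuous_expRM.
Qed.

(** For w in [a, b] and y >= 0 one has e^{-wy} <= e^{-ay}. When s < 0, the range s <= y < 0 is
    bounded, and there the factor e^{|s||b|} dominates the kernel. *)
Lemma Rintegral_kernel_le (h : R -> R) s t a b C : 0 < a -> t < a ->
  (forall x, t <= x -> {for x, continuous h}) ->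
  (forall x, ~~ (a <= x <= b) -> h x = 0) ->
  (forall x, t <= x -> `|h x| <= C * expR (- x)) ->
  forall y, s <= y ->
  `|\int[mu]_(w in `]t, +oo[) (expR (- (w * y)) * h w)| <=
    expR (`|s| * `|b|) * (\int[mu]_(w in `]t, +oo[) `|h w|) * expR (- a * y).
Proof.
move=> a0 ta ch sh hC y sy.
have N10 : -1 < 0 :> R by rewrite oppr_lt0.
have ck : forall x, t <= x -> {for x, continuous (fun w : R => expR (- (w * y)) * h w)}.
  move=> x tx; apply: cvgM; last exact: ch.
  exact: continuous_kernel.
have kE w : `|expR (- (w * y)) * h w| <= (expR (`|s| * `|b|) * expR (- a * y)) * `|h w|.
  have [/andP[aw wb]|wab] := boolP (a <= w <= b); last by rewrite sh // mulr0 normr0 mulr0.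
  rewrite normrM ger0_norm ?expR_ge0 // ler_wpM2r // -expRD ler_expR.
  have w0 : 0 < w by exact: lt_le_trans aw.
  have bE : `|b| = b by rewrite ger0_norm // ltW // (lt_le_trans w0).
  have [y0|y0] := leP 0 y.
    apply: ler_wpDl; first by rewrite mulr_ge0.
    by rewrite mulNr lerN2 ler_wpM2r.
  apply: ler_wpDr; first by rewrite mulNr -mulrN mulr_ge0 ?(ltW a0) // oppr_ge0 ltW.
  rewrite -mulrN [leRHS]mulrC bE ler_pM ?(ltW w0) // ?oppr_ge0 ?(ltW y0) //.
  by rewrite (ltr0_norm (le_lt_trans sy y0)) lerN2.
have ih : mu.-integrable `]t, +oo[ (EFin \o (fun w => `|h w|)).
  apply: (@integrable_expR_bound _ _ C (-1)) => // [x tx|x tx].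
    by apply: cvg_norm; exact: ch.
  by rewrite normr_id mulN1r hC.
have ik : mu.-integrable `]t, +oo[ (EFin \o (fun w => expR (- (w * y)) * h w)).
  apply: (@integrable_expR_bound _ _ (expR (`|s| * `|b|) * expR (- a * y) * C) (-1)) => // x tx.
  rewrite (le_trans (kE x)) // -[leRHS]mulrA ler_wpM2l ?mulr_ge0 ?expR_ge0 //.
  by rewrite mulN1r hC.
have mI := measurable_tail t.
apply: le_trans (le_normr_Rintegral _ _) _ => //.
rewrite mulrAC -RintegralZl //; apply: le_Rintegral => //.
- by refine (integrable_norm ik).
- by refine (integrableZl _ _ ih); exact: mI.
Qed.

Lemma Lap_decay s t a b v : 0 < a -> cfun t a b v -> tame s (- a) (Lap t v).
Proof.
move=> a0 cv; have [ta cc sv] := cv; split=> [y sy|].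
  have yy : y - 1 < y by rewrite ltrBlDr ltrDl.
  exact: is_cder_ccont (is_cder_Lap yy (cfun_tame (y - 1) cv)).
have [C [C0 HC]] := tame_bound (cfun_tame (-1) cv).
pose I (h : R[i] -> R) := expR (`|s| * `|b|) * \int[mu]_(w in `]t, +oo[) `|h (v w)|.
exists (I (@complex.Re R) + I (@complex.Im R)) => y sy; rewrite [leRHS]mulrDl /cnorm1.
have RE : Re (Lap t v y) = \int[mu]_(w in `]t, +oo[) (expR (- (w * y)) * Re (v w)).
  by apply: eq_Rintegral => w _; rewrite !cpartE /= mul0r subr0.
have IE : Im (Lap t v y) = \int[mu]_(w in `]t, +oo[) (expR (- (w * y)) * Im (v w)).
  by apply: eq_Rintegral => w _; rewrite !cpartE /= mul0r addr0.
rewrite RE IE lerD //; apply: (Rintegral_kernel_le (C := C)) => // x tx.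
- by case: (cc x tx).
- by rewrite sv.
- by rewrite -mulN1r (le_trans _ (HC x tx)) //; case: (cnorm1_ReIm (v x)).
- by case: (cc x tx).
- by rewrite sv.
- by rewrite -mulN1r (le_trans _ (HC x tx)) //; case: (cnorm1_ReIm (v x)).
Qed.

(** The k-th derivative of the Laplace transform, as the transform of (-w)^k v. *)
Definition Lapk t v (k : nat) : R -> R[i] := Lap t (fun w => (- w%:C) ^+ k * v w).

Lemma eq_Lap t u v y : (forall w, t < w -> u w = v w) -> Lap t u y = Lap t v y.
Proof. by move=> uv; apply: eq_cintegral_tail => w /uv ->. Qed.

Lemma is_cder_Lapk s t v k y : s < y -> (forall j, tame t s (fun w => (- w%:C) ^+ j * v w)) ->
  is_cder (Lapk t v k) y (Lapk t v k.+1 y).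
Proof.
move=> sy tv; have := is_cder_Lap sy (tv k).
rewrite (_ : Lap t _ y = Lapk t v k.+1 y) //; apply: eq_Lap => w _.
by rewrite exprS mulrA.
Qed.

Lemma chain_Lapk s t a b v : cfun t a b v -> chain s (Lapk t v).
Proof.
move=> cv k y _; apply: (@is_cder_Lapk (y - 1)); first by rewrite ltrBlDr ltrDl.
by move=> j; apply: cfun_tame; exact: cfunX cv.
Qed.

Lemma tame_Lapk s t a b v k : 0 < a -> cfun t a b v -> tame s (- a) (Lapk t v k).
Proof. by move=> a0 cv; apply: Lap_decay a0 (cfunX k cv). Qed.

Lemma Lap_linear_sum t s y v (n : nat) (c : nat -> R[i]) : s < y ->
  (forall j, tame t s (fun w => (- w%:C) ^+ j * v w)) ->
  \sum_(k < n) c k * Lapk t v k y =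
  Lap t (fun w => (\sum_(k < n) c k * (- w%:C) ^+ k) * v w) y.
Proof.
move=> sy tv.
have mI := measurable_tail t.
pose F k w := c k * ((expR (- (w * y)))%:C * ((- w%:C) ^+ k * v w)).
have iF k : cintegrable `]t, +oo[ (F k).
  by apply: cintegrableZ => //; exact: Lap_integrable sy (tv k).
transitivity (\sum_(k < n) cintegral `]t, +oo[ (F k)).
  by apply: eq_bigr => k _; rewrite cintegralZ //; exact: Lap_integrable sy (tv k).
rewrite -(cintegral_sum n mI iF).2; apply: eq_cintegral => w _.
by rewrite mulr_suml mulr_sumr; apply: eq_bigr => k _; rewrite /F; ring.
Qed.

(** Integration by parts gives (y - s) L(f) as transform of f' - s f, without boundary term since t
    lies outside the support; the formula is its k-th derivative by Leibniz. At k = 0 the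
    meaningless index k - 1 carries the factor 0. *)
Lemma Lapk_step t a b f f' s k y : cfun t a b f -> cfun t a b f' ->
  (forall w, t <= w -> is_cder f w (f' w)) ->
  Lapk t (fun w => f' w - s%:C * f w) k y =
  (y%:C - s%:C) * Lapk t f k y + k%:R * Lapk t f k.-1 y.
Proof.
move=> cf cf' df; have [ta _ sf] := cf.
have N10 : -1 < 0 :> R by rewrite oppr_lt0.
have mI := measurable_tail t.
have T j v : cfun t a b v -> tame t (y - 1) (fun w => (- w%:C) ^+ j * v w).
  by move=> cv; apply: cfun_tame; exact: cfunX cv.
have yy : y - 1 < y by rewrite ltrBlDr ltrDl.
pose E w := (expR (- (w * y)))%:C : R[i].
have dE w : is_cder E w (- y%:C * E w).
  have := is_cder_real (is_derive_expRM (- y) w).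
  rewrite (_ : (fun y0 => (expR (- y * y0))%:C) = E); last first.
    by apply/funext => x; rewrite /E mulNr mulrC.
  suff -> : (- y * expR (- y * w))%:C = - y%:C * E w by [].
  have -> : - y * w = - (w * y) by ring.
  by rewrite /E; apply: cpart_eq; rewrite !cpartE /=; ring.
have i1 j v : cfun t a b v -> cintegrable `]t, +oo[ (fun w => E w * ((- w%:C) ^+ j * v w)).
  by move=> cv; exact: Lap_integrable yy (T j v cv).
pose G w := E w * ((- w%:C) ^+ k * f' w) + (- y%:C * (E w * ((- w%:C) ^+ k * f w))
     + - k%:R * (E w * ((- w%:C) ^+ k.-1 * f w))).
have tk j v : cfun t a b v -> tame t (-1) (fun w => E w * ((- w%:C) ^+ j * v w)).
  move=> cv; rewrite (_ : -1 = (y - 1) - y); last by ring.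
  exact: tame_kernel (T j v cv).
have : cintegral `]t, +oo[ G = - (E t * ((- t%:C) ^+ k * f t)).
  apply: (cintegral_tail (F := fun w => E w * ((- w%:C) ^+ k * f w)) N10) => [||w tw].
  - by apply: tameD; [exact: tk|apply: tameD; apply: tameZ; exact: tk].
  - exact: tk.
  - have := is_cderM (dE w) (is_cderM (is_cder_exprN k w) (df w tw)).
    set u := (X in is_cder _ _ X) => H; suff -> : G w = u by exact: H.
    by rewrite /G /u; ring.
rewrite (sf t) ?leNgt ?ta // !mulr0 oppr0.
rewrite /G cintegralD //; [|exact: i1|by apply: cintegrableD => //; apply: cintegrableZ => //; exact: i1].
rewrite cintegralD //; [|by apply: cintegrableZ => //; exact: i1..].
rewrite !cintegralZ //; [|exact: i1..].
rewrite -/(Lap t _ y) -/(Lapk t f' k y) -/(Lap t _ y) -/(Lapk t f k y).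
rewrite -[cintegral _ _]/(Lapk t f k.-1 y) => H.
have -> : Lapk t (fun w => f' w - s%:C * f w) k y = Lapk t f' k y + - s%:C * Lapk t f k y.
  rewrite /Lapk /Lap -cintegralZ //; last exact: i1.
  rewrite -cintegralD //; [|exact: i1|by apply: cintegrableZ => //; exact: i1].
  by apply: eq_cintegral => w _; ring.
apply/eqP; rewrite -subr_eq0 -H; apply/eqP; ring.
Qed.

End CompactLaplace.

(** * Transforms of test functions *)

Section ConstantOperators.
Variable R : realType.
Local Open Scope classical_set_scope.
Local Notation K := (ratfun R).
Local Notation delta := (@rderiv R).
Implicit Types (N : {poly K}) (p : {poly R[i]}) (x z s t a b : R).

(* N = p(-d) *)
Definition is_constop N p : Prop := forall k, N`_k = (-1) ^+ k * cst p`_k.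

Definition ewave z (k : nat) : R -> R[i] := fun x => (- z%:C) ^+ k * (expR (- (x * z)))%:C.

Lemma conj_ewave z k x : conjc (ewave z k x) = ewave z k x.
Proof. by rewrite /ewave -rmorphN -rmorphXn -rmorphM; exact: conjc_real. Qed.

Lemma chain_ewave s z : chain s (ewave z).
Proof.
move=> k x _; rewrite (_ : ewave z k.+1 x = (- z%:C) ^+ k * (- z * expR (- z * x))%:C).
  have := is_cderZ ((- z%:C) ^+ k) (is_cder_real (is_derive_expRM (- z) x)).
  rewrite (_ : (fun y => _ * (expR (- z * y))%:C) = ewave z k) //.
  by apply/funext => y; rewrite /ewave mulNr [y * z]mulrC.
have -> : - z * x = - (x * z) by ring.
rewrite /ewave exprSr -mulrA; congr (_ * _).
by apply: cpart_eq; rewrite !cpartE /=; ring.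
Qed.

Lemma tame_ewave s z k : tame s (- z) (ewave z k).
Proof.
apply: tameZ; rewrite (_ : (fun y => _) = fun y => (expR (- z * y))%:C).
  exact: tame_expR.
by apply/funext => y; rewrite mulNr mulrC.
Qed.

Lemma constop_sum N p (b : nat -> R[i]) x : is_constop N p ->
  \sum_(k < size N) reval N`_k x * b k = \sum_(k < size p) (-1) ^+ k * p`_k * b k.
Proof.
move=> Np; have vE k : reval N`_k x = (-1) ^+ k * p`_k.
  rewrite Np -[RHS](reval_cst _ x); congr (reval _ x).
  by rewrite cstM cst_sign.
pose n := maxn (size N) (size p).
rewrite (@sum_ord_widen _ (fun k => reval N`_k x * b k) _ n) ?leq_maxl //; last first.
  by move=> k Nk; rewrite nth_default // reval0 mul0r.
rewrite (@sum_ord_widen _ (fun k => (-1) ^+ k * p`_k * b k) (size p) n) ?leq_maxr //; last first.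
  by move=> k pk; rewrite nth_default // mulr0 mul0r.
by apply: eq_bigr => k _; rewrite vE.
Qed.

Lemma horner_sum_sign p (z : R[i]) :
  \sum_(k < size p) (-1) ^+ k * p`_k * (- z) ^+ k = p.[z].
Proof.
rewrite horner_coef; apply: eq_bigr => k _.
by rewrite mulrAC -exprMn mulN1r opprK mulrC.
Qed.

(** The exponential is an eigenfunction of -d_x with eigenvalue z, and N commutes with d_x because
    its coefficients are constants. *)
Lemma rapply_dl_constop N p k z x : is_constop N p ->
  rapply (iter k (dl delta) N) (ewave z) x = p.[z%:C] * ewave z k x.
Proof.
move=> Np; have -> : iter k (dl delta) N = N * 'X^k.
  elim: k => [|k IH] /=; first by rewrite mulr1.
  rewrite IH exprSr mulrA /dl; set M := map_poly _ _; suff -> : M = 0 by rewrite add0r.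
  apply/polyP => i; rewrite coef_map coefMXn coef0 /=; case: ifP => _; first exact: raddf0.
  by rewrite Np -cst_sign -cstM; exact: rderiv_cst.
have MXn (us : nat -> R -> R[i]) : rapply (N * 'X^k) us x = rapply N (fun j => us (j + k)%N) x.
  elim: k us => [|k IH] us.
    by rewrite mulr1; apply: eq_bigr => j _; rewrite addn0.
  by rewrite exprSr mulrA rapplyMX IH; apply: eq_bigr => j _; rewrite addnS.
rewrite MXn /rapply (constop_sum (fun j => ewave z (j + k)%N x) x Np) -horner_sum_sign.
by rewrite mulr_suml; apply: eq_bigr => j _; rewrite /ewave exprD !mulrA.
Qed.

(** On a Laplace transform in y, -d_y is multiplication by w under the integral. *)
Lemma rapply_constop_Lapk N p t a b h y : is_constop N p -> cfun t a b h ->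
  rapply N (Lapk t h) y = Lap t (fun w => p.[w%:C] * h w) y.
Proof.
move=> Np ch; rewrite /rapply (constop_sum (fun k => Lapk t h k y) y Np).
have yy : y - 1 < y by rewrite ltrBlDr ltrDl.
rewrite (@Lap_linear_sum _ _ (y - 1) _ _ _ (fun k => (-1) ^+ k * p`_k)) //.
  by apply: eq_Lap => w _; rewrite horner_sum_sign.
by move=> j; apply: cfun_tame; exact: cfunX ch.
Qed.

Lemma is_constop_oconj N p : is_constop N p -> is_constop (oconj N) (map_poly (@conjc R) p).
Proof. by move=> Np k; rewrite coef_oconj Np rconjM rconj_sign rconj_cst coef_map. Qed.

Lemma eq_cintegrable (D : set R) (f g : R -> R[i]) : measurable D -> (forall x, D x -> f x = g x) ->
  cintegrable D f -> cintegrable D g.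
Proof.
move=> mD fg [f1 f2]; split.
  by refine (eq_integrable _ _ _ _ f1); [exact: mD|move=> x /set_mem /fg ->].
by refine (eq_integrable _ _ _ _ f2); [exact: mD|move=> x /set_mem /fg ->].
Qed.

End ConstantOperators.

(** * The transform of test functions through either factorization *)

Section Transforms.
Variable R : realType.
Local Open Scope classical_set_scope.
Local Notation K := (ratfun R).
Local Notation delta := (@rderiv R).
Implicit Types (N : {poly K}) (p : {poly R[i]}) (x z : R) (f h : R -> R[i]).

Variables (psi : R -> R -> R[i]) (s t : R) (d : nat).

(** The counterpart for functions of the formal identity p psi = N e^{-xz}, with the coefficients of
    N free of poles on [s, oo). *)
Definition intertwines N p : Prop := oreg s N /\
  forall x z, s <= x -> t <= z -> p.[z%:C] * psi x z = rapply N (ewave z) x.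

(** The factor conj p in f completes conj psi to conj (p psi) = conj (N e^{-xw}), after which the
    conjugate of N can be taken out of the integral over w. *)
Lemma Eadj_rapply N p a b f h x : intertwines N p -> cfun t a b h ->
  (forall w, t < w -> f w = conjc p.[w%:C] * h w) -> s <= x ->
  Epsi_adj psi t f x = rapply (oconj N) (Lapk t h) x.
Proof.
move=> [rN Np] ch fh sx.
have -> : rapply (oconj N) (Lapk t h) x =
    \sum_(k < size N) conjc (reval N`_k x) * Lapk t h k x.
  rewrite /rapply size_oconj; apply: eq_bigr => k _.
  by rewrite coef_oconj (reval_rconj (rN k) sx).
have xx : x - 1 < x by rewrite ltrBlDr ltrDl.
rewrite (@Lap_linear_sum _ _ (x - 1) _ _ _ (fun k => conjc (reval N`_k x))) //; last first.
  by move=> j; apply: cfun_tame; exact: cfunX ch.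
apply: eq_cintegral_tail => w tw.
rewrite fh // mulrA [_ * conjc p.[_]]mulrC -rmorphM /= (Np _ _ sx (ltW tw)).
rewrite [in RHS]mulrA; congr (_ * _); rewrite /rapply.
have -> : conjc (\sum_(k < size N) reval N`_k x * ewave w k x) =
    \sum_(k < size N) conjc (reval N`_k x * ewave w k x) by rewrite rmorph_sum.
rewrite mulr_sumr; apply: eq_bigr => k _; rewrite rmorphM /=.
have -> : conjc (ewave w k x) = ewave w k x by exact: conj_ewave.
by rewrite /ewave [w * x]mulrC; ring.
Qed.

Hypothesis t0 : 0 <= t.
Variables (A0 A : {poly K}) (q r : {poly R[i]}).
Hypothesis A0q : intertwines A0 q.
Hypothesis Ar : intertwines A r.
Hypothesis sA : (size A <= d.+1)%N.
Hypothesis q0 : forall z, t <= z -> q.[z%:C] != 0.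
Hypothesis CA0 : is_constop (ocomp delta (oadj delta (oconj A)) A0) (q * qsharp r).

Lemma psi_integrable z g a : t < z -> 0 < a -> tame s (- a) g ->
  cintegrable `]s, +oo[ (fun y => psi y z * g y).
Proof.
move=> tz a0 tg; have [rA0 A0E] := A0q.
have z0 : 0 < z by exact: le_lt_trans tz.
(* Half of the decay of e^{-yz} is given up to absorb the rational coefficients of A0; this needs z
   > t >= 0. *)
have e0 : - z < - (z / 2) by lra.
have T : tame s (- (z / 2) - a) (fun y => q.[z%:C]^-1 * rapply A0 (ewave z) y * g y).
  apply: tameM => //; apply: tameZ; apply: (tame_rapply e0 rA0) => k.
  exact: tame_ewave.
have mI := measurable_tail s.
have e : - (z / 2) - a < 0 by lra.
apply: (eq_cintegrable mI _ (tame_cintegrable e T)).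
move=> y; rewrite /= in_itv /= andbT => /ltW sy.
by rewrite -A0E ?(ltW tz) // mulKf // q0 // ltW.
Qed.

Lemma horner_EEpsi_adj N p g a f z : intertwines N p -> t < z -> 0 < a ->
  tame s (- a) g -> (forall x, s <= x -> Epsi_adj psi t f x = g x) ->
  p.[z%:C] * EEpsi_adj psi s t f z =
  cintegral `]s, +oo[ (fun y => rapply N (ewave z) y * g y).
Proof.
move=> [_ Np] tz a0 tg gE.
have mI := measurable_tail s.
have -> : EEpsi_adj psi s t f z = cintegral `]s, +oo[ (fun y => psi y z * g y).
  by apply: eq_cintegral_tail => y /ltW sy; rewrite gE.
rewrite -cintegralZ //; last exact: psi_integrable tz a0 tg.
apply: eq_cintegral_tail => y /ltW sy.
by rewrite -Np ?(ltW tz) // mulrA.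
Qed.

Lemma cfun_conj_div a b f : cfun t a b f ->
  cfun t a b (fun w => conjc q.[w%:C]^-1 * f w).
Proof.
apply: cfunM => w tw; apply: is_cder_ccont; apply: is_cderJ.
exact: is_cderV (q0 tw) (is_cder_horner q w).
Qed.

Lemma Epsi_adj_rapply a b f x : cfun t a b f -> s <= x ->
  Epsi_adj psi t f x =
  rapply (oconj A0) (Lapk t (fun w => conjc q.[w%:C]^-1 * f w)) x.
Proof.
move=> cf sx; apply: (Eadj_rapply A0q (cfun_conj_div cf)) => // w tw.
by rewrite mulrA -rmorphM /= mulfV ?q0 ?(ltW tw) // rmorph1 mul1r.
Qed.

(** With h = f / conj q, the adjoint transform of f is conj(A0) L(h). Moving A off e^{-yz} produces
    the composite of its adjoint with conj(A0), the conjugate of C A0: it multiplies h by conj(q(w))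
    r(-w), so that q cancels and r(-w) f remains. *)
Lemma transform_boundary a b f : cfun t a b f -> exists B : nat -> R[i],
  forall z, t < z -> r.[z%:C] * EEpsi_adj psi s t f z =
    Lap s (Lap t (fun w => r.[- w%:C] * f w)) z -
    \sum_(i < d) ewave z i s * B i.
Proof.
move=> cf; have [ta _ _] := cf; have a0 : 0 < a by exact: le_lt_trans ta.
have [rA0 _] := A0q; have [rA AE] := Ar.
have rcA0 := oreg_oconj rA0.
pose h w := conjc q.[w%:C]^-1 * f w.
have ch : cfun t a b h by exact: cfun_conj_div.
pose ws k := rapply (iter k (dl delta) (oconj A0)) (Lapk t h).
have cws : chain s ws by apply: chain_rapply => //; exact: chain_Lapk ch.
have e0 : - a < - (a / 2) by lra.
have tws k : tame s (- (a / 2)) (ws k).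
  by apply: (tame_rapply e0 (oreg_iter_dl k rcA0)) => j; exact: tame_Lapk ch.
have [B HB] := rapply_transpose sA rA cws tws; exists B => z tz.
have z0 : 0 < z by exact: le_lt_trans tz.
have zs : - z + - (a / 2) < 0 by lra.
have a20 : 0 < a / 2 by rewrite divr_gt0.
rewrite (@horner_EEpsi_adj A r (ws 0%N) (a / 2)) // => [|x]; last first.
  exact: Epsi_adj_rapply cf.
rewrite (HB _ _ zs (@chain_ewave R s z)); last by move=> k; exact: tame_ewave.
congr (_ - _); apply: eq_cintegral_tail => y /ltW sy.
rewrite {1}/ewave expr0 mul1r; congr (_ * _).
rewrite -(rapply_comp _ (oreg_oadj rA) rcA0 sy).
have cC : is_constop (ocomp delta (oadj delta A) (oconj A0))
    (map_poly (@conjc R) (q * qsharp r)).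
  have := is_constop_oconj CA0.
  by rewrite oconj_comp oconj_oadj oconjK.
rewrite (rapply_constop_Lapk _ cC ch); apply: eq_Lap => w tw.
rewrite horner_map_conj hornerM horner_qsharp conjc_real rmorphM /= conjcK /h.
have qq : conjc q.[w%:C] * conjc q.[w%:C]^-1 = 1.
  by rewrite -rmorphM /= mulfV ?q0 ?(ltW tw) // rmorph1.
rewrite -[RHS]mul1r -qq; ring.
Qed.

(** Here conj r is already a factor of f, so the adjoint transform is conj(A) L(h), and multiplying
    by q turns psi into A0 e^{-yz}. Moving conj(A) onto A0 e^{-yz} yields C A0 e^{-yz} = q r#
    e^{-yz}; the boundary terms are killed by the zeros of L(h) at s, and q cancels. *)
Lemma transform_reflected a b h f z : cfun t a b h ->
  (forall w, t < w -> f w = conjc r.[w%:C] * h w) ->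
  (forall i, (i < d)%N -> Lapk t h i s = 0) -> t < z ->
  EEpsi_adj psi s t f z = (qsharp r).[z%:C] * Lap s (Lap t h) z.
Proof.
move=> ch fh vanish tz; have [ta _ _] := ch; have a0 : 0 < a by exact: le_lt_trans ta.
have [rA0 A0E] := A0q; have [rA AE] := Ar.
have z0 : 0 < z by exact: le_lt_trans tz.
have rcA := oreg_oconj rA.
pose ws k := rapply (iter k (dl delta) A0) (ewave z).
have cws : chain s ws by apply: chain_rapply => //; exact: chain_ewave.
have e0 : - z < - (z / 2) by lra.
have tws k : tame s (- (z / 2)) (ws k).
  by apply: (tame_rapply e0 (oreg_iter_dl k rA0)) => j; exact: tame_ewave.
have scA : (size (oconj A) <= d.+1)%N by rewrite size_oconj.
have [B HB] := rapply_transpose scA rcA cws tws.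
have az : - a + - (z / 2) < 0 by lra.
have := HB _ _ az (@chain_Lapk _ s _ _ _ _ ch) (fun k => @tame_Lapk _ s _ _ _ _ k a0 ch).
rewrite [X in _ - X]big1 ?subr0 => [H|i _]; last by rewrite vanish ?mul0r.
have qz : q.[z%:C] != 0 by rewrite q0 // ltW.
have mI := measurable_tail s.
have ea : - a < - (a / 2) by lra.
have tg : tame s (- (a / 2)) (rapply (oconj A) (Lapk t h)).
  by apply: (tame_rapply ea rcA) => k; exact: tame_Lapk ch.
have a20 : 0 < a / 2 by rewrite divr_gt0.
apply: (mulfI qz).
rewrite (horner_EEpsi_adj A0q tz a20 tg) => [|x]; last exact: (Eadj_rapply Ar ch).
have -> : cintegral `]s, +oo[ (fun y => rapply A0 (ewave z) y * rapply (oconj A) (Lapk t h) y) =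
    cintegral `]s, +oo[ (fun x => rapply (oconj A) (Lapk t h) x * ws 0%N x).
  by apply: eq_cintegral => y _; rewrite mulrC.
rewrite H mulrA -hornerM -cintegralZ //; last first.
  have tL : tame s (- a) (Lap t h) by exact: Lap_decay ch.
  by apply: Lap_integrable tL; lra.
apply: eq_cintegral_tail => y /ltW sy.
rewrite -(rapply_comp _ (oreg_oadj rcA) rA0 sy) (rapply_dl_constop 0 _ _ CA0).
rewrite /ewave expr0 mul1r -[Lapk t h 0%N y]/(Lap t (fun w => 1 * h w) y).
rewrite (@eq_Lap _ t (fun w => 1 * h w) h); last by move=> w _; rewrite mul1r.
by ring.
Qed.

End Transforms.

(** * Finite smoothness and the action of polynomial operators in z *)

Section SmoothFunctions.
Variable R : realType.
Local Open Scope classical_set_scope.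
Implicit Types (f g u : R -> R[i]) (x w : R) (D : set R) (n k : nat) (N : diffop R).

Definition csmooth D n f : Prop := forall x, D x -> cderivable_n n f x.

Lemma is_cder_open D f g x v : open D -> D x -> (forall y, D y -> f y = g y) ->
  is_cder f x v -> is_cder g x v.
Proof.
move=> oD Dx fg; apply: is_cder_near.
by apply: filterS (open_nbhs_nbhs (conj oD Dx)) => y /fg.
Qed.

Lemma csmoothS D n f : csmooth D n.+1 f <->
  (forall x, D x -> cderivable f x) /\ csmooth D n (cderiv f).
Proof.
split=> [sf|[f1 sf] x Dx [|k] kn]; last 2 first.
- exact: f1.
- by rewrite iterSr; exact: sf.
split=> [x Dx|x Dx k kn]; first by have := sf x Dx 0%N; exact.
by have := sf x Dx k.+1 kn; rewrite iterSr.
Qed.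

Lemma csmooth_leq D n m f : (m <= n)%N -> csmooth D n f -> csmooth D m f.
Proof. by move=> mn sf x Dx k km; apply: sf => //; exact: leq_trans mn. Qed.

Lemma csmooth_ext D n f g : open D -> (forall x, D x -> f x = g x) ->
  csmooth D n f -> csmooth D n g.
Proof.
move=> oD; elim: n f g => [|n IH] f g fg; first by move=> _ x Dx.
move=> /csmoothS [f1 sf]; apply/csmoothS.
have gE x : D x -> is_cder g x (cderiv f x).
  by move=> Dx; apply: (is_cder_open oD Dx fg); exact: cderivable_is_cder (f1 x Dx).
split=> [x Dx|]; first exact: is_cder_cderivable (gE x Dx).
by apply: IH sf => x Dx; rewrite (is_cder_cderiv (gE x Dx)).
Qed.

Lemma csmooth_der D n f f' : open D -> (forall x, D x -> is_cder f x (f' x)) ->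
  csmooth D n f' -> csmooth D n.+1 f.
Proof.
move=> oD ff' sf'; apply/csmoothS; split=> [x Dx|]; first exact: is_cder_cderivable (ff' x Dx).
by apply: csmooth_ext sf' => // x Dx; rewrite (is_cder_cderiv (ff' x Dx)).
Qed.

Lemma csmooth_cder D n f x : csmooth D n.+1 f -> D x -> is_cder f x (cderiv f x).
Proof. by move=> /csmoothS [f1 _] Dx; exact: cderivable_is_cder (f1 x Dx). Qed.

Lemma csmoothD D n f g : open D -> csmooth D n f -> csmooth D n g ->
  csmooth D n (fun x => f x + g x).
Proof.
move=> oD; elim: n f g => [|n IH] f g sf sg; first by move=> x Dx.
apply: (csmooth_der (f' := fun x => cderiv f x + cderiv g x) oD) => [x Dx|].
  exact: is_cderD (csmooth_cder sf Dx) (csmooth_cder sg Dx).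
by apply: IH; [case/csmoothS: sf|case/csmoothS: sg].
Qed.

Lemma csmoothM D n f g : open D -> csmooth D n f -> csmooth D n g ->
  csmooth D n (fun x => f x * g x).
Proof.
move=> oD; elim: n f g => [|n IH] f g sf sg; first by move=> x Dx.
apply: (csmooth_der (f' := fun x => cderiv f x * g x + f x * cderiv g x) oD) => [x Dx|].
  exact: is_cderM (csmooth_cder sf Dx) (csmooth_cder sg Dx).
apply: csmoothD => //; apply: IH.
- by case/csmoothS: sf.
- exact: csmooth_leq sg.
- exact: csmooth_leq sf.
- by case/csmoothS: sg.
Qed.

Lemma csmooth_chain D n (us : nat -> R -> R[i]) : open D ->
  (forall k x, D x -> is_cder (us k) x (us k.+1 x)) -> csmooth D n (us 0%N).
Proof.
move=> oD; elim: n us => [|n IH] us cus; first by move=> x Dx.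
apply: (csmooth_der (f' := us 1%N) oD) => [x Dx|]; first exact: cus.
by apply: (IH (fun k => us k.+1)) => k; exact: cus.
Qed.

Lemma csmooth_cst D n (c : R[i]) : open D -> csmooth D n (fun=> c).
Proof.
move=> oD; apply: (csmooth_chain (us := fun k => if k is 0%N then fun=> c else fun=> 0) oD).
by move=> [|k] x _; exact: is_cder_cst.
Qed.

Lemma csmooth_sum D n (I : Type) (r : seq I) (F : I -> R -> R[i]) : open D ->
  (forall i, csmooth D n (F i)) -> csmooth D n (fun x => \sum_(i <- r) F i x).
Proof.
move=> oD sF; elim: r => [|i r IH].
  have -> : (fun x => \sum_(i <- [::]) F i x) = fun=> 0.
    by apply/funext => x; rewrite big_nil.
  exact: csmooth_cst.
have -> : (fun x => \sum_(j <- i :: r) F j x) = fun x => F i x + \sum_(j <- r) F j x.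
  by apply/funext => x; rewrite big_cons.
exact: csmoothD.
Qed.

Lemma csmooth_horner D n (p : {poly R[i]}) : open D -> csmooth D n (fun x => p.[x%:C]).
Proof.
move=> oD; apply: (csmooth_chain (us := fun k x => (p^`(k)).[x%:C]) oD).
by move=> k x _; rewrite derivnS; exact: is_cder_horner.
Qed.

Lemma csmooth_comp_horner D n e (p : {poly R[i]}) : open D ->
  csmooth D n (fun x => p.[e * x%:C]).
Proof.
move=> oD; have := @csmooth_horner D n (p \Po (e *: 'X)) oD.
by apply: csmooth_ext => // x _; rewrite horner_comp hornerZ hornerX.
Qed.

(* [gfun 1] is the action of N(z, d_z) and [gfun (-1)] that of N(-z, -d_z) *)
Definition gfun (e : R[i]) (N : diffop R) f : R -> R[i] := fun w =>
  \sum_(k < size N) e ^+ k * (N`_k).[e * w%:C] * iter k (@cderiv R) f w.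

Lemma gfunE n e (N : diffop R) f w : (size N <= n)%N ->
  gfun e N f w = \sum_(k < n) e ^+ k * (N`_k).[e * w%:C] * iter k (@cderiv R) f w.
Proof.
move=> Nn; apply: (sum_ord_widen
  (F := fun k => e ^+ k * (N`_k).[e * w%:C] * iter k (@cderiv R) f w) Nn) => k Nk.
by rewrite nth_default // horner0 mulr0 mul0r.
Qed.

(** The substitution of e z and e d_z, with e a sign, makes [dl] correspond to e d_z; a plain
    derivative brings out one more factor e, as e^2 = 1. *)
Lemma is_cder_gfun e (N : diffop R) f w : e * e = 1 -> cderivable_n (size N) f w ->
  is_cder (gfun e N f) w (e * gfun e (dl (@deriv R[i]) N) f w).
Proof.
move=> ee df; have dp (p : {poly R[i]}) : is_cder (fun w => p.[e * w%:C]) w (e * p^`().[e * w%:C]).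
  have := is_cder_horner (p \Po (e *: 'X)) w.
  rewrite deriv_comp hornerM horner_comp derivZ derivX hornerZ hornerC mulr1 hornerZ hornerX mulrC.
  have -> // : (fun y : R => (p \Po (e *: 'X)).[y%:C]) = fun w : R => p.[e * w%:C].
  by apply/funext => y; rewrite horner_comp hornerZ hornerX.
have -> : e * gfun e (dl (@deriv R[i]) N) f w = \sum_(k < size N)
   (e ^+ k * (e * (N`_k)^`().[e * w%:C]) * iter k (@cderiv R) f w +
    e ^+ k * (N`_k).[e * w%:C] * iter k.+1 (@cderiv R) f w).
  rewrite (@gfunE (size N).+1); last first.
    rewrite (leq_trans (size_polyD _ _)) // geq_max (leq_trans (size_poly _ _)) //=.
    by rewrite (leq_trans (size_polyMleq _ _)) // size_polyX addn2.
  rewrite mulr_sumr; under eq_bigr do rewrite coefD coef_map coefMX /= hornerD mulrDr mulrDl mulrDr.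
  rewrite big_split /= [X in X + _ = _]big_ord_recr [X in _ + X = _]big_ord_recl /=.
  rewrite nth_default // deriv0 horner0 !(mulr0, mul0r) addr0 add0r -big_split.
  apply: eq_bigr => k _ /=; congr (_ + _); first by ring.
  rewrite /bump /= add1n exprS; rewrite [RHS](_ : _ = (e * e) * (e ^+ k * (N`_k).[e * w%:C] * cderiv (iter k (@cderiv R) f) w)).
    by ring.
  by rewrite ee mul1r.
apply: is_cder_sum => k; apply: is_cderM; last exact: cderivable_is_cder (df k (ltn_ord k)).
exact: is_cderZ (dp _).
Qed.

Lemma gfun_zstep e (s : R[i]) (N : diffop R) f w v : e * e = 1 -> cderivable_n (size N) f w ->
  is_cder (gfun e N f) w v ->
  gfun e (zstep s N) f w = - e * v - s * gfun e N f w.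
Proof.
move=> ee df dv.
have vE : v = e * gfun e (dl (@deriv R[i]) N) f w.
  by rewrite -(is_cder_cderiv dv) (is_cder_cderiv (is_cder_gfun ee df)).
rewrite vE mulNr mulrA ee mul1r.
pose M := dl (@deriv R[i]) N; pose n := maxn (size M) (size N).
have Mn : (size M <= n)%N by rewrite leq_maxl.
have Nn : (size N <= n)%N by rewrite leq_maxr.
have zn : (size (zstep s N) <= n)%N.
  rewrite size_polyN (leq_trans (size_polyD _ _)) // geq_max Mn /=.
  by rewrite (leq_trans (size_scale_leq _ _)).
rewrite (gfunE _ _ _ zn) (gfunE _ _ _ Mn) (gfunE _ _ _ Nn) mulr_sumr -sumrN -sumrB.
apply: eq_bigr => k _; rewrite coefN coefD coefZ -/M !(hornerN, hornerD, hornerM, hornerC); ring.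
Qed.

Lemma size_iter_zstep (s : R[i]) (r : {poly R[i]}) j :
  (size (iter j (zstep s) r%:P) <= j.+1)%N.
Proof.
elim: j => [|j IH]; first exact: size_polyC_leq1.
rewrite iterS size_polyN (leq_trans (size_polyD _ _)) // geq_max.
rewrite (leq_trans (size_scale_leq _ _) (leqW IH)) andbT.
rewrite (leq_trans (size_polyD _ _)) // geq_max (leq_trans (size_poly _ _) (leqW IH)) /=.
by rewrite (leq_trans (size_polyMleq _ _)) // size_polyX addn2.
Qed.

(** Identifies the action of (-d_z - s)^j r, or of its reflection, with any sequence that satisfies
    the same recursion. It serves twice: for the reflected operator on a test function, and for the
    operator itself on the transform. *)
Lemma gfun_iter_zstep e (s : R[i]) (r : {poly R[i]}) D d f (us us' : nat -> R -> R[i]) :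
  e * e = 1 -> open D -> csmooth D d f ->
  (forall w, D w -> us 0%N w = r.[e * w%:C] * f w) ->
  (forall j w, (j < d)%N -> D w -> is_cder (us j) w (us' j w)) ->
  (forall j w, (j < d)%N -> D w -> us j.+1 w = - e * us' j w - s * us j w) ->
  forall j w, (j <= d)%N -> D w -> gfun e (iter j (zstep s) r%:P) f w = us j w.
Proof.
move=> ee oD sf us0 dus usS; elim=> [|j IH] w jd Dw.
  by rewrite us0 // (@gfunE 1) ?size_polyC_leq1 // big_ord1 coefC expr0 mul1r.
rewrite iterS (@gfun_zstep _ _ _ _ _ (us' j w)) //.
- by rewrite IH ?usS // ltnW.
- by apply: (csmooth_leq _ sf) => //; exact: leq_trans (size_iter_zstep _ _ _) jd.
- apply: (is_cder_open oD Dw) (dus j w jd Dw) => y Dy.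
  by rewrite IH // ltnW.
Qed.

Lemma ratdiffop_act_gfun (r : {poly R[i]}) (s : R[i]) d (h : (1 : {poly R[i]}) != 0) f w :
  ratdiffop_act (RatDiffop (reflecting_numerator r s d) h) f w =
  (qsharp r).[w%:C] * gfun 1 (iter d (zstep s) r%:P) f w.
Proof.
rewrite /ratdiffop_act /= hornerC divr1.
have E : \sum_(k < size (reflecting_numerator r s d)) ((reflecting_numerator r s d)`_k).[w%:C] *
    iter k (@cderiv R) f w = gfun 1 (reflecting_numerator r s d) f w.
  by apply: eq_bigr => k _; rewrite expr1n !mul1r.
rewrite E (@gfunE (size (iter d (zstep s) r%:P))) ?size_scale_leq // mulr_sumr.
by apply: eq_bigr => k _; rewrite coefZ hornerM !mul1r expr1n !mul1r mulrA.
Qed.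

Lemma ratdiffop_act_reflected_gfun (r : {poly R[i]}) (s : R[i]) d
    (h : (1 : {poly R[i]}) != 0) f w :
  ratdiffop_act_reflected (RatDiffop (reflecting_numerator r s d) h) f w =
  conjc r.[w%:C] * gfun (-1) (iter d (zstep s) r%:P) f w.
Proof.
rewrite /ratdiffop_act_reflected /= hornerC divr1.
have E : \sum_(k < size (reflecting_numerator r s d)) (-1) ^+ k *
    ((reflecting_numerator r s d)`_k).[- w%:C] * iter k (@cderiv R) f w =
    gfun (-1) (reflecting_numerator r s d) f w.
  by apply: eq_bigr => k _; rewrite mulN1r.
rewrite E (@gfunE (size (iter d (zstep s) r%:P))) ?size_scale_leq // mulr_sumr.
apply: eq_bigr => k _; rewrite coefZ hornerM !mulN1r horner_qsharp.
have -> : - conjc (- w%:C) = w%:C by apply: cpart_eq; rewrite !cpartE /= ?opprK ?oppr0.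
by ring.
Qed.

End SmoothFunctions.

(** * Test functions *)

Section TestFunctions.
Variable R : realType.
Local Open Scope classical_set_scope.
Implicit Types (f u : R -> R[i]) (a b t x : R).

(** Finitely many derivatives are required instead of infinitely many: this is what finitely many
    averagings provide. *)
Definition test_fun t n f : Prop :=
  exists a b, [/\ t < a, csupp a b f & csmooth setT n f].

Lemma csupp_cderiv a b f : csupp a b f -> csupp a b (cderiv f).
Proof.
move=> sf x; rewrite negb_and -!ltNge => xab.
suff H : is_cder f x 0 by rewrite (is_cder_cderiv H).
case/orP: xab => [xa|bx].
  apply: (is_cder_open (D := `]-oo, a[) (f := fun=> 0)) (is_cder_cst 0 x) => //.
  by move=> y; rewrite /= in_itv /= => ya; rewrite sf // negb_and -!ltNge ya.
apply: (is_cder_open (D := `]b, +oo[) (f := fun=> 0)) (is_cder_cst 0 x) => //.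
  by rewrite /= in_itv /= bx.
by move=> y; rewrite /= in_itv /= andbT => yb; rewrite sf // negb_and -!ltNge yb orbT.
Qed.

Lemma cfun_smooth t a b n f : t < a -> csupp a b f -> csmooth setT n.+1 f -> cfun t a b f.
Proof.
move=> ta sf smf; split=> // x _.
exact: is_cder_ccont (csmooth_cder smf (I : setT x)).
Qed.

End TestFunctions.

(** * The reflection identity on test functions *)

Section ReflectionOnTestFunctions.
Variable R : realType.
Local Open Scope classical_set_scope.
Local Notation K := (ratfun R).
Local Notation delta := (@rderiv R).
Implicit Types (x y z w : R) (f : R -> R[i]).
Variables (psi : R -> R -> R[i]) (s t : R) (d : nat).
Hypothesis t0 : 0 <= t.
Variables (A0 A : {poly K}) (q r : {poly R[i]}).
Hypothesis A0q : intertwines psi s t A0 q.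
Hypothesis Ar : intertwines psi s t A r.
Hypothesis sA : (size A <= d.+1)%N.
Hypothesis q0 : forall z, t <= z -> q.[z%:C] != 0.
Hypothesis CA0 : is_constop (ocomp delta (oadj delta (oconj A)) A0) (q * qsharp r).

Let Dt : set R := `]t, +oo[.
Let oDt : open Dt. Proof. exact: interval_open. Qed.
Let DtE z : Dt z = (t < z). Proof. by rewrite /Dt /= in_itv /= andbT. Qed.

(** Multiplied by q, the transform is \sum_k (-z)^k times the Laplace transform of a coefficient of
    A0 against the decaying function g. Each of these is differentiable at all z > 0 to any order,
    and q has no zero on [t, oo). *)
Lemma transform_smooth a b f n : cfun t a b f -> csmooth Dt n (EEpsi_adj psi s t f).
Proof.
move=> cf; have [ta _ _] := cf; have a0 : 0 < a by exact: le_lt_trans ta.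
have [rA0 A0E] := A0q; have rcA0 := oreg_oconj rA0.
pose h w := conjc q.[w%:C]^-1 * f w.
have ch : cfun t a b h by exact: cfun_conj_div.
pose g := rapply (oconj A0) (Lapk t h).
have ea : - a < - (a / 2) by lra.
have tg : tame s (- (a / 2)) g.
  by apply: (tame_rapply ea rcA0) => k; exact: tame_Lapk ch.
pose v k y := reval A0`_k y * g y.
have a2 : 0 < a / 2 by rewrite divr_gt0.
have tv k : tame s 0 (v k).
  by rewrite -(subrr (a / 2)); apply: tameM => //; exact: tame_reval.
have mI := measurable_tail s.
have TE z : Dt z -> q.[z%:C]^-1 * (\sum_(k < size A0) (- z%:C) ^+ k * Lap s (v k) z) =
    EEpsi_adj psi s t f z.
  rewrite DtE => tz; have qz : q.[z%:C] != 0 by rewrite q0 // ltW.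
  have z0 : 0 < z by exact: le_lt_trans tz.
  apply: (mulfI qz); rewrite mulrA mulfV // mul1r.
  rewrite (horner_EEpsi_adj t0 A0q q0 A0q tz a2 tg) => [|x]; last first.
    exact: (Epsi_adj_rapply A0q q0 cf).
  pose w k y := (- z%:C) ^+ k * ((expR (- (y * z)))%:C * v k y).
  have iw k : cintegrable `]s, +oo[ (w k).
    by apply: cintegrableZ => //; exact: Lap_integrable z0 (tv k).
  transitivity (\sum_(k < size A0) cintegral `]s, +oo[ (w k)).
    by apply: eq_bigr => k _; rewrite cintegralZ //; exact: Lap_integrable z0 (tv k).
  rewrite -(cintegral_sum _ mI iw).2; apply: eq_cintegral => y _.
  by rewrite mulr_suml; apply: eq_bigr => k _; rewrite /w /v /ewave; ring.
apply: (csmooth_ext oDt TE); apply: csmoothM => //.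
  have rq : rreg t (q%:F^-1) by exact: rregV.
  have rqk k : rreg t (iter k delta (q%:F^-1)).
    by elim: k => //= k; exact: rreg_rderiv.
  apply: (csmooth_ext (f := reval (q%:F^-1)) oDt) => [z|].
    rewrite DtE => tz; rewrite -[q%:F^-1]mul1r -tofrac1 revalE ?hornerC ?mul1r //.
    by rewrite q0 // ltW.
  apply: (csmooth_chain (us := fun k => reval (iter k delta (q%:F^-1))) oDt).
  by move=> k z; rewrite DtE => tz; exact: is_cder_reval (rqk k) (ltW tz).
apply: csmooth_sum => // k; apply: csmoothM => //.
  apply: (csmooth_ext (f := fun z => ((- 'X) ^+ k).[z%:C]) oDt) => [z _|].
    by rewrite horner_exp hornerN hornerX.
  exact: csmooth_horner.
pose us j := Lap s (fun y => (- y%:C) ^+ j * v k y).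
have tus j c : 0 < c -> tame s c (fun y => (- y%:C) ^+ j * v k y).
  move=> c0; rewrite -[c]addr0; apply: tameM => //.
  have := tame_horner s ((- 'X) ^+ j) c0.
  have -> // : (fun x : R => ((- 'X) ^+ j : {poly R[i]}).[x%:C]) = fun y : R => (- y%:C) ^+ j.
  by apply/funext => y; rewrite horner_exp hornerN hornerX.
apply: (csmooth_ext (f := us 0%N) oDt) => [z _|].
  by apply: eq_cintegral => y _; rewrite expr0 mul1r.
apply: (csmooth_chain (us := us) oDt) => j z; rewrite DtE => tz.
have z0 : 0 < z by exact: le_lt_trans tz.
have zz : z / 2 < z by lra.
have := is_cder_Lap zz (tus j (z / 2) (divr_gt0 z0 (ltr0Sn _ _))).
have -> // : Lap s (fun y => - y%:C * ((- y%:C) ^+ j * v k y)) z = us j.+1 z.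
by apply: eq_cintegral => y _; rewrite exprS mulrA.
Qed.

Section OneTestFunction.
Variables (a b : R) (f : R -> R[i]).
Hypothesis ta : t < a.
Hypothesis sf : csupp a b f.
Hypothesis smf : csmooth setT d.+1 f.

(** The functions (d_w - s)^j applied to r(-w) f: reflection turns - d_z - s into d_w - s and r(z)
    into r(-w). *)
Let H j := iter j (fun u w => cderiv u w - s%:C * u w) (fun w => r.[- w%:C] * f w).
Let F := Lap t (H 0%N).

(** Each step consumes a derivative. The d + 1 derivatives of f leave one for [H d], hence its
    continuity. *)
Let smH j : (j <= d)%N -> csmooth setT (d - j).+1 (H j) /\ csupp a b (H j).
Proof.
elim: j => [|j IH] jd.
  rewrite subn0; split; last by move=> x /sf; rewrite /H /= => ->; rewrite mulr0.
  apply: csmoothM; [exact: openT| |exact: smf].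
  have := @csmooth_comp_horner _ setT d.+1 (-1) r openT.
  by apply: csmooth_ext; [exact: openT|move=> x _; rewrite mulN1r].
have [sH cH] := IH (ltnW jd); rewrite -(subnSK jd) in sH.
split; last first.
  move=> x xab; rewrite /H /= -/(H j) (csupp_cderiv cH xab) (cH x xab).
  by rewrite mulr0 subr0.
apply: (csmooth_ext (f := fun w => cderiv (H j) w + - s%:C * H j w) openT) => [x _|].
  by rewrite /H /= mulNr.
apply: csmoothD; [exact: openT|by case/csmoothS: sH|].
apply: csmoothM; [exact: openT|exact: csmooth_cst openT|].
exact: csmooth_leq sH.
Qed.

Let cH j : (j <= d)%N -> cfun t a b (H j).
Proof. by move=> jd; have [sH sHj] := smH jd; exact: cfun_smooth sH. Qed.

Let dH j x : (j < d)%N -> is_cder (H j) x (cderiv (H j) x).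
Proof. by move=> jd; have [sH _] := smH (ltnW jd); exact: (csmooth_cder sH). Qed.

Let cdH j : (j < d)%N -> cfun t a b (cderiv (H j)).
Proof.
move=> jd; have [sH sHj] := smH (ltnW jd); rewrite -(subnSK jd) in sH.
have [_ sdH] := (csmoothS _ _ _).1 sH.
exact: (cfun_smooth ta (csupp_cderiv sHj) sdH).
Qed.

Let LapH j k y : (j < d)%N -> Lapk t (H j.+1) k y =
  (y%:C - s%:C) * Lapk t (H j) k y + k%:R * Lapk t (H j) k.-1 y.
Proof.
move=> jd; apply: (Lapk_step _ _ _ (cH (ltnW jd)) (cdH jd)) => w _; exact: dH.
Qed.

(** At y = s the first term of [LapH] drops out and the second one lowers both i and j; this is the
    zero of order j of (y - s)^j F at s. *)
Let LapH_vanish j i : (j <= d)%N -> (i < j)%N -> Lapk t (H j) i s = 0.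
Proof.
elim: j i => // j IH i jd ij; rewrite LapH // subrr mul0r add0r.
by case: i ij => [|i] ij; rewrite ?mul0r //= IH ?mulr0 // ltnW.
Qed.

Let Lapk0 v y : Lapk t v 0 y = Lap t v y.
Proof. by apply: eq_Lap => w _; rewrite expr0 mul1r. Qed.

Let LapH_power j y : (j <= d)%N -> Lap t (H j) y = (y%:C - s%:C) ^+ j * F y.
Proof.
elim: j => [|j IH] jd; first by rewrite mul1r.
by rewrite -Lapk0 LapH // Lapk0 IH ?(ltnW jd) // mul0r addr0 exprS mulrA.
Qed.

Variable one_neq0 : (1 : {poly R[i]}) != 0.
Let Dop := RatDiffop (reflecting_numerator r s%:C d) one_neq0.

Lemma reflected_action w : ratdiffop_act_reflected Dop f w = conjc r.[w%:C] * H d w.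
Proof.
rewrite ratdiffop_act_reflected_gfun; congr (_ * _).
apply: (gfun_iter_zstep (us := H) (us' := fun j => cderiv (H j)) (D := setT) (d := d)).
- by rewrite mulrNN mulr1.
- exact: openT.
- exact: csmooth_leq smf.
- by move=> x _; rewrite /H /= mulN1r.
- by move=> j x jd _; exact: dH.
- by move=> j x jd _; rewrite opprK mul1r.
- exact: leqnn.
- by [].
Qed.

Lemma reflected_action_cfun : cfun t a b (ratdiffop_act_reflected Dop f).
Proof.
have -> : ratdiffop_act_reflected Dop f = fun w => conjc r.[w%:C] * H d w.
  by apply/funext => w; exact: reflected_action.
apply: cfunM (cH (leqnn d)) => x _.
exact: is_cder_ccont (is_cderJ (is_cder_horner r x)).
Qed.

Lemma reflection_on_test_fun z : t < z ->
  EEpsi_adj psi s t (ratdiffop_act_reflected Dop f) z =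
  ratdiffop_act Dop (EEpsi_adj psi s t f) z.
Proof.
move=> tz; have a0 : 0 < a by exact: le_lt_trans ta.
have cf : cfun t a b f by exact: cfun_smooth smf.
rewrite (transform_reflected t0 A0q Ar sA q0 CA0 (cH (leqnn d))) //; last first.
- by move=> i id; exact: LapH_vanish.
- by move=> w _; exact: reflected_action.
rewrite ratdiffop_act_gfun; congr (_ * _).
have [B HB] := transform_boundary t0 A0q Ar sA q0 CA0 cf.
(* The boundary terms, with the exponential e^{-sz} divided out: a polynomial in z of degree less
   than d. The signs come from (-z)^i. *)
pose b0 : {poly R[i]} := \poly_(i < d) ((-1) ^+ i * B i).
(* On e^{-sz} b(z), the operator - d_z - s acts as e^{-sz} times -b', so j steps give (-1)^j b0^(j)
   and d steps give 0. *)
pose bj j := (-1) ^+ j *: derivn j b0.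
pose E y : R[i] := (expR (- s * y))%:C.
pose v j y := (y%:C - s%:C) ^+ j * F y.
(* The closed form of (-d_z - s)^j applied to r T f: a Laplace transform gains the factor y - s per
   step, the boundary polynomial loses a degree. *)
pose us j y := Lap s (v j) y - E y * (bj j).[y%:C].
pose us' j y := Lap s (fun x => - x%:C * v j x) y -
  (- s%:C * E y * (bj j).[y%:C] + E y * (bj j)^`().[y%:C]).
have tF : tame s (- a) F by exact: Lap_decay a0 (cH (leq0n d)).
have tv j : tame s 0 (v j).
  rewrite -(subrr a); apply: tameM tF.
  have := tame_horner s (('X - s%:C%:P) ^+ j) a0.
  have -> // : (fun x : R => (('X - s%:C%:P) ^+ j).[x%:C]) = fun y : R => (y%:C - s%:C) ^+ j.
  by apply/funext => y; rewrite horner_exp hornerXsubC.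
have dE y : is_cder E y (- s%:C * E y).
  have := is_cder_real (is_derive_expRM (- s) y).
  suff -> : (- s * expR (- s * y))%:C = - s%:C * E y by [].
  by apply: cpart_eq; rewrite !cpartE /=; ring.
have mI := measurable_tail s.
have -> : gfun 1 (iter d (zstep s%:C) r%:P) (EEpsi_adj psi s t f) z = us d z.
  apply: (gfun_iter_zstep (us' := us') _ oDt) => //; rewrite ?mul1r ?DtE //.
  - exact: transform_smooth cf.
  - move=> w; rewrite DtE => tw; rewrite mul1r HB //; congr (_ - _).
      by apply: eq_cintegral => y _; rewrite /v expr0 mul1r.
    rewrite /bj expr0 scale1r derivn0 /b0 horner_poly mulr_sumr; apply: eq_bigr => i _.
    rewrite /ewave /E mulNr; set e := (expR _)%:C.
    by rewrite (exprNn w%:C); ring.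
  - move=> j w jd; rewrite DtE => tw; have w0 : 0 < w by exact: le_lt_trans tw.
    apply: is_cderD; first exact: is_cder_Lap w0 (tv j).
    by apply: is_cderN; apply: is_cderM; [exact: dE|exact: is_cder_horner].
  - move=> j w jd; rewrite DtE => tw; have w0 : 0 < w by exact: le_lt_trans tw.
    have bS : (bj j.+1).[w%:C] = - (bj j)^`().[w%:C].
      by rewrite /bj derivZ -derivnS exprS mulN1r scaleNr hornerN.
    have LS : Lap s (v j.+1) w = - Lap s (fun x => - x%:C * v j x) w - s%:C * Lap s (v j) w.
      have i1 : cintegrable `]s, +oo[ (fun y => (expR (- (y * w)))%:C * v j y).
        exact: Lap_integrable w0 (tv j).
      have tw2 : tame s (w / 2) (fun x => - x%:C * v j x).
        rewrite -[w / 2]addr0; apply: tameM => //; apply: tameN; apply: tame_id.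
        by rewrite divr_gt0.
      have w2 : w / 2 < w by lra.
      have i2 := Lap_integrable w2 tw2.
      rewrite -mulN1r -mulNr /Lap -!cintegralZ // -cintegralD //; last 2 first.
        by apply: cintegrableZ.
        by apply: cintegrableZ.
      by apply: eq_cintegral => y _; rewrite /v exprS; ring.
    by rewrite /us /us' bS LS; ring.
have b0d : derivn d b0 = 0 by apply: derivn_poly0; exact: size_poly.
rewrite /us /bj b0d scaler0 horner0 mulr0 subr0.
by apply: eq_cintegral => y _; rewrite LapH_power.
Qed.

End OneTestFunction.
End ReflectionOnTestFunctions.

(** * Density of the test functions *)

Section Averaging.
Variable R : realType.
Local Open Scope classical_set_scope.
Local Notation mu := (@lebesgue_measure R).
Implicit Types (f g k u v : R -> R) (a b c h t x y N e : R).

Definition bfun N a b k : Prop := [/\ measurable_fun setT k,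
  forall x, `|k x| <= N & forall x, ~~ (a <= x <= b) -> k x = 0].

Lemma integrable_indic_bound (D : set R) f C a b : measurable D ->
  measurable_fun D f -> (forall x, D x -> `|f x| <= C * \1_(`[a, b]) x) ->
  mu.-integrable D (EFin \o f).
Proof.
move=> mD mf fC.
have i1 : mu.-integrable setT (EFin \o (\1_(`[a, b] : set R) : R -> R)).
  exact: (@integrable_indic_itv R a b true false).
have i2 : mu.-integrable D (EFin \o (\1_(`[a, b] : set R) : R -> R)).
  by refine (integrableS _ _ _ i1) => //; exact: mD.
have i3 : mu.-integrable D (fun x => C%:E * (\1_(`[a, b] : set R) x)%:E)%E.
  by refine (integrableZl _ C i2); exact: mD.
refine (le_integrable _ _ _ i3); first exact: mD.
  exact/measurable_EFinP.
by move=> x Dx /=; rewrite lee_fin (le_trans (fC x Dx)) // ler_norm.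
Qed.

Lemma bfun_le_indic N a b k x : bfun N a b k -> `|k x| <= N * \1_(`[a, b]) x.
Proof.
move=> [_ kN k0]; rewrite indicE.
have [xab|xab] := boolP (a <= x <= b).
  by rewrite mem_set /= ?in_itv //= mulr1.
rewrite k0 // normr0; case: (_ \in _); rewrite ?mulr0 // mulr1.
by rewrite (le_trans (normr_ge0 _) (kN x)).
Qed.

Lemma bfun_integrable (D : set R) N a b k : measurable D -> bfun N a b k ->
  mu.-integrable D (EFin \o k).
Proof.
move=> mD bk; apply: (integrable_indic_bound (C := N) (a := a) (b := b) mD).
  by case: bk => mk _ _; exact: measurable_funTS.
by move=> x _; exact: bfun_le_indic.
Qed.

Definition primitive k x := \int[mu]_(y in `]-oo, x]) k y.

Lemma primitiveB N a b k x y : bfun N a b k -> x <= y ->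
  primitive k y - primitive k x = \int[mu]_(z in `]x, y]) k z.
Proof.
move=> bk xy; have ik : mu.-integrable `]-oo, y] (EFin \o k).
  by apply: bfun_integrable bk; exact: measurable_itv.
have xy' : (BRight x <= BRight y)%O by rewrite bnd_simp.
exact: (Rintegral_itvB ik isT xy').
Qed.

Lemma primitive_lip N a b k x y : bfun N a b k -> x <= y ->
  `|primitive k y - primitive k x| <= N * (y - x).
Proof.
move=> bk xy; rewrite (primitiveB bk xy).
have mI : measurable (`]x, y] : set R) by exact: measurable_itv.
have ik : mu.-integrable `]x, y] (EFin \o k) by exact: bfun_integrable bk.
apply: le_trans (le_normr_Rintegral _ ik) _; first exact: mI.
have lI : mu `]x, y] = (y - x)%:E.
  by rewrite lebesgue_measure_itv /= lte_fin; case: ltP => // yx; rewrite (le_anti (_ : x <= y <= x)) ?xy // subrr.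
have -> : N * (y - x) = \int[mu]_(z in `]x, y]) N.
  by rewrite Rintegral_cst //; congr (N * _); exact: (esym (congr1 fine lI)).
apply: le_Rintegral => //.
- by refine (integrable_norm ik).
- apply: (integrable_indic_bound (C := `|N|) (a := x) (b := y) mI) => // z.
  rewrite /= in_itv /= => /andP[xz zy].
  by rewrite indicE mem_set /= ?in_itv /= ?(ltW xz) ?mulr1.
- by move=> z _; case: bk.
Qed.

(** The Steklov mean over (x, x + h]. It keeps the bound N, gains one derivative, and enlarges the
    support only to the left, by h, which must be kept away from t. *)
Definition average h k x := (primitive k (x + h) - primitive k x) / h.

Lemma average_bound N a b k h x : 0 < h -> bfun N a b k -> `|average h k x| <= N.
Proof.
move=> h0 bk; rewrite /average normrM normfV (gtr0_norm h0) ler_pdivrMr //.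
have := primitive_lip bk (_ : x <= x + h); rewrite lerDl (ltW h0) => /(_ isT).
by rewrite addrAC subrr add0r.
Qed.

Lemma average_supp N a b k h x : 0 < h -> bfun N a b k -> ~~ (a - h <= x <= b) ->
  average h k x = 0.
Proof.
move=> h0 bk; have [_ _ k0] := bk; rewrite negb_and -!ltNge => xab.
have xh : x <= x + h by rewrite lerDl ltW.
rewrite /average (primitiveB bk xh) /Rintegral integral0_eq ?mul0r // => z.
rewrite /= in_itv /= => /andP[xz zxh]; rewrite k0 // negb_and -!ltNge.
case/orP: xab => [xa|bx]; first by rewrite (le_lt_trans zxh) // -ltrBrDr.
by rewrite (lt_trans bx xz) orbT.
Qed.

Lemma primitive_continuous N a b k : bfun N a b k -> continuous (primitive k).
Proof.
move=> bk x; have N0 : 0 <= N by case: bk => _ /(_ 0) kN _; exact: le_trans kN.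
have lip y : `|primitive k x - primitive k y| <= N * `|x - y|.
  have [xy|yx] := leP x y.
    by rewrite distrC [`|x - y|]distrC (ger0_norm (_ : 0 <= y - x)) ?subr_ge0 // (primitive_lip bk).
  by rewrite (gtr0_norm (_ : 0 < x - y)) ?subr_gt0 // (primitive_lip bk) // ltW.
apply/cvgrPdist_le => e e0.
have d0 : 0 < e / (N + 1) by rewrite divr_gt0 // ltr_wpDl.
near=> y; apply: le_trans (lip y) _.
have : `|x - y| <= e / (N + 1) by near: y; exact: cvgr_dist_le.
rewrite ler_pdivlMr ?ltr_wpDl // => H; apply: le_trans H.
by rewrite mulrC ler_wpM2l // lerDl.
Unshelve. all: by end_near. Qed.

Lemma average_continuous N a b k h : bfun N a b k -> continuous (average h k).
Proof.
move=> bk x; apply: cvgM; last exact: cvg_cst.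
have pc := primitive_continuous bk.
apply: cvgB; last exact: pc.
have shift : {for x, continuous (fun y => y + h)} by apply: cvgD; [exact: cvg_id|exact: cvg_cst].
exact: (continuous_comp shift (pc (x + h))).
Qed.

Lemma average_bfun N a b k h : 0 < h -> bfun N a b k -> bfun N (a - h) b (average h k).
Proof.
move=> h0 bk; split=> [|x|x].
- exact: continuous_measurable_fun (average_continuous bk).
- exact: average_bound bk.
- exact: average_supp bk.
Qed.

Lemma is_derive_primitive N a b k x : bfun N a b k -> {for x, continuous k} ->
  is_derive x 1 (primitive k) (k x).
Proof.
move=> bk ck.
have ik : mu.-integrable `]-oo, x + 1] (EFin \o k).
  by apply: bfun_integrable bk; exact: measurable_itv.
have xx : x < x + 1 by rewrite ltrDl.
have [d1 d2] := continuous_FTC1 xx ik (ltNyr x) ck.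
by apply: DeriveDef; [exact: d1|rewrite -derive1E; exact: d2].
Qed.

Lemma is_derive_average N a b k h x : bfun N a b k -> continuous k ->
  is_derive x 1 (average h k) ((k (x + h) - k x) / h).
Proof.
move=> bk ck.
have d1 : is_derive x 1 (fun y => primitive k (y + h)) (k (x + h)).
  have ds : is_derive x 1 (fun y : R => y + h) 1.
    by apply: is_derive_eq (is_deriveD (is_derive_id x 1) (is_derive_cst h x 1)) _; rewrite addr0.
  pose sh (y : R) := y + h.
  have dp : is_derive (sh x) 1 (primitive k) (k (x + h)).
    exact: is_derive_primitive bk (ck _).
  have := is_derive1_comp (g := sh) dp ds.
  by rewrite mulr1.
have := is_deriveM_ (is_deriveB d1 (is_derive_primitive bk (ck x))) (is_derive_cst h^-1 x 1).
by rewrite mulr0 addr0.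
Qed.

Definition sqdist t u v : \bar R := (\int[mu]_(x in `]t, +oo[) ((u x - v x) ^+ 2)%:E)%E.

Lemma measurable_sqr_diff t u v : measurable_fun `]t, +oo[ u -> measurable_fun `]t, +oo[ v ->
  measurable_fun `]t, +oo[ (fun x => ((u x - v x) ^+ 2)%:E).
Proof.
move=> mu_ mv; apply/measurable_EFinP; apply: measurable_funX; exact: measurable_funB.
Qed.

Lemma sqdist_dominated (u_ : nat -> R -> R) v g t e :
  (forall n, measurable_fun `]t, +oo[ (u_ n)) -> measurable_fun `]t, +oo[ v ->
  mu.-integrable `]t, +oo[ (EFin \o g) ->
  (forall n x, t < x -> (u_ n x - v x) ^+ 2 <= g x) ->
  {ae mu, forall x, t < x -> u_ n x @[n --> \oo] --> v x} -> 0 < e ->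
  exists n, (sqdist t (u_ n) v < e%:E)%E.
Proof.
move=> mu_ mv ig ug uv e0.
have mD := measurable_tail t.
pose F n x : \bar R := ((u_ n x - v x) ^+ 2)%:E.
have mF n : measurable_fun `]t, +oo[ (F n) by exact: measurable_sqr_diff.
have m0 : measurable_fun `]t, +oo[ (fun _ : R => 0%:E : \bar R) by [].
have F0 : {ae mu, forall x, `]t, +oo[ x -> F n x @[n --> \oo] --> (0%:E : \bar R)}.
  move: uv; apply: filterS; first exact: (ae_filter_ringOfSetsType mu).
  move=> x ux; rewrite /= in_itv /= andbT => /ux {}ux.
  apply: cvg_EFin; first exact: nearW.
  have : (u_ n x - v x) @[n --> \oo] --> 0.
    by rewrite -(subrr (v x)); apply: cvgB => //; exact: cvg_cst.
  move=> H; have -> : fine \o F^~ x = fun n => (u_ n x - v x) * (u_ n x - v x).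
    by apply/funext => n; rewrite /= expr2.
  by rewrite -(mulr0 0); apply: cvgM.
have Fg : {ae mu, forall x n, `]t, +oo[ x -> (`|F n x| <= (EFin \o g) x)%E}.
  apply: aeW => x n; rewrite /= in_itv /= andbT => tx.
  by rewrite /F lee_fin ger0_norm ?sqr_ge0 // ug.
have := @dominated_convergence _ _ _ mu `]t, +oo[ _ F (fun=> 0%:E) (EFin \o g) _ _ F0 ig Fg.
move=> /(_ mD mF m0) [_ _ H].
rewrite integral0 in H.
have nb : nbhs (0%E : \bar R) [set y | (y < e%:E)%E].
  by apply: open_ereal_lt'; rewrite lte_fin.
by have [n _ Hn] := H _ nb; exists n; exact: (Hn n (leqnn n)).
Qed.

(** The means converge almost everywhere along a sequence h n -> 0. Since h n < c, all of them live
    in [a - c, b], where the constant (2 N)^2 dominates the squared differences. *)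
Lemma average_cvg N a b k t e (c : R) : bfun N a b k -> 0 < e -> 0 < c ->
  exists h, [/\ 0 < h, h < c & (sqdist t (average h k) k < e%:E)%E].
Proof.
move=> bk e0 c0; pose h (n : nat) : R := c / 2 * harmonic n.
have h0 n : 0 < h n by rewrite mulr_gt0 ?divr_gt0 // /harmonic /= invr_gt0.
have hc n : h n < c.
  apply: (@le_lt_trans _ _ (c / 2)); last by lra.
  rewrite -[leRHS]mulr1 ler_wpM2l ?divr_ge0 ?(ltW c0) // /harmonic /=.
  by rewrite invf_le1 // ler1n.
have h_cvg : h n @[n --> \oo] --> 0.
  by rewrite -(mulr0 (c / 2)); apply: cvgMr; exact: cvg_harmonic.
have mD := measurable_tail t.
have [mk kN k0] := bk.
have N0 : 0 <= N by exact: le_trans (kN 0).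
have mA n : measurable_fun `]t, +oo[ (average (h n) k).
  by have [mA _ _] := average_bfun (h0 n) bk; exact: measurable_funTS.
have ig : mu.-integrable `]t, +oo[ (EFin \o (fun x => (2 * N) ^+ 2 * \1_(`[a - c, b] : set R) x)).
  apply: (integrable_indic_bound (C := (2 * N) ^+ 2) (a := a - c) (b := b) mD).
    by apply: measurable_funM => //; exact: measurable_indic.
  by move=> x _; rewrite ger0_norm // mulr_ge0 // sqr_ge0.
have Fg n x : t < x -> (average (h n) k x - k x) ^+ 2 <= (2 * N) ^+ 2 * \1_(`[a - c, b] : set R) x.
  move=> _; rewrite indicE; have [xab|xab] := boolP (a - c <= x <= b).
    rewrite mem_set /= ?in_itv //= mulr1.
    rewrite -real_normK ?num_real // ler_pXn2r ?nnegrE ?mulr_ge0 //.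
    rewrite (le_trans (ler_normB _ _)) // mulrDl mul1r lerD //.
    exact: average_bound (h0 n) bk.
  have xk : ~~ (a <= x <= b).
    apply: contra xab => /andP[ax ->]; rewrite andbT (le_trans _ ax) //.
    by rewrite gerBl ltW.
  have xA : ~~ (a - h n <= x <= b).
    apply: contra xab => /andP[ax ->]; rewrite andbT (le_trans _ ax) //.
    by rewrite lerD2l lerN2 ltW.
  rewrite k0 // (average_supp (h0 n) bk) // subrr expr0n /=.
  by rewrite mulr_ge0 // sqr_ge0.
have Fcvg : {ae mu, forall x, t < x -> average (h n) k x @[n --> \oo] --> k x}.
  have ik : mu.-integrable setT (EFin \o k) by apply: bfun_integrable bk; exact: measurableT.
  have ikN y : mu.-integrable `]-oo, y] (EFin \o k).
    by apply: bfun_integrable bk; exact: measurable_itv.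
  have lk : locally_integrable setT k by exact: open_integrable_locally openT ik.
  (* Lebesgue's differentiation theorem: almost everywhere the primitive has derivative k, and its
     difference quotients along h n are the means. *)
  have := FTC1Ny ikN lk.
  apply: filterS; first exact: (ae_filter_ringOfSetsType mu).
  move=> x [d1 d2] _.
  have H0 : z^-1 *: ((primitive k \o shift x) (z *: 1) - primitive k x) @[z --> 0^'] --> k x.
    by rewrite -d2 derive1E /derive; exact: d1.
  have H := (cvgr_dnbhsP _ _ _).1 H0 h (conj (fun n => lt0r_neq0 (h0 n)) h_cvg).
  have hE : (fun n => average (h n) k x) =
      fun n => (h n)^-1 *: ((primitive k \o shift x) (h n *: 1) - primitive k x).
    apply/funext => n; rewrite /average /GRing.scale /= mulr1 [h n + x]addrC.
    by rewrite mulrC.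
  by rewrite hE; exact: H.
have [n Hn] := sqdist_dominated mA (measurable_funTS mk) ig Fg Fcvg e0.
by exists (h n).
Qed.

End Averaging.

(** * Approximation in L^2 by test functions *)

Section Density.
Variable R : realType.
Local Open Scope classical_set_scope.
Local Notation mu := (@lebesgue_measure R).
Implicit Types (g k u v w : R -> R) (f : R -> R[i]) (a b t x N e h : R) (n m : nat).

(** Cutting g off outside [t + 1/(n+1), t + n] and where |g| > n gives functions that, at each
    point, eventually equal g, and the squared error is dominated by g^2. *)
Lemma truncation_approx t g e : measurable_fun `]t, +oo[ g ->
  mu.-integrable `]t, +oo[ (EFin \o (fun x => g x ^+ 2)) -> 0 < e ->
  exists k, (exists N a b, t < a /\ bfun N a b k) /\ (sqdist t k g < e%:E)%E.
Proof.
move=> mg ig e0.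
pose a (n : nat) := t + n.+1%:R^-1; pose b (n : nat) := t + n%:R.
have ta n : t < a n by rewrite ltrDl invr_gt0.
have subD n : `[a n, b n] `<=` (`]t, +oo[ : set R).
  by move=> x; rewrite /= !in_itv /= andbT => /andP[ax _]; exact: lt_le_trans ax.
have mI n : measurable (`[a n, b n] : set R) by exact: measurable_itv.
have mgI n : measurable_fun `[a n, b n] g by apply: measurable_funS (subD n) mg.
pose E n := `[a n, b n] `&` g @^-1` `[- n%:R, n%:R].
have mE n : measurable (E n) by apply: mgI.
pose k n := g \_ (E n).
have mk n : measurable_fun setT (k n).
  apply/(measurable_restrictT _ (mE n)).
  by apply: measurable_funS (mgI n) => // x [].
have bk n : bfun n%:R (a n) (b n) (k n).
  split=> [|x|x xab]; [exact: mk| |].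
    rewrite /k patchE; case: ifPn => [|_]; last by rewrite normr0.
    by rewrite inE => -[_]; rewrite /= in_itv /= ler_norml.
  rewrite /k patchE ifF //; apply/negP; rewrite inE => -[+ _].
  by rewrite /= in_itv /= (negbTE xab).
have kg n x : t < x -> (k n x - g x) ^+ 2 <= g x ^+ 2.
  move=> _; rewrite /k patchE; case: ifPn => _; first by rewrite subrr expr0n sqr_ge0.
  by rewrite sub0r sqrrN.
have cv : {ae mu, forall x, t < x -> k n x @[n --> \oo] --> g x}.
  apply: aeW => x tx; apply: cvg_near_cst; near=> n.
  rewrite /k patchE ifT // inE; split; rewrite /= in_itv /=; last first.
    by rewrite -ler_norml; near: n; exact: nbhs_infty_ger.
  apply/andP; split.
    rewrite /a -lerBrDl -[leRHS]invrK lef_pV2 ?posrE ?invr_gt0 ?subr_gt0 //.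
    apply: (@le_trans _ _ n%:R); last by rewrite ler_nat.
    by near: n; exact: nbhs_infty_ger.
  by rewrite /b -lerBlDl; near: n; exact: nbhs_infty_ger.
have mkD n : measurable_fun `]t, +oo[ (k n) by exact: measurable_funTS.
have [n Hn] := sqdist_dominated mkD mg ig kg cv e0.
by exists (k n); split=> //; exists n%:R, (a n), (b n).
Unshelve. all: by end_near. Qed.

(** For squared distances (u - w)^2 <= 2 (u - v)^2 + 2 (v - w)^2, whence e / 4 for each part. *)
Lemma sqdist_triangle t u v w e :
  measurable_fun `]t, +oo[ u -> measurable_fun `]t, +oo[ v -> measurable_fun `]t, +oo[ w ->
  (sqdist t u v < (e / 4)%:E)%E -> (sqdist t v w < (e / 4)%:E)%E -> (sqdist t u w < e%:E)%E.
Proof.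
move=> mu_ mv mw uv vw.
have mD := measurable_tail t.
have sq0 (p q : R -> R) x : (0 <= ((p x - q x) ^+ 2)%:E)%E by rewrite lee_fin sqr_ge0.
have le1 : (sqdist t u w <= 2%:E * sqdist t u v + 2%:E * sqdist t v w)%E.
  have Zl (p q : R -> R) : measurable_fun `]t, +oo[ p -> measurable_fun `]t, +oo[ q ->
      (2%:E * sqdist t p q = \int[mu]_(x in `]t, +oo[) (2%:E * ((p x - q x) ^+ 2)%:E))%E.
    by move=> mp mq; rewrite /sqdist ge0_integralZl //; exact: measurable_sqr_diff.
  rewrite (Zl u v) // (Zl v w) // -ge0_integralD //; last 4 first.
  - by move=> x _; rewrite mule_ge0.
  - by apply: measurable_funeM; exact: measurable_sqr_diff.
  - by move=> x _; rewrite mule_ge0.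
  - by apply: measurable_funeM; exact: measurable_sqr_diff.
  apply: ge0_le_integral => //.
  - exact: measurable_sqr_diff.
  - by apply: emeasurable_funD; apply: measurable_funeM; exact: measurable_sqr_diff.
  - move=> x _; rewrite -!EFinM -EFinD lee_fin.
    have := sqr_ge0 (u x - v x - (v x - w x)); rewrite -subr_ge0.
    by rewrite -subr_ge0 => H; nra.
apply: (le_lt_trans le1).
have -> : e%:E = (2%:E * (e / 4)%:E + 2%:E * (e / 4)%:E)%E.
  by rewrite -!EFinM -EFinD; congr (_%:E); lra.
by apply: lteD; rewrite lte_pmul2l.
Qed.

Lemma csmooth_shift n f h : csmooth setT n f -> csmooth setT n (fun x => f (x + h)).
Proof.
elim: n f => [|n IH] f sf; first by move=> x _.
have [f1 sf'] := (csmoothS _ _ _).1 sf.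
apply: (csmooth_der (f' := fun x => cderiv f (x + h)) openT) => [x _|]; last exact: IH.
have [d1 d2] := csmooth_cder sf (I : setT (x + h)).
have ds : is_derive x 1 (fun y : R => y + h) 1.
  by apply: is_derive_eq (is_deriveD (is_derive_id x 1) (is_derive_cst h x 1)) _; rewrite addr0.
pose sh (y : R) := y + h.
split.
  have := is_derive1_comp (g := sh) (d1 : is_derive (sh x) 1 (fun y => complex.Re (f y)) _) ds.
  by rewrite mulr1.
have := is_derive1_comp (g := sh) (d2 : is_derive (sh x) 1 (fun y => complex.Im (f y)) _) ds.
by rewrite mulr1.
Qed.

(* each averaging gains one derivative *)
Definition smoothness n k : Prop :=
  if n is m.+1 then continuous k /\ csmooth setT m (fun x => (k x)%:C) else True.

Lemma average_smoothness N a b k h n : bfun N a b k -> smoothness n k ->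
  smoothness n.+1 (average h k).
Proof.
move=> bk; case: n => [|n] /= => [_|[ck sk]].
  by split; [exact: average_continuous bk|move=> x _].
split; first exact: average_continuous bk.
apply: (csmooth_der (f' := fun x => ((k (x + h) - k x) / h)%:C) openT) => [x _|].
  exact: is_cder_real (is_derive_average h x bk ck).
have H : csmooth setT n (fun x => (h^-1)%:C * ((k (x + h))%:C + (- 1) * (k x)%:C)).
  apply: csmoothM; [exact: openT|exact: csmooth_cst openT|].
  apply: csmoothD; [exact: openT|exact: (csmooth_shift h sk)|].
  by apply: csmoothM; [exact: openT|exact: csmooth_cst openT|].
apply: csmooth_ext H; first exact: openT.
by move=> x _; apply: cpart_eq; rewrite !cpartE /=; ring.
Qed.

(** One truncation followed by n averagings. Taking h < a - t each time keeps the support inside (t,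
    oo). *)
Lemma real_density t g n e : measurable_fun `]t, +oo[ g ->
  mu.-integrable `]t, +oo[ (EFin \o (fun x => g x ^+ 2)) -> 0 < e ->
  exists k, [/\ exists N a b, t < a /\ bfun N a b k, smoothness n k &
    (sqdist t k g < e%:E)%E].
Proof.
move=> mg ig; elim: n e => [|n IH] e e0.
  by have [k [bk kg]] := truncation_approx mg ig e0; exists k.
have e4 : 0 < e / 4 by rewrite divr_gt0.
have [k [[N [a [b [ta bk]]]] sk kg]] := IH _ e4.
have ta0 : 0 < a - t by rewrite subr_gt0.
have [h [h0 ha Hh]] := average_cvg t bk e4 ta0.
exists (average h k); split.
- by exists N, (a - h), b; split; [rewrite ltrBrDr -ltrBrDl|exact: average_bfun].
- exact: average_smoothness bk sk.
- apply: sqdist_triangle Hh kg => //; apply: measurable_funTS; last by case: bk.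
  by case: (average_bfun h0 bk).
Qed.

Lemma test_fun_dense t n : dense_subspace `]t, +oo[ (test_fun t n.+1).
Proof.
split.
- by move=> f [a [b [ta sf smf]]]; apply: cfun_L2 (cfun_smooth ta sf smf).
- exists (t + 1), (t + 1); split; [by rewrite ltrDl|by []|exact: csmooth_cst openT].
- move=> c f g [a [b [ta sf smf]]] [a' [b' [ta' sg smg]]].
  exists (Num.min a a'), (Num.max b b'); split.
  + by rewrite lt_min ta ta'.
  + move=> x xab; rewrite sf ?sg ?mulr0 ?addr0 //; apply: contra xab => /andP[ax xb].
      by rewrite ge_min ax orbT le_max xb orbT.
    by rewrite ge_min ax le_max xb.
  + apply: csmoothD; [exact: openT| |exact: smg].
    by apply: csmoothM; [exact: openT|exact: csmooth_cst openT|exact: smf].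
move=> g e [mR mI gfin] e0.
have mD := measurable_tail t.
have isq (h : R -> R) : measurable_fun `]t, +oo[ h ->
    (forall x, h x ^+ 2 <= complex.Re (g x) ^+ 2 + complex.Im (g x) ^+ 2) ->
    mu.-integrable `]t, +oo[ (EFin \o (fun x => h x ^+ 2)).
  move=> mh hg; apply/integrableP; split.
    by apply/measurable_EFinP; exact: measurable_funX.
  apply: le_lt_trans gfin; apply: ge0_le_integral => //.
  - by apply/measurable_EFinP; apply: measurableT_comp => //; exact: measurable_funX.
  - by apply/measurable_EFinP; apply: measurable_funD; exact: measurable_funX.
  - by move=> x _; rewrite /= lee_fin ger0_norm ?sqr_ge0.
have e2 : 0 < e / 2 by rewrite divr_gt0.
have iR := isq _ mR (fun x => ler_wpDr (sqr_ge0 _) (lexx _)).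
have iI := isq _ mI (fun x => ler_wpDl (sqr_ge0 _) (lexx _)).
(* Index n + 2, because the first averaging yields only continuity: this gives the n + 1 derivatives
   wanted. *)
have [k1 [[N1 [a1 [b1 [ta1 bk1]]]] s1 d1]] := real_density n.+2 mR iR e2.
have [k2 [[N2 [a2 [b2 [ta2 bk2]]]] s2 d2]] := real_density n.+2 mI iI e2.
exists (fun x => k1 x +i* k2 x).
  exists (Num.min a1 a2), (Num.max b1 b2); split.
  - by rewrite lt_min ta1 ta2.
  - have [_ _ z1] := bk1; have [_ _ z2] := bk2.
    move=> x xab; rewrite z1 ?z2 //; apply: contra xab => /andP[ax xb].
      by rewrite ge_min ax orbT le_max xb orbT.
    by rewrite ge_min ax le_max xb.
  - case: s1 => _ s1; case: s2 => _ s2.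
    have H : csmooth setT n.+1 (fun x => (k1 x)%:C + (0 +i* 1) * (k2 x)%:C).
      apply: csmoothD; [exact: openT|exact: s1|].
      by apply: csmoothM; [exact: openT|exact: csmooth_cst openT|exact: s2].
    apply: csmooth_ext H; first exact: openT.
    by move=> x _; apply: cpart_eq; rewrite !cpartE /=; ring.
have mk (k : R -> R) N a b : bfun N a b k -> measurable_fun `]t, +oo[ k.
  by move=> [mk _ _]; exact: measurable_funTS.
have -> : sqnormL2 `]t, +oo[ (fun x => (k1 x +i* k2 x - g x)%R) =
    (sqdist t k1 (fun x => complex.Re (g x)) + sqdist t k2 (fun x => complex.Im (g x)))%E.
  rewrite /sqdist -ge0_integralD //.
  - by apply: eq_integral => x _; rewrite -EFinD !cpartE.
  - by move=> x _; rewrite lee_fin sqr_ge0.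
  - exact: measurable_sqr_diff (mk _ _ _ _ bk1) mR.
  - by move=> x _; rewrite lee_fin sqr_ge0.
  - exact: measurable_sqr_diff (mk _ _ _ _ bk2) mI.
have -> : e%:E = ((e / 2)%:E + (e / 2)%:E)%E by rewrite -EFinD; congr (_%:E); lra.
exact: lteD.
Qed.

End Density.

(** * Sign of the truncation parameter *)

Section NonnegativeTruncation.
Variable R : realType.
Local Open Scope classical_set_scope.
Local Notation mu := (@lebesgue_measure R).
Implicit Types (f : R -> R[i]) (x y z s t c : R).

Lemma not_integrable_pinfty c f C : (forall y, c <= y -> 1 <= C * cnorm1 (f y)) ->
  ~ cintegrable `]c, +oo[ f.
Proof.
move=> fC [i1 i2].
have mD := measurable_tail c.
pose g y := `|complex.Re (f y)| + `|complex.Im (f y)|.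
have ig : mu.-integrable `]c, +oo[ (fun y => C%:E * (g y)%:E)%E.
  refine (integrableZl _ C (integrableD _ (integrable_norm i1) (integrable_norm i2))); exact: mD.
have i3 : mu.-integrable `]c, +oo[ (EFin \o (fun=> 1 : R)).
  refine (le_integrable _ _ _ ig); [exact: mD|by apply/measurable_EFinP; exact: measurable_cst|].
  move=> y; rewrite /= in_itv /= andbT => /ltW cy; rewrite normr1 lee_fin.
  by rewrite (le_trans (fC y cy)) // ler_norm.
have [_] := integrableP _ _ _ i3.
under eq_integral do rewrite /= normr1.
rewrite integral_cst // mul1e.
have E : mu `]c, +oo[ = +oo%E by rewrite lebesgue_measure_itv /= ltry.
rewrite [X in (X < _)%E](_ : _ = +oo%E); last exact: E.
by rewrite ltxx.
Qed.

Lemma seq_avoid_right (rs : seq R) t t' : t < t' ->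
  exists b, [/\ t < b, b <= t' & forall z, t < z -> z < b -> z \notin rs].
Proof.
move=> tt'; elim: rs => [|r rs [b [tb bt' IH]]]; first by exists t'.
have [tr|rt] := ltP t r.
  exists (Num.min b r); rewrite lt_min tb tr ge_min bt'; split=> // z tz.
  by rewrite lt_min => /andP[zb zr]; rewrite inE negb_or lt_eqF //= IH.
exists b; split=> // z tz zb; rewrite inE negb_or IH // andbT.
by rewrite gt_eqF // (le_lt_trans rt).
Qed.

Lemma seq_bounded (rs : seq R) s : exists c, s <= c /\ forall y, c <= y -> y \notin rs.
Proof.
elim: rs => [|r rs [c [sc IH]]]; first by exists s.
exists (Num.max c (r + 1)); rewrite le_max sc; split=> // y.
rewrite ge_max => /andP[cy ry]; rewrite inE negb_or IH // andbT gt_eqF //.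
by rewrite (lt_le_trans _ ry) // ltrDl.
Qed.

Lemma real_roots (p : {poly R[i]}) : p != 0 ->
  exists rs : seq R, forall x, p.[x%:C] = 0 -> x \in rs.
Proof.
move=> p0; have [rs pE] := closed_field_poly_normal p.
exists (map (@complex.Re R) rs) => x px.
have : root p x%:C by rewrite /root px.
rewrite pE rootZ ?lead_coef_eq0 // root_prod_XsubC => xrs.
by apply/mapP; exists x%:C.
Qed.

(** Let i be the degree in x of the leading coefficient of P. The coefficient of x^i in P(x, a) is a
    polynomial w in a, nonzero because its own top coefficient is the leading coefficient of that
    leading coefficient. *)
Lemma horner_polyC_neq0 (P : diffop R) : P != 0 ->
  exists2 w : {poly R[i]}, w != 0 & forall a, w.[a] != 0 -> P.[a%:P] != 0.
Proof.
move=> P0; pose i := (size (lead_coef P)).-1.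
pose w : {poly R[i]} := \poly_(k < size P) (P`_k)`_i.
exists w.
  apply/eqP => w0; have := congr1 (fun u : {poly R[i]} => u`_(size P).-1) w0.
  rewrite coef_poly coef0 ifT ?prednK ?size_poly_gt0 //.
  rewrite -/(lead_coef P) -/(lead_coef (lead_coef P)) => /eqP.
  by rewrite !lead_coef_eq0 (negbTE P0).
move=> a; apply: contraNneq => Pa.
have := congr1 (fun u : {poly R[i]} => u`_i) Pa; rewrite coef0 => <-.
rewrite horner_poly horner_coef coef_sum; apply/eqP; apply: eq_bigr => k _.
by rewrite -polyC_exp coefMC.
Qed.

(** If t < 0, put e = -t/2. Then p(y) e^{-ey} is square integrable on (s, oo), but its product with
    psi(y, z) is P(y, -z) / q(z) times e^{-y(z+e)}, which is not integrable at infinity for z in (t,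
    -e) unless P(y, -z) vanishes identically in y. The factor p is there to cancel the denominator
    of psi. *)
Lemma truncation_nonneg (P : diffop R) (p q : {poly R[i]}) s t : P != 0 ->
  (forall x, s <= x -> p.[x%:C] != 0) -> (forall z, t <= z -> q.[z%:C] != 0) ->
  truncation_defined (wave_fun P p q) s t -> 0 <= t.
Proof.
move=> P0 ps qt [T _]; rewrite leNgt; apply/negP => t0.
pose e := - t / 2; have e0 : 0 < e by rewrite /e; lra.
pose f y : R[i] := p.[y%:C] * (expR (- e * y))%:C.
have e20 : - (e / 2) < 0 by lra.
have tf : tame s (- (e / 2)) f.
  have -> : - (e / 2) = e / 2 + - e by lra.
  apply: tameM; last exact: tame_expR.
  by apply: tame_horner; lra.
have [aeT _] := T f (tame_L2 e20 tf).
have [w w0 wP] := horner_polyC_neq0 P0.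
have w'0 : w \Po (- 'X) != 0.
  apply: contra w0 => /eqP w'0; apply/eqP/polyP => i; have := coef_compNX w i.
  by rewrite w'0 !coef0 => /esym/eqP; rewrite mulf_eq0 signr_eq0 => /eqP.
have [rs Hrs] := real_roots w'0.
have te : t < - e by rewrite /e; lra.
(* Only finitely many z make P(y, -z) vanish identically, so some interval (t, b) avoids them. It
   has positive measure, and integrability for almost every z yields one z in it. *)
have [b [tb be Hb]] := seq_avoid_right rs te.
have [z [tz zb iz]] : exists z, [/\ t < z, z < b &
    cintegrable `]s, +oo[ (fun y => wave_fun P p q y z * f y)].
  apply: contrapT => H; have [N [mN N0 NT]] := aeT.
  have sub : `]t, b[ `<=` N.
    move=> z; rewrite /= in_itv /= => /andP[tz zb]; apply: NT => /= Hz.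
    apply: H; exists z; split=> //; apply: Hz.
    by rewrite /= in_itv /= tz.
  have : (mu `]t, b[ <= mu N)%E.
    by apply: le_measure => //; rewrite inE.
  have -> : mu N = 0%E by exact: N0.
  have -> : mu `]t, b[ = (b - t)%:E by rewrite lebesgue_measure_itv /= lte_fin tb.
  by rewrite lee_fin leNgt subr_gt0 tb.
pose u := P.[(- z%:C)%:P].
have u0 : u != 0.
  apply: wP; apply/eqP => wz; have : z \in rs.
    by apply: Hrs; rewrite horner_comp hornerN hornerX.
  by apply/negP; exact: Hb.
have [rs' Hrs'] := real_roots u0.
(* Beyond c the polynomial u has no root, and c >= 0 makes y (z + e) <= 0, so the integrand is
   bounded below there. *)
have [c [sc Hc]] := seq_bounded rs' (Num.max s 0).
have uc y : c <= y -> u.[y%:C] != 0.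
  by move=> cy; apply/eqP => /Hrs'; apply/negP; exact: Hc.
move: sc; rewrite ge_max => /andP[sc c0].
have [C [C0 HC]] := tame_bound (tame_inv_horner uc).
have qz : q.[z%:C] != 0 by rewrite qt // ltW.
have subD : `]c, +oo[ `<=` (`]s, +oo[ : set R).
  by move=> y; rewrite /= !in_itv /= !andbT; exact: le_lt_trans.
have mD := @measurable_tail R.
have ic : cintegrable `]c, +oo[ (fun y => wave_fun P p q y z * f y).
  case: iz => i1 i2; split.
    by refine (integrableS _ _ _ i1); [exact: mD|exact: mD|exact: subD].
  by refine (integrableS _ _ _ i2); [exact: mD|exact: mD|exact: subD].
apply: (@not_integrable_pinfty c _ (C * cnorm1 q.[z%:C])) ic => y cy.
have py : p.[y%:C] != 0 by rewrite ps // (le_trans sc).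
have uy := uc y cy.
pose E : R := expR (y * (z + e)).
have E1 : E <= 1.
  rewrite -expR0 ler_expR nmulr_lle0 ?(le_trans c0) //; lra.
have id1 : 1 = u.[y%:C]^-1 * q.[z%:C] * (E%:C * (wave_fun P p q y z * f y)).
  rewrite /wave_fun -/u /f.
  have EE : E%:C * ((expR (- (y * z)))%:C * (expR (- e * y))%:C) = 1.
    rewrite -!rmorphM -!expRD /=.
    by rewrite (_ : y * (z + e) + (- (y * z) + - e * y) = 0) ?expR0 //; ring.
  transitivity (E%:C * ((expR (- (y * z)))%:C * (expR (- e * y))%:C)); first by rewrite EE.
  by field; rewrite uy qz py.
have -> : 1 = cnorm1 (1 : R[i]) by rewrite (cnorm1_real 1) normr1.
rewrite {1}id1 (le_trans (cnorm1M _ _)) //.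
set G := wave_fun _ _ _ _ _ * f y.
have EG : cnorm1 (E%:C * G) <= cnorm1 G.
  rewrite (le_trans (cnorm1M _ _)) // cnorm1_real ger0_norm ?expR_ge0 //.
  by rewrite ler_piMl ?cnorm1_ge0.
have uq : cnorm1 (u.[y%:C]^-1 * q.[z%:C]) <= C * cnorm1 q.[z%:C].
  rewrite (le_trans (cnorm1M _ _)) // ler_wpM2r ?cnorm1_ge0 //.
  by have := HC y cy; rewrite mul0r expR0 mulr1.
by rewrite ler_pM ?cnorm1_ge0.
Qed.

End NonnegativeTruncation.

(** * From formal identities to identities between functions *)

Section FactorizationValues.
Variable R : realType.
Local Open Scope classical_set_scope.
Local Notation K := (ratfun R).
Local Notation fml := (int -> ratfun R).
Local Notation delta := (@rderiv R).
Implicit Types (u psi : fml) (A B N : {poly K}) (P : diffop R) (p q r : {poly R[i]}).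
Implicit Types (x z s t c : R).

Lemma rreg_fmulz c q u : (forall m, rreg c (u m)) -> forall m, rreg c (fmulz q u m).
Proof. by move=> cu m; apply: rreg_sum => i; apply: rregM => //; exact: rreg_cst. Qed.

(* the leading coefficient of q lets one solve for u m from the top degree downwards *)
Lemma rreg_fmulz_inv c q u : q != 0 -> (forall m, (0 < m)%R -> u m = 0) ->
  (forall m, rreg c (fmulz q u m)) -> forall m, rreg c (u m).
Proof.
move=> q0 u0 qu.
apply: (int_down_ind (M := 0)) => [m m0|m um]; first by rewrite u0 //; exact: rreg0.
have qE : size q = (size q).-1.+1 by rewrite prednK // size_poly_gt0.
have := qu (m + (size q).-1%:Z); rewrite /fmulz; set d := (size q).-1.
rewrite qE big_ord_recr /= addrK -/d -[_%:F]/(cst _) -/(lead_coef q).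
set S := \sum_(_ < _) _ => rS.
have rS' : rreg c S.
  rewrite /S big_seq; apply: rreg_sum => i; apply: rregM; first exact: rreg_cst.
  by apply: um; have := ltn_ord i; rewrite -/d; lia.
have -> : u m = cst (lead_coef q)^-1 * (S + cst (lead_coef q) * u m - S).
  rewrite addrC addKr mulrA -cstM mulVf ?cst1 ?mul1r //.
  by rewrite lead_coef_eq0.
by apply: rregM; [exact: rreg_cst|apply: rregD => //; exact: rregN].
Qed.

Lemma oreg_xact_fexp c A : (forall m, rreg c (xact A (fexp R) m)) -> oreg c A.
Proof.
move=> cA k; have -> : A`_k = (-1) ^+ k * xact A (fexp R) k.
  by rewrite xact_fexp signrMK.
exact: rreg_sign.
Qed.

Lemma rreg_xact_fexp c A : oreg c A -> forall m, rreg c (xact A (fexp R) m).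
Proof.
move=> cA [k|k]; last by rewrite xact_fexp_neg; exact: rreg0.
by rewrite xact_fexp; exact: rreg_sign.
Qed.

Definition constop p : {poly K} := \poly_(k < size p) ((-1) ^+ k * cst p`_k).

Lemma is_constop_constop p : is_constop (constop p) p.
Proof.
move=> k; rewrite coef_poly; case: ltnP => // pk.
by rewrite nth_default // cst0 mulr0.
Qed.

Lemma is_constop_fexp N p : xact N (fexp R) = fmulz p (fexp R) <-> is_constop N p.
Proof.
split=> [Np k|Np].
  by rewrite -fmulz_fexp -Np xact_fexp signrMK.
apply/funext => -[k|k]; last by rewrite xact_fexp_neg fmulz_fexp_neg.
by rewrite xact_fexp fmulz_fexp Np signrMK.
Qed.

Lemma is_constop_oreg c N p : is_constop N p -> oreg c N.
Proof. by move=> Np k; rewrite Np; apply: rreg_sign; exact: rreg_cst. Qed.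

(** An equality of formal waves is converted into the equality of operators A q(-d) = B r(-d), by
    [xact_fexp_inj], and operators can be evaluated. *)
Lemma rapply_fmulz c A B q r z x : oreg c A -> oreg c B -> c <= x ->
  fmulz q (xact A (fexp R)) = fmulz r (xact B (fexp R)) ->
  q.[z%:C] * rapply A (ewave z) x = r.[z%:C] * rapply B (ewave z) x.
Proof.
move=> rA rB cx AB.
have AN N p C : is_constop N p -> oreg c C ->
    rapply (ocomp delta C N) (ewave z) x = p.[z%:C] * rapply C (ewave z) x.
  move=> Np rC; rewrite (rapply_comp _ rC (is_constop_oreg c Np) cx) mulr_sumr.
  by apply: eq_bigr => k _; rewrite (rapply_dl_constop _ _ _ Np) mulrCA.
rewrite -(AN _ _ _ (is_constop_constop q) rA) -(AN _ _ _ (is_constop_constop r) rB).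
congr (rapply _ _ _); apply: xact_fexp_inj; rewrite !xact_comp.
have cE p : xact (constop p) (fexp R) = fmulz p (fexp R).
  by apply/is_constop_fexp; exact: is_constop_constop.
by rewrite !cE !xact_fmulz.
Qed.

Lemma oreg_cleared c P p : (forall x, c <= x -> p.[x%:C] != 0) ->
  oreg c (p%:F^-1 *: clift P).
Proof.
move=> pc k; rewrite coefZ coef_map /=.
by apply: rregM; [exact: rregV|exact: rreg_poly].
Qed.

Lemma rapply_cleared c P p z x : (forall x, c <= x -> p.[x%:C] != 0) -> c <= x ->
  rapply (p%:F^-1 *: clift P) (ewave z) x =
  P.[(- z%:C)%:P].[x%:C] / p.[x%:C] * (expR (- (x * z)))%:C.
Proof.
move=> pc cx; rewrite (@rapplyE _ (size P)); last first.
  by rewrite (leq_trans (size_scale_leq _ _)) // size_poly.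
rewrite (horner_coef P) horner_sum !mulr_suml; apply: eq_bigr => k _.
rewrite coefZ coef_map /= (revalM (rregV pc) (rreg_poly c _) cx) reval_poly.
have -> : reval (p%:F^-1) x = p.[x%:C]^-1.
  by rewrite -[p%:F^-1]mul1r -tofrac1 revalE ?pc // hornerC mul1r.
by rewrite hornerM -polyC_exp hornerC /ewave; ring.
Qed.

Lemma intertwines_wave_fun P p q s t : (forall x, s <= x -> p.[x%:C] != 0) ->
  (forall z, t <= z -> q.[z%:C] != 0) ->
  intertwines (wave_fun P p q) s t (p%:F^-1 *: clift P) q.
Proof.
move=> ps qt; split=> [|x z sx tz]; first exact: oreg_cleared.
rewrite (rapply_cleared _ _ ps sx) /wave_fun.
have := qt z tz; have := ps x sx; move: p.[_] q.[_] => a b a0 b0.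
by field; rewrite a0 b0.
Qed.

(** A may come from Pt / pt, about whose poles nothing is assumed. Its coefficients are, up to sign,
    those of r psi, and those of psi are regular on [s, oo) since q psi = A0 e^{-xz} is. The
    identity for functions follows by comparison with A0, cancelling q. *)
Lemma intertwines_factor P p q psi A r s t : kp_wave psi -> from_exp psi P p q ->
  (forall x, s <= x -> p.[x%:C] != 0) -> (forall z, t <= z -> q.[z%:C] != 0) ->
  xact A (fexp R) = fmulz r psi -> intertwines (wave_fun P p q) s t A r.
Proof.
move=> [_ psi0] [p0 q0 Pe] ps qt Ar.
have [rA0 A0q] := intertwines_wave_fun P ps qt.
have A0e := xact_cleared p0 Pe; set A0 := _ *: _ in rA0 A0q A0e.
have rpsi : forall m, rreg s (psi m).
  apply: (rreg_fmulz_inv q0 psi0) => m; rewrite -A0e; exact: rreg_xact_fexp.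
have rA : oreg s A by apply: oreg_xact_fexp => m; rewrite Ar; exact: rreg_fmulz.
split=> // x z sx tz; apply: (mulfI (qt z tz)).
rewrite mulrCA A0q // -(rapply_fmulz (q := q) (r := r) z rA rA0 sx) // Ar A0e.
by rewrite -!fmulzM mulrC.
Qed.

End FactorizationValues.

Theorem theorem2 (R : realType) (psi : formal R)
    (P : diffop R) (p q : {poly R[i]})
    (Pt : diffop R) (pt qt : {poly R[i]}) (d1 d2 : nat) (s t : R)
    (psi_kp : kp_wave psi)
    (psi_from : from_exp psi P p q)
    (psi_to : to_exp psi Pt pt qt)
    (degree_psi : d1 = diffop_order P)
    (codegree_psi : d2 = diffop_order Pt)
    (min_gt0 : (0 < minn d1 d2)%N)
    (psi_ac : ac_fixed psi)
    (regular_x : forall x : R, s <= x -> p.[x%:C] != 0)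
    (regular_z : forall z : R, t <= z -> q.[z%:C] != 0)
    (psi_st : truncation_defined (wave_fun P p q) s t) :
  exists D : ratdiffop R,
    [/\ right_fourier psi D,
        ~ scalar_op D,
        (rorder D <= 2 * minn d1 d2)%N &
        reflects t (EEpsi_adj (wave_fun P p q) s t) D].
Proof.
set d := minn d1 d2.
have [A [r [r0 sA Ar Cpsi]]] := symmetric_factorization psi_kp psi_from psi_to psi_ac.
rewrite -degree_psi -codegree_psi -/d in sA.
have [p0 q0 Pe] := psi_from.
have P0 : P != 0.
  apply: contraTneq min_gt0 => P0; rewrite degree_psi P0 /diffop_order size_poly0.
  by rewrite min0n.
have t0 := truncation_nonneg P0 regular_x regular_z psi_st.
have A0q := intertwines_wave_fun P regular_x regular_z.
have Ar_st := intertwines_factor psi_kp psi_from regular_x regular_z Ar.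
have A0e := xact_cleared p0 Pe; set A0 := _ *: _ in A0q A0e.
(* C A0 e^{-xz} = q C psi = q r# e^{-xz}; an operator with the exponential as eigenfunction for all
   z has constant coefficients. *)
have CA0 : is_constop (ocomp (@rderiv R) (oadj (@rderiv R) (oconj A)) A0) (q * qsharp r).
  by apply/is_constop_fexp; rewrite xact_comp A0e xact_fmulz Cpsi fmulzM.
pose D := RatDiffop (reflecting_numerator r s%:C d) (oner_neq0 _).
have sD : size (numerator D) = d.+1 by exact: size_reflecting_numerator.
exists D; split.
- exact: right_fourier_reflecting Ar Cpsi.
(* A scalar operator has order 0, whereas D has order d > 0. *)
- move=> [c Dc]; have := size_polyC_leq1 (c *: denominator D).
  by rewrite -Dc sD ltnS leqNgt min_gt0.
- by rewrite /rorder /diffop_order sD /= -/d mul2n -addnn leq_addr.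
have rD : rorder D = d by rewrite /rorder /diffop_order sD.
(* One derivative more than the order of D, so that D(-z, -d_z) f is still continuous. *)
exists (test_fun t d.+1); first exact: test_fun_dense.
move=> f [a [b [ta sf smf]]]; split.
- by move=> z _; rewrite rD; apply: (csmooth_leq (leqnSn d) smf).
- exact: cfun_L2 (reflected_action_cfun s r ta sf smf _).
move=> z tz _; rewrite rD; split.
  apply: (transform_smooth t0 A0q regular_z (cfun_smooth ta sf smf)).
  by rewrite /= in_itv /= andbT.
exact: (reflection_on_test_fun t0 A0q Ar_st sA regular_z CA0 ta sf smf).
Qed.
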